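(* Let $\xi=(\xi_n)_{n\in\mathbb Z_+}$, $\xi_n=(X_n,\eta_n)$, be the time-homogeneous Markov process on the half-strip $\Sigma=\mathbb R_+\times S$ described in the context, with kernel $\mathcal K_s$. Suppose the following. (1) (Non-confinement) $\Pr(\limsup_{n\to\infty}X_n=\infty)=1$. (2) (Limiting kernel) $\mathcal K:S\times\mathcal B(S)\to[0,1]$ is a Markov kernel on $S$ that has a unique invariant probability measure $\pi\in\mathcal P(S)$, and $u\mapsto\mathcal K(u,\cdot)$ is continuous from $(S,d_S)$ to $(\mathcal P(S),d_{\mathrm{TV}})$. (3) (Asymptotic Markovianity) $\lim_{x\to\infty}\sup_{u\in S}\|\mathcal K_s^\circ(x,u,\cdot)-\mathcal K(u,\cdot)\|_{\mathrm{TV}}=0$. (4) (Moments) There are constants $p>2$, $q\ge2$, $x_B\in\mathbb R_+$ and $B_p,B_q<\infty$ such that, for all $n\in\mathbb Z_+$, $\mathbb E[|X_{n+1}-X_n|^p\mid\mathcal F_n]\le B_p$ on $\{X_n\ge x_B\}$ and $\mathbb E[|X_{n+1}|^q\mid\mathcal F_n]\le B_q$ on $\{X_n<x_B\}$. (5) (Strict Lamperti regime) There are $e,\sigma^2\in C_b(S)$ (values at $u$ written $e_u$, $\sigma_u^2$) such that, as $x\to\infty$, $\sup_{u\in S}|\mu_1(x,u)-\frac{e_u}{x}|=o(x^{-1})$ and $\sup_{u\in S}|\mu_2(x,u)-\sigma_u^2|=o(1)$. For $\theta\in\mathbb R$ set $\delta_\theta:=\int_S(2e_u+(2\theta-1)\sigma_u^2)\,\pi(du)$,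 and let $\tau_r:=\min\{n\in\mathbb Z_+:X_n\le r\}$ ($\min\emptyset:=\infty$). Then: (a) If $\delta_\theta<0$ for some $\theta>0$, then for any $s\in[0,\theta\wedge\frac p2\wedge\frac q2)$ there exists $r_1\in\mathbb R_+$ for which $\mathbb E[\tau_r^s]<\infty$ for all $r\ge r_1$. (b) If $\delta_\theta>0$ for some $\theta\in(0,\frac p2\wedge\frac q2]$, then for every $s>\theta$ and every $r\in\mathbb R_+$ there exists $r_1\in(r,\infty)$ for which $\mathbb E[\tau_r^s]=\infty$ provided $X_0=x_0$ satisfies $x_0>r_1$.
   Context: Notation: $\mathbb R_+=[0,\infty)$, $\mathbb Z_+=\{0,1,2,\dots\}$. $(S,d_S)$ is a compact metric space with Borel sets $\mathcal B(S)$; $\mathcal P(S)$ is the set of Borel probability measures on $S$; $C_b(S)$ is the set of continuous real functions on $S$. $\|\cdot\|_{\mathrm{TV}}$ is the total variation norm on finite signed Borel measures, $\|\nu\|_{\mathrm{TV}}=\sup\{\int f\,d\nu: f\in C_b(S),\ \sup|f|\le1\}$, and $d_{\mathrm{TV}}(\mu,\nu)=\frac12\|\mu-\nu\|_{\mathrm{TV}}$. A probability $\nu\in\mathcal P(S)$ is invariant for a Markov kernel $\mathcal K$ if $\nu(B)=\int_S\nu(du)\mathcal K(u,B)$ for all $B\in\mathcal B(S)$. The process: on a probability space with filtration $(\mathcal F_n)_{n\in\mathbb Z_+}$, $\xi=(\xi_n)$ is an adapted process in $\Sigma=\mathbb R_+\times S$ with $\xi_n=(X_n,\eta_n)$, $X_n\in\mathbb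 R_+$, $\eta_n\in S$, and $\mathcal K_s$ is a Markov kernel on $\Sigma$ with $\Pr(\xi_{n+1}\in A\mid\mathcal F_n)=\mathcal K_s(\xi_n,A)$ a.s. for all Borel $A\subseteq\Sigma$, $n\in\mathbb Z_+$. The initial state $\xi_0=(x_0,u_0)\in\Sigma$ is deterministic but arbitrary; statements imposing a condition on $x_0$ concern the process with the given kernel started from such an $x_0$. For $B\in\mathcal B(S)$, $\mathcal K_s^\circ(x,u,B):=\mathcal K_s((x,u),\mathbb R_+\times B)$. For $k\in\{1,2\}$ and $x\ge x_B$, $\mu_k(x,u):=\int_{\mathbb R_+\times S}(y-x)^k\,\mathcal K_s((x,u),d(y,v))$, so $\mathbb E[(X_{n+1}-X_n)^k\mid\mathcal F_n]=\mu_k(\xi_n)$ on $\{X_n\ge x_B\}$. *)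

(* Defs.v *)
From HB Require Import structures.
From mathcomp Require Import all_boot all_order all_algebra.
From mathcomp Require Import interval_inference.
From mathcomp Require Import mathcomp_extra boolp classical_sets functions.
From mathcomp Require Import cardinality fsbigop reals ereal topology normedtype.
From mathcomp Require Import sequences exp measure measurable_realfun.
From mathcomp Require Import lebesgue_measure lebesgue_integral numfun kernel.

Set Implicit Arguments.
Unset Strict Implicit.
Unset Printing Implicit Defensive.

Import Order.TTheory GRing.Theory Num.Theory.
Import numFieldNormedType.Exports.

Local Open Scope classical_set_scope.
Local Open Scope ring_scope.

(* The mixins do not relate the two structures: that the sigma-algebra is the
   Borel one has to be assumed separately. *)
#[short(type="measurableMetricType")]
HB.structure Definition MeasurableMetric (R : numDomainType)
  (d : measure_display) := {S of Metric R S & Measurable d S}.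

(* R_+ with its Borel sigma-algebra, the trace of that of R.  The state space
   R_+ x S carries the product sigma-algebra, which is the Borel one because
   R_+ and a compact metric S are second countable. *)
Definition halfline (R : realType) : Type := {nonneg R}.

Section halfline.
Variable R : realType.

HB.instance Definition _ := Choice.on (halfline R).
HB.instance Definition _ := isPointed.Build (halfline R) (0%:nng : {nonneg R}).

Definition hval (x : halfline R) : R := (x : {nonneg R})%:num.

Let halfline_measurable : set (set (halfline R)) :=
  preimage_set_system [set: halfline R] hval measurable.

Let halfline_sigma_algebra : sigma_algebra [set: halfline R] halfline_measurable.
Proof. exact/sigma_algebra_preimage/sigma_algebra_measurable. Qed.

Let halfline_measurable0 : halfline_measurable set0.
Proof. by case: halfline_sigma_algebra. Qed.

Let halfline_measurableC A :
  halfline_measurable A -> halfline_measurable (~` A).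
Proof.
by case: halfline_sigma_algebra => _ + _ => /[apply]; rewrite setTD.
Qed.

Let halfline_measurable_bigcup (F : (set (halfline R))^nat) :
  (forall i, halfline_measurable (F i)) -> halfline_measurable (\bigcup_i F i).
Proof. by case: halfline_sigma_algebra => _ _; apply. Qed.

HB.instance Definition _ := @isMeasurable.Build (preimage_display hval)
  (halfline R) halfline_measurable
  halfline_measurable0 halfline_measurableC halfline_measurable_bigcup.

Lemma measurable_hval : measurable_fun [set: halfline R] hval.
Proof. by move=> _ B mB; exists B. Qed.

Definition halfline_pinfty : set_system (halfline R) :=
  [set A | exists M : R, forall x : halfline R, M < hval x -> A x].

#[global] Instance halfline_pinfty_filter : ProperFilter halfline_pinfty.
Proof.
split.
  move=> [M MA]; have h : 0 <= `|M| + 1 by rewrite addr_ge0.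
  apply: (MA (NngNum h : halfline R)).
  by rewrite /hval /= (le_lt_trans (ler_norm _))// ltrDl.
split.
- by exists 0.
- move=> A B [M MA] [N NB]; exists (Num.max M N) => x.
  by rewrite gt_max => /andP[/MA ? /NB ?].
- by move=> A B AB [M MA]; exists M => x /MA /AB.
Qed.

End halfline.

Section total_variation.
Context (R : realType) (d : measure_display) (S : measurableMetricType R d).
Local Open Scope ereal_scope.

(* ||mu - nu||_TV for finite measures mu and nu, the integral against the signed
   measure mu - nu being the difference of the integrals. *)
Definition tv_norm_sub (mu nu : set S -> \bar R) : \bar R :=
  ereal_sup [set \int[mu]_u (f u)%:E - \int[nu]_u (f u)%:E | f in
    [set f : S -> R | continuous f /\ forall u, (`|f u| <= 1)%R]].

Definition tv_dist (mu nu : set S -> \bar R) : \bar R :=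
  (2^-1)%:E * tv_norm_sub mu nu.

End total_variation.

Section kernels.
Context (R : realType) (d : measure_display) (S : measurableMetricType R d).
Local Open Scope ereal_scope.

Definition invariant_probability (K : R.-pker S ~> S) (nu : probability S R) :=
  forall B : set S, measurable B -> nu B = \int[nu]_u K u B.

Variable Ks : R.-pker (halfline R * S)%type ~> (halfline R * S)%type.

Definition angular_kernel (x : halfline R) (u : S) : set S -> \bar R :=
  fun B => Ks (x, u) ([set: halfline R] `*` B).

(* mu_k(x,u); for a non-integrable integrand this is never a finite number
   (+oo - +oo is -oo). *)
Definition increment_moment (k : nat) (x : halfline R) (u : S) : \bar R :=
  \int[Ks (x, u)]_z ((hval z.1 - hval x) ^+ k)%:E.

End kernels.

(* f = o(g) as x -> oo in R_+ *)
Definition littleo_pinfty (R : realType) (f : halfline R -> \bar R)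
    (g : halfline R -> R) :=
  forall eps : R, 0 < eps ->
    \forall x \near @halfline_pinfty R, (`|f x| <= (eps * `|g x|)%:E)%E.

Definition delta (R : realType) d (S : measurableMetricType R d)
    (pi : probability S R) (e sigma2 : S -> R) (theta : R) : R :=
  \int[pi]_u (2 * e u + (2 * theta - 1) * sigma2 u).

Section processes.
Context (R : realType) (dO : measure_display) (Omega : measurableType dO)
        (P : probability Omega R).

Definition filtration (F : nat -> set (set Omega)) :=
  [/\ forall n, sigma_algebra [set: Omega] (F n),
      forall n, F n `<=` measurable &
      forall m n, (m <= n)%N -> F m `<=` F n].

(* Z is a version of E[Y | G], for Y measurable with values in [0,oo]; Y is not
   required to be integrable. *)
Definition cond_expectation (G : set (set Omega)) (Y Z : Omega -> \bar R) :=
  [/\ preimage_set_system [set: Omega] Z measurable `<=` G,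
      forall w, (0 <= Z w)%E &
      forall B, G B ->
        (\int[P]_(w in B) Z w)%E = (\int[P]_(w in B) Y w)%E].

Definition nonconfined (X : nat -> Omega -> R) :=
  P [set w | limn_esup (fun n => (X n w)%:E) = +oo%E] = 1%E.

Definition moment_bounds (F : nat -> set (set Omega)) (X : nat -> Omega -> R)
    (p q xB Bp Bq : R) :=
  forall n,
  (exists Z, cond_expectation (F n)
       (fun w => (`|X n.+1 w - X n w| `^ p)%:E) Z /\
     {ae P, forall w, xB <= X n w -> (Z w <= Bp%:E)%E}) /\
  (exists Z, cond_expectation (F n) (fun w => (`|X n.+1 w| `^ q)%:E) Z /\
     {ae P, forall w, X n w < xB -> (Z w <= Bq%:E)%E}).

(* The infimum is a minimum when the set is nonempty, and +oo when it is empty. *)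
Definition tau (X : nat -> Omega -> R) (r : R) (w : Omega) : \bar R :=
  ereal_inf [set (n%:R)%:E | n in [set n : nat | X n w <= r]].

Definition tau_moment (X : nat -> Omega -> R) (r s : R) : \bar R :=
  (\int[P]_w (tau X r w `^ s))%E.

Record halfstrip_process d (S : measurableMetricType R d)
    (Ks : R.-pker (halfline R * S)%type ~> (halfline R * S)%type)
    (x0 : halfline R) (u0 : S) (F : nat -> set (set Omega))
    (xi : nat -> Omega -> halfline R * S) : Prop := HalfstripProcess {
  halfstrip_filtration : filtration F ;
  halfstrip_adapted : forall n (A : set (halfline R * S)), measurable A ->
    F n (xi n @^-1` A) ;
  halfstrip_initial : forall w, xi 0%N w = (x0, u0) ;
  halfstrip_markov : forall n (A : set (halfline R * S)), measurable A ->
    cond_expectation (F n)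
      (fun w => (\1_(xi n.+1 @^-1` A) w)%:E) (fun w => Ks (xi n w) A)
}.

Definition radial d (S : measurableMetricType R d)
    (xi : nat -> Omega -> halfline R * S) (n : nat) (w : Omega) : R :=
  hval (xi n w).1.

End processes.

(* Main.v *)
(** Let g_theta = 2 e + (2 theta - 1) sigma2, so that delta_theta = \int g_theta dpi.
If delta_theta < 0, unique ergodicity makes the Cesaro averages of K^n g_theta
uniformly negative for some n, and summing them gives a continuous h with
g_theta + K h - h <= -c.  Since the angular part of the chain moves almost like K
far away, f(x, u) = (x^2 + h(u))^theta satisfies E f(next) <= exp(-c/x^2) f for
large x; the term h corrects the dependence of the drift on the angle.  Stopping
at the exit from (r, y) gives P(tau_r > n) <= C (exp(-c n/y^2) + y^(-2 theta)), and
y close to n^(1/2) makes the s-th moment of tau_r finite for s < theta.  If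
delta_theta > 0, the inequalities are reversed: f is a submartingale far away, and
f/(4 y^2)^theta, truncated at 1 and supplemented by a function of the radius near
the level y, loses at most a factor 1 - lam/y^2 per step.  Started from a large x0,
the chain thus stays above r for a number of steps of order y^2 with probability of
order at least y^(-2 theta), so that the s-th moment of tau_r is infinite for
s > theta. *)

Require Import Defs.
From HB Require Import structures.
From mathcomp Require Import all_boot all_order all_algebra.
From mathcomp Require Import interval_inference.
From mathcomp Require Import mathcomp_extra boolp classical_sets functions.
From mathcomp Require Import cardinality fsbigop reals ereal topology normedtype.
From mathcomp Require Import sequences exp measure measurable_realfun.
From mathcomp Require Import lebesgue_measure lebesgue_integral numfun kernel.
From mathcomp Require Import derive realfun ring lra.

Set Implicit Arguments.
Unset Strict Implicit.
Unset Printing Implicit Defensive.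

Import Order.TTheory GRing.Theory Num.Theory.
Import numFieldNormedType.Exports.

Local Open Scope classical_set_scope.
Local Open Scope ring_scope.

(** * Mean functionals on bounded measurable functions *)

(** Integrals, Cesaro averages, their limits along an ultrafilter and expectations over an event are
    all normalised, linear and monotone functionals, and continuity along decreasing sets turns such
    a functional into a probability. Continuity of K in total variation yields that continuity
    uniformly in the starting point, so an invariant limit is found without weak compactness. Two
    obstacles shape the drift estimates. The moment bound is assumed along the process only, hence
    is known for the kernel at almost every visited state; the drift inequalities take it as a
    pointwise premise and are then used almost surely. And increments are unbounded: the power is
    expanded with a global error |z|^p in the relative increment z, which confines the exponent to 2
    theta <= p. In (a) theta may be larger, but sigma2, a limit of second moments, is nonnegative,
    so delta_theta is nondecreasing in theta and theta can be lowered. In (b) the radial supplement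
    loses an absolute amount O(1/y^2); this becomes a factor because the truncated f has a positive
    lower bound at the radii below y where the supplement exceeds it. *)

Section bounded_measurable.
Context {d : measure_display} {T : measurableType d} {R : realType}.
Implicit Types (f g : T -> R) (P : probability T R).

Definition bounded_measurable f :=
  measurable_fun setT f /\ exists M, forall x, `|f x| <= M.

Lemma bounded_measurable_cst (c : R) : bounded_measurable (fun=> c).
Proof. by split => //; exists `|c|. Qed.

Lemma bounded_measurableD f g : bounded_measurable f -> bounded_measurable g ->
  bounded_measurable (fun x => f x + g x).
Proof.
move=> [mf [M fM]] [mg [N gN]]; split; first exact: measurable_funD.
by exists (M + N) => x; rewrite (le_trans (ler_normD _ _))// lerD.
Qed.

Lemma bounded_measurableZ (c : R) f : bounded_measurable f ->
  bounded_measurable (fun x => c * f x).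
Proof.
move=> [mf [M fM]]; split; first exact: measurable_funM.
by exists (`|c| * M) => x; rewrite normrM ler_wpM2l.
Qed.

Lemma bounded_measurableB f g : bounded_measurable f -> bounded_measurable g ->
  bounded_measurable (fun x => f x - g x).
Proof.
move=> bf bg; have := bounded_measurableD bf (bounded_measurableZ (-1) bg).
by congr bounded_measurable; apply/funext => x; rewrite mulN1r.
Qed.

Lemma bounded_measurable_norm f : bounded_measurable f ->
  bounded_measurable (fun x => `|f x|).
Proof.
move=> [mf [M fM]]; split; first exact: measurableT_comp.
by exists M => x; rewrite normr_id.
Qed.

Lemma bounded_measurable_sum n (F : nat -> T -> R) :
  (forall k, bounded_measurable (F k)) ->
  bounded_measurable (fun x => \sum_(k < n) F k x).
Proof.
move=> bF; elim: n => [|n IHn].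
  have -> : (fun x => \sum_(k < 0) F k x) = (fun=> 0).
    by apply/funext => x; rewrite big_ord0.
  exact: bounded_measurable_cst.
have -> : (fun x => \sum_(k < n.+1) F k x) =
    (fun x => \sum_(k < n) F k x + F n x).
  by apply/funext => x; rewrite big_ord_recr.
exact: bounded_measurableD.
Qed.

Lemma bounded_measurable_indic (A : set T) : measurable A ->
  bounded_measurable (\1_A : T -> R).
Proof.
move=> mA; split; first exact: measurable_indic.
by exists 1 => x; rewrite indicE; case: (x \in A); rewrite ?normr1 ?normr0.
Qed.

Lemma bounded_measurable_integrable P f : bounded_measurable f ->
  P.-integrable setT (EFin \o f).
Proof.
move=> [mf [M fM]]; apply: measurable_bounded_integrable => //.
  by rewrite (le_lt_trans (probability_le1 P measurableT))// ltry.
exists `|M|; split; first exact: num_real.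
move=> y My x _ /=; rewrite (le_trans (fM x))// (le_trans (ler_norm _))//.
exact: ltW.
Qed.

Lemma Rintegral_indic P (A : set T) : measurable A ->
  \int[P]_x \1_A x = fine (P A).
Proof. by move=> mA; rewrite /Rintegral integral_indic// setIT. Qed.

Lemma EFin_Rintegral P f : bounded_measurable f ->
  (\int[P]_x (f x)%:E)%E = (\int[P]_x f x)%:E.
Proof.
move=> bf; rewrite /Rintegral fineK//.
exact: integrable_fin_num (bounded_measurable_integrable _ bf).
Qed.

(** No continuity is required: besides integrals the notion has to cover limits along an
    ultrafilter, whose countable additivity must be proved. *)
Definition mean_functional (L : (T -> R) -> R) := [/\ L (fun=> 1) = 1,
  forall f g, bounded_measurable f -> bounded_measurable g ->
    L (fun x => f x + g x) = L f + L g,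
  forall c f, bounded_measurable f -> L (fun x => c * f x) = c * L f &
  forall f g, bounded_measurable f -> bounded_measurable g ->
    (forall x, f x <= g x) -> L f <= L g].

Lemma mean_functional_probability P :
  mean_functional (fun f => \int[P]_x f x).
Proof.
split.
- by rewrite Rintegral_cst// mul1r (congr1 fine (probability_setT P)).
- by move=> f g bf bg; rewrite RintegralD//; exact: bounded_measurable_integrable.
- by move=> c f bf; rewrite RintegralZl//; exact: bounded_measurable_integrable.
- move=> f g bf bg fg; apply: le_Rintegral => //;
  exact: bounded_measurable_integrable.
Qed.

Section functional.
Variables (L : (T -> R) -> R) (ML : mean_functional L).

Lemma mean_functional_cst c : L (fun=> c) = c.
Proof.
have [L1 _ LZ _] := ML.
have -> : (fun=> c) = (fun _ : T => c * 1) by apply/funext => x; rewrite mulr1.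
by rewrite (LZ c (fun=> 1)) ?L1 ?mulr1//; exact: bounded_measurable_cst.
Qed.

Lemma mean_functionalB f g : bounded_measurable f -> bounded_measurable g ->
  L (fun x => f x - g x) = L f - L g.
Proof.
have [_ LD LZ _] := ML => bf bg.
have -> : (fun x => f x - g x) = (fun x => f x + -1 * g x).
  by apply/funext => x; rewrite mulN1r.
by rewrite LD ?LZ ?mulN1r//; exact: bounded_measurableZ.
Qed.

Lemma mean_functional_sum n (F : nat -> T -> R) :
  (forall k, bounded_measurable (F k)) ->
  L (fun x => \sum_(k < n) F k x) = \sum_(k < n) L (F k).
Proof.
move=> bF; have [_ LD _ _] := ML; elim: n => [|n IHn].
  rewrite big_ord0 -[RHS]mean_functional_cst; congr L.
  by apply/funext => x; rewrite big_ord0.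
rewrite big_ord_recr /= -IHn -LD//; last exact: bounded_measurable_sum.
by congr L; apply/funext => x; rewrite big_ord_recr.
Qed.

Lemma mean_functional_norm f (c : R) : bounded_measurable f ->
  (forall x, `|f x| <= c) -> `|L f| <= c.
Proof.
have [_ _ _ Lle] := ML => bf fc; rewrite ler_norml; apply/andP; split.
  rewrite -(mean_functional_cst (- c)); apply: Lle => //.
    exact: bounded_measurable_cst.
  by move=> x; have := fc x; rewrite ler_norml => /andP[].
rewrite -(mean_functional_cst c); apply: Lle => //.
  exact: bounded_measurable_cst.
by move=> x; have := fc x; rewrite ler_norml => /andP[].
Qed.

End functional.

(** The sum counts the integers among 1, ..., n that do not exceed y, so it is the integer part of
    y. *)
Lemma count_le_bounds n (y : R) : 0 <= y <= n%:R ->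
  \sum_(j < n) (j.+1%:R <= y)%R%:R <= y <= \sum_(j < n) (j.+1%:R <= y)%R%:R + 1.
Proof.
move=> /andP[y0 yn].
have ubn m : \sum_(j < m) (j.+1%:R <= y)%R%:R <= m%:R :> R.
  rewrite -[leRHS](_ : \sum_(j < m) 1 = _); last by rewrite sumr_const card_ord.
  by apply: ler_sum => j _; case: (j.+1%:R <= y)%R; rewrite /= ?mulr0n ?mulr1n ?ler01.
apply/andP; split.
  elim: n {yn} => [|n IHn]; first by rewrite big_ord0.
  rewrite big_ord_recr /=; have [ny|_] := leP n.+1%:R y; last by rewrite addr0.
  by apply: le_trans ny; rewrite -natr1; exact: lerD (ubn n) (lexx _).
elim: n yn => [|n IHn] yn; first by rewrite big_ord0 add0r (le_trans yn).
rewrite big_ord_recr /=; have [yn'|ny] := leP y n%:R.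
  by rewrite (le_trans (IHn yn'))// lerD2r lerDl.
have nE : n%:R = \sum_(j < n) 1 :> R by rewrite sumr_const card_ord.
rewrite (le_trans yn)// -natr1 lerD2r [leLHS]nE -[leLHS]addr0 lerD//.
apply: ler_sum => j _.
by rewrite (le_trans _ (ltW ny))// ler_nat.
Qed.

(* For 0 <= f <= 1, the step function counting the levels (j+1)/n reached by f
   is within 1/n of f and a combination of indicators. *)
Lemma mean_functional_ext (L I : (T -> R) -> R) :
  mean_functional L -> mean_functional I ->
  (forall A, measurable A -> L \1_A = I \1_A) ->
  forall f, bounded_measurable f -> L f = I f.
Proof.
move=> ML MI LI.
have unit_case f : measurable_fun setT f -> (forall x, 0 <= f x <= 1) -> L f = I f.
  move=> mf f01.
  have bf : bounded_measurable f.
    split => //; exists 1 => x; have /andP[f0 f1] := f01 x.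
    by rewrite ger0_norm.
  pose A n j := [set x | j.+1%:R <= n.+1%:R * f x].
  have mA n j : measurable (A n j).
    rewrite -[A n j]setTI; apply: measurable_fun_le => //.
    exact: measurable_funM.
  pose s n (x : T) : R := n.+1%:R^-1 * \sum_(j < n.+1) \1_(A n j) x.
  have bs n : bounded_measurable (fun x : T => \sum_(j < n.+1) \1_(A n j) x : R).
    apply: (@bounded_measurable_sum n.+1 (fun j => \1_(A n j))) => j.
    exact: bounded_measurable_indic.
  have sf n x : `|f x - s n x| <= n.+1%:R^-1.
    have /andP[f0 f1] := f01 x.
    have yn : 0 <= n.+1%:R * f x <= n.+1%:R by rewrite mulr_ge0//= ger_pMr.
    have n0 : 0 < n.+1%:R^-1 :> R by rewrite invr_gt0.
    have /andP[lo hi] := count_le_bounds yn.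
    have E : \sum_(j < n.+1) \1_(A n j) x = \sum_(j < n.+1) (j.+1%:R <= n.+1%:R * f x)%R%:R :> R.
      by apply: eq_bigr => j _; rewrite indicE /A mem_setE.
    have fE : f x = n.+1%:R^-1 * (n.+1%:R * f x) by rewrite mulKf.
    rewrite ger0_norm; first by rewrite {1}fE /s E -mulrBr ger_pMr// lerBlDl.
    by rewrite {1}fE /s E -mulrBr mulr_ge0 ?(ltW n0)// subr_ge0.
  have LIs n : L (s n) = I (s n).
    have [_ _ LZ _] := ML; have [_ _ IZ _] := MI.
    have bA j : bounded_measurable (\1_(A n j) : T -> R).
      exact: bounded_measurable_indic.
    rewrite /s LZ// IZ// (mean_functional_sum ML n.+1 bA).
    rewrite (mean_functional_sum MI n.+1 bA).
    by congr (_ * _); apply: eq_bigr => j _; exact: LI.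
  have bsn n : bounded_measurable (s n) by exact: bounded_measurableZ.
  have close n : `|L f - I f| <= 2 * n.+1%:R^-1.
    have -> : L f - I f = (L f - L (s n)) - (I f - I (s n)) by rewrite LIs; ring.
    rewrite (le_trans (ler_normB _ _))// mulr_natl mulr2n lerD//.
      rewrite -mean_functionalB//; apply: mean_functional_norm => //.
      exact: bounded_measurableB.
    rewrite -mean_functionalB//; apply: mean_functional_norm => //.
    exact: bounded_measurableB.
  apply/eqP; rewrite -subr_eq0 -normr_le0; apply/ler_addgt0Pr => e e0.
  rewrite add0r.
  have e20 : 0 < e / 2 by rewrite divr_gt0.
  have [n _ /(_ n (leqnn n)) /= ne] := near_infty_natSinv_lt (PosNum e20).
  by rewrite (le_trans (close n))// -ler_pdivlMl// mulrC ltW.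
move=> f [mf [M fM]].
pose N := `|M| + 1.
have N0 : 0 < N by rewrite ltr_wpDl.
have fN x : `|f x| <= N.
  by rewrite (le_trans (fM x))// (le_trans (ler_norm _))// lerDl.
pose g x := (2 * N)^-1 * (f x + N).
have N20 : 0 < 2 * N by rewrite mulr_gt0.
have mg : measurable_fun setT g by apply: measurable_funM => //; exact: measurable_funD.
have g01 x : 0 <= g x <= 1.
  have := fN x; rewrite ler_norml => /andP[fl fr].
  rewrite /g mulrC ler_pdivrMr// divr_ge0 ?(ltW N20)//=; first lra.
  by lra.
have bg : bounded_measurable g.
  by split => //; exists 1 => x; have /andP[g0 g1] := g01 x; rewrite ger0_norm.
have fE : f = (fun x => 2 * N * g x + - N).
  by apply/funext => x; rewrite /g mulVKf ?gt_eqF// addrK.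
have bc : bounded_measurable (fun _ : T => - N) by exact: bounded_measurable_cst.
have bZ : bounded_measurable (fun x => 2 * N * g x) by exact: bounded_measurableZ.
have [_ LD LZ _] := ML; have [_ ID IZ _] := MI.
rewrite fE LD// ID// LZ// IZ// (unit_case g)//.
by rewrite (mean_functional_cst ML) (mean_functional_cst MI).
Qed.

(** Continuity along decreasing sets with empty intersection is what upgrades the finite additivity
    of indicators to countable additivity; simple functions then determine the functional. *)
Lemma mean_functional_representation (L : (T -> R) -> R) : mean_functional L ->
  (forall B : (set T)^nat, (forall n, measurable (B n)) ->
    (forall n, B n.+1 `<=` B n) -> \bigcap_n B n = set0 ->
    L \1_(B n) @[n --> \oo] --> 0) ->
  exists nu : probability T R,
    forall f, bounded_measurable f -> L f = \int[nu]_x f x.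
Proof.
move=> ML Lcont; have [L1 LD LZ Lle] := ML.
have bi (A : set T) : measurable A -> bounded_measurable (\1_A : T -> R).
  exact: bounded_measurable_indic.
(* The default 0 off the sigma-algebra keeps [nu] nonnegative on all sets. *)
pose nu (A : set T) : \bar R := if `[< measurable A >] then (L \1_A)%:E else 0%E.
have nuE A : measurable A -> nu A = (L \1_A)%:E by move=> mA; rewrite /nu asboolT.
have indic0 : (\1_set0 : T -> R) = (fun=> 0).
  by apply/funext => x; rewrite indicE in_set0.
have nu0 : nu set0 = 0%E by rewrite nuE// indic0 (mean_functional_cst ML).
have nu_ge0 A : (0 <= nu A)%E.
  rewrite /nu; case: asboolP => // mA.
  rewrite lee_fin -(mean_functional_cst ML 0); apply: Lle; first exact: bounded_measurable_cst.
    exact: bi.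
  by move=> x; rewrite indicE ler0n.
have nu_sigma : semi_sigma_additive nu.
  move=> F mF tF mUF.
  (* Tails of the disjoint union: they decrease to the empty set, and the value of the union is the
     n-th partial sum plus that of the n-th tail. *)
  pose B n := \bigcup_(i in [set i | (n <= i)%N]) F i.
  have mB n : measurable (B n) by exact: bigcup_measurable.
  have B0 : B 0%N = \bigcup_i F i.
    by apply/seteqP; split => x [i _ Fx]; exists i.
  have BS n : B n = F n `|` B n.+1.
    apply/seteqP; split => x.
      move=> [i /=]; rewrite leq_eqVlt => /predU1P[<-|ni] Fx; first by left.
      by right; exists i.
    by move=> [Fx|[i /= ni Fx]]; [exists n => /=|exists i => //=; exact: ltnW].
  have FBd n x : F n x -> B n.+1 x -> False.
    move=> Fx [i /= ni Fix]; have /trivIsetP := tF => /(_ n i I I).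
    by rewrite (ltn_eqF ni) => /(_ isT); apply/eqP/set0P; exists x.
  have indS n : (\1_(B n) : T -> R) = (fun x => \1_(F n) x + \1_(B n.+1) x).
    apply/funext => x; rewrite !indicE BS in_setU.
    have [/set_mem Fx|_] := boolP (x \in F n); last by rewrite add0r.
    by have [/set_mem/(FBd _ _ Fx)//|_] := boolP (x \in B n.+1); rewrite addr0.
  have LE n : L \1_(\bigcup_i F i) = \sum_(0 <= i < n) L \1_(F i) + L \1_(B n).
    elim: n => [|n ->]; first by rewrite big_geq// add0r B0.
    rewrite big_nat_recr//= -addrA; congr (_ + _).
    by rewrite {1}indS LD//; exact: bi.
  have Lc : L \1_(B n) @[n --> \oo] --> 0.
    apply: Lcont => // [n|]; first by rewrite (BS n).
    rewrite -subset0 => x Bx; have [i _ Fx] := Bx 0%N I.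
    exact: FBd Fx (Bx i.+1 I).
  have -> : (fun n => \sum_(0 <= i < n) nu (F i))%E =
      EFin \o (fun n => L \1_(\bigcup_i F i) - L \1_(B n)).
    apply/funext => n /=; rewrite (LE n) addrK -sumEFin.
    by apply: eq_bigr => i _; rewrite nuE.
  rewrite nuE//.
  apply: cvg_EFin; first exact: nearW.
  by rewrite -[X in _ --> X]subr0; apply: cvgB => //; exact: cvg_cst.
have nuT : nu setT = 1%E.
  rewrite nuE// (_ : \1_setT = (fun=> 1)) ?L1//.
  by apply/funext => x; rewrite indicE in_setT.
pose num : {measure set T -> \bar R} := HB.pack nu
  (isMeasure.Build _ _ _ nu nu0 nu_ge0 nu_sigma).
pose nuP : probability T R := HB.pack (Measure.sort num)
  (Measure_isProbability.Build _ _ _ num nuT).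
exists nuP => f bf.
have bimean := mean_functional_probability nuP.
apply: (mean_functional_ext ML bimean) => // A mA.
by rewrite Rintegral_indic//= nuE.
Qed.

Lemma bounded_cvg_Rintegral P (f_ : nat -> T -> R) :
  (forall n, bounded_measurable (f_ n)) ->
  (forall n u, `|f_ n u| <= 1) -> (forall u, f_ n u @[n --> \oo] --> 0) ->
  (\int[P]_u f_ n u) @[n --> \oo] --> 0.
Proof.
move=> bf f1 f0.
have -> : (fun n => \int[P]_u f_ n u) = fine \o (fun n => \int[P]_u (f_ n u)%:E)%E by [].
apply: fine_cvg.
have i0 : (\int[P]_(u in setT) (0 : \bar R))%E = 0%:E by exact: integral0.
rewrite -i0.
apply: (@dominated_cvg _ _ _ _ _ measurableT _ _ (fun=> 1%E)) => //.
- by move=> n; apply/measurable_EFinP; have [] := bf n.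
- by move=> u _; apply: cvg_EFin; [exact: nearW|exact: f0].
- exact: (bounded_measurable_integrable P (bounded_measurable_cst 1)).
- by move=> n u _ /=; rewrite lee_fin.
Qed.

(** Sequential continuity makes both functionals integrals, so agreement on a pi-system spreads to
    the sigma-algebra by uniqueness of measures. *)
Lemma mean_functional_pi_system (L I : (T -> R) -> R) (G : set (set T)) :
  mean_functional L -> mean_functional I ->
  (forall f_ : nat -> T -> R, (forall n, bounded_measurable (f_ n)) ->
    (forall n x, `|f_ n x| <= 1) -> (forall x, f_ n x @[n --> \oo] --> 0) ->
    L (f_ n) @[n --> \oo] --> 0 /\ I (f_ n) @[n --> \oo] --> 0) ->
  measurable = <<s G >> -> setI_closed G -> G setT ->
  (forall A, G A -> L \1_A = I \1_A) ->
  forall f, bounded_measurable f -> L f = I f.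
Proof.
move=> ML MI LIc mG GI GT LI.
have indic_cvg (B : (set T)^nat) : (forall n, measurable (B n)) ->
    (forall n, B n.+1 `<=` B n) -> \bigcap_n B n = set0 ->
    L \1_(B n) @[n --> \oo] --> 0 /\ I \1_(B n) @[n --> \oo] --> 0.
  move=> mB BS B0; apply: LIc.
  - by move=> n; exact: bounded_measurable_indic.
  - by move=> n x; rewrite indicE; case: (_ \in _); rewrite ?normr0 ?normr1.
  - move=> x; have : ~ (\bigcap_n B n) x by rewrite B0.
    move=> /existsNP[m /not_implyP[_ nBm]].
    apply: cvg_near_cst; exists m => // n /= mn.
    rewrite indicE memNset// => Bn; apply: nBm; move: Bn.
    rewrite -(subnKC mn); elim: (n - m)%N => [|k IHk]; first by rewrite addn0.
    by rewrite addnS => /BS.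
have [nuL nuLE] := mean_functional_representation ML
  (fun B mB BS B0 => (indic_cvg B mB BS B0).1).
have [nuI nuIE] := mean_functional_representation MI
  (fun B mB BS B0 => (indic_cvg B mB BS B0).2).
have GM A : G A -> measurable A by move=> GA; rewrite mG; exact: sub_sigma_algebra.
have nuE A : measurable A -> nuL A = nuI A.
  apply: (measure_unique G (fun=> setT)) => //.
  - by rewrite bigcup_const.
  - move=> B GB; have mB := GM _ GB.
    rewrite -[LHS]fineK ?fin_num_measure// -[RHS]fineK ?fin_num_measure//.
    rewrite -!Rintegral_indic// -nuLE ?LI ?nuIE//; exact: bounded_measurable_indic.
  - by move=> k; rewrite (le_lt_trans (probability_le1 _ _))// ltry.
apply: (mean_functional_ext ML MI) => A mA.
rewrite nuLE; last exact: bounded_measurable_indic.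
rewrite nuIE; last exact: bounded_measurable_indic.
by rewrite !Rintegral_indic// nuE.
Qed.

End bounded_measurable.

(** * Total variation *)

Section continuous_approximation.
Context {R : realType} {d : measure_display} {S : measurableMetricType R d}.
Hypothesis S_borel : @measurable d S = <<s @open S >>.
Implicit Types (f g : S -> R) (P Q : probability S R).

Lemma continuous_measurable f : continuous f -> measurable_fun setT f.
Proof.
move=> cf; apply: (measurability _ (RGenOpens.measurableE R)).
move=> _ [_ [a [b ->]] <-]; rewrite setTI S_borel.
apply: sub_sigma_algebra; apply: open_comp => [x _|]; first exact: cf.
exact: interval_open.
Qed.

Section approximation.
Variables (L : (S -> R) -> R) (ML : mean_functional L).
Hypothesis L_cvg : forall f_ : nat -> S -> R,
  (forall n, bounded_measurable (f_ n)) ->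
  (forall n u, `|f_ n u| <= 1) -> (forall u, f_ n u @[n --> \oo] --> 0) ->
  L (f_ n) @[n --> \oo] --> 0.

Definition unit_continuous g := continuous g /\ forall u, 0 <= g u <= 1.

(** Indicators that are L-limits of continuous functions with values in [0, 1]. These sets contain
    the open ones and form a sigma-algebra, hence are all the Borel sets. *)
Let approximable (B : set S) := measurable B /\ forall e : R, 0 < e ->
  exists2 g, unit_continuous g & L (fun u => `|g u - \1_B u|) <= e.

Let unit_bounded g : unit_continuous g -> bounded_measurable g.
Proof.
move=> [cg g01]; split; first exact: continuous_measurable.
by exists 1 => u; have /andP[g0 g1] := g01 u; rewrite ger0_norm.
Qed.

Let dist_bounded f g : bounded_measurable f -> bounded_measurable g ->
  bounded_measurable (fun u => `|f u - g u|).
Proof. by move=> bf bg; apply: bounded_measurable_norm; exact: bounded_measurableB. Qed.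

Let indic_bounded (B : set S) : measurable B -> bounded_measurable (\1_B : S -> R).
Proof. exact: bounded_measurable_indic. Qed.

Let approximable0 : approximable set0.
Proof.
split=> // e e0; exists (fun=> 0).
  by split=> [u|u]; [exact: cvg_cst|rewrite lexx ler01].
rewrite (_ : (fun u => _) = (fun=> 0)) ?(mean_functional_cst ML) ?ltW//.
by apply/funext => u; rewrite indicE in_set0 subrr normr0.
Qed.

Let approximableC B : approximable B -> approximable (~` B).
Proof.
move=> [mB aB]; split; first exact: measurableC.
move=> e /aB[g [cg g01] gB]; exists (fun u => 1 - g u).
  split=> [u|u]; first by apply: cvgB; [exact: cvg_cst|exact: cg].
  by have /andP[g0 g1] := g01 u; rewrite subr_ge0 g1 gerBl.
apply: le_trans gB; rewrite le_eqVlt; apply/orP; left; apply/eqP; congr L.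
apply/funext => u; rewrite !indicE in_setC distrC.
by case: (u \in B) => /=; rewrite ?mulr0n ?mulr1n; congr (`|_|); ring.
Qed.

Let approximableU A B : approximable A -> approximable B ->
  approximable (A `|` B).
Proof.
move=> [mA aA] [mB aB]; split; first exact: measurableU.
move=> e e0; have e20 : 0 < e / 2 by rewrite divr_gt0.
have [f uf fA] := aA _ e20; have [g ug gB] := aB _ e20.
(* Pointwise, the distance from [max f g] to the indicator of the union is at most the sum of the
   two given distances. *)
have um : unit_continuous (fun u => Num.max (f u) (g u)).
  have [[cf f01] [cg g01]] := (uf, ug); split.
    move=> u; exact: (@continuous_max _ _ f g u (cf u) (cg u)).
  move=> u; have /andP[f0 f1] := f01 u; have /andP[g0 g1] := g01 u.
  by rewrite le_max f0 /= ge_max f1 g1.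
exists (fun u => Num.max (f u) (g u)) => //.
have mAB := measurableU _ _ mA mB.
have [_ LD _ Lle] := ML; rewrite [e]splitr.
apply: (le_trans _ (lerD fA gB)); rewrite -LD; last 2 first.
  by apply: dist_bounded; [exact: unit_bounded|exact: indic_bounded].
  by apply: dist_bounded; [exact: unit_bounded|exact: indic_bounded].
apply: Lle.
- by apply: dist_bounded; [exact: unit_bounded|exact: indic_bounded].
- apply: bounded_measurableD; apply: dist_bounded;
    by [exact: unit_bounded|exact: indic_bounded].
move=> u; have [_ /(_ u)/andP[f0 f1]] := uf; have [_ /(_ u)/andP[g0 g1]] := ug.
rewrite !indicE in_setU; case: (u \in A); case: (u \in B) => /=;
  rewrite ?mulr0n ?mulr1n; have [fg|gf] := leP (f u) (g u);
  rewrite ?subr0 ?(ger0_norm f0) ?(ger0_norm g0) ?lerDr ?lerDl//.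
all: by rewrite ?(distrC (g u)) ?(distrC (f u)) !ger0_norm ?subr_ge0//; lra.
Qed.

Let approximable_bigcup (F : (set S)^nat) : (forall i, approximable (F i)) ->
  approximable (\bigcup_i F i).
Proof.
move=> aF; have mF : measurable (\bigcup_i F i).
  by apply: bigcup_measurable => i _; have [] := aF i.
split=> // e e0; have e20 : 0 < e / 2 by rewrite divr_gt0.
pose G n := \big[setU/set0]_(i < n) F i.
have aG n : approximable (G n).
  elim: n => [|n IHn]; first by rewrite /G big_ord0.
  by rewrite /G big_ord_recr; exact: approximableU.
have mG n : measurable (G n) by have [] := aG n.
have GF n : G n `<=` \bigcup_i F i.
  by rewrite /G -bigcup_mkord; apply: bigcup_sub => i _; exact: bigcup_sup.
have bd n : bounded_measurable (fun u => `|\1_(G n) u - \1_(\bigcup_i F i) u| : R).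
  by apply: dist_bounded; exact: indic_bounded.
have /cvgr_dist_le/(_ _ e20)[n _ /(_ n (leqnn n))] :
    L (fun u => `|\1_(G n) u - \1_(\bigcup_i F i) u|) @[n --> \oo] --> 0.
  apply: L_cvg => //.
    move=> n u; rewrite !indicE; case: (_ \in _); case: (_ \in _);
    by rewrite ?subrr ?subr0 ?sub0r ?normrN ?normr0 ?normr1.
  move=> u; have [[i _ Fu]|nFu] := pselect ((\bigcup_i F i) u).
    apply: cvg_near_cst; exists i.+1 => // n /= ni.
    rewrite !indicE mem_set; last first.
      by rewrite /G -bigcup_mkord; exists i.
    by rewrite mem_set ?subrr ?normr0//; exists i.
  apply: cvg_near_cst; apply: nearW => n.
  rewrite !indicE memNset; last by move=> /GF.
  by rewrite memNset// subrr normr0.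
rewrite sub0r normrN => /(le_trans (ler_norm _)) Gn.
have [g ug gG] := (aG n).2 _ e20; exists g => //.
have bg := unit_bounded ug.
have [_ LD _ Lle] := ML; rewrite [e]splitr.
apply: (le_trans _ (lerD gG Gn)); rewrite -LD//; last first.
  by apply: dist_bounded => //; exact: indic_bounded.
apply: Lle => //.
- by apply: dist_bounded => //; exact: indic_bounded.
- apply: bounded_measurableD => //; apply: dist_bounded => //; exact: indic_bounded.
- by move=> u; rewrite (le_trans _ (ler_normD _ _))// addrA subrK.
Qed.

Let approximable_open (U : set S) : open U -> approximable U.
Proof.
move=> oU; have mU : measurable U by rewrite S_borel; exact: sub_sigma_algebra.
split=> // e e0.
(* The sets [C n] exhaust U and stay at a positive distance from its complement, so Urysohn
   functions converge pointwise to the indicator of U. *)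
pose C n := [set u : S | ball u n.+1%:R^-1 `<=` U].
have sep n : uniform_separator (~` U) (C n).
  apply: uniform_separatorW.
  exists [set uv : S * S | ball uv.1 n.+1%:R^-1 uv.2].
    by apply: (entourage_ball _ (PosNum (_ : 0 < n.+1%:R^-1))); rewrite invr_gt0.
  rewrite -subset0 => -[u v] [[/= nUu Cv] /= uv].
  by apply/nUu/Cv; exact: ball_sym.
pose g n := @Urysohn S R (~` U) (C n).
have ug n : unit_continuous (g n).
  split; first exact: Urysohn_continuous.
  move=> u; have : range (g n) (g n u) by exists u.
  by move/(@Urysohn_range S R (~` U) (C n)); rewrite /= in_itv.
have g0 n u : ~ U u -> g n u = 0.
  by move=> Uu; apply: (@Urysohn_sub0 S R _ _ (sep n)); exists u.
have g1 n u : C n u -> g n u = 1.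
  by move=> Cu; apply: (@Urysohn_sub1 S R _ _ (sep n)); exists u.
have /cvgr_dist_le/(_ _ e0)[n _ /(_ n (leqnn n))] :
    L (fun u => `|g n u - \1_U u|) @[n --> \oo] --> 0.
  apply: L_cvg => //.
  - move=> n; apply: dist_bounded; first exact: unit_bounded.
    exact: indic_bounded.
  - move=> n u; have [_ /(_ u)/andP[gn0 gn1]] := ug n.
    rewrite normr_id indicE; case: (_ \in _) => /=.
      by rewrite distrC ger0_norm ?subr_ge0// gerBl.
    by rewrite subr0 ger0_norm.
  - move=> u; have [Uu|nUu] := pselect (U u); last first.
      apply: cvg_near_cst; apply: nearW => n.
      by rewrite g0// indicE memNset// subrr normr0.
    have : nbhs u U by exact: open_nbhs_nbhs.
    move=> /nbhs_ballP[r /= r0 rU].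
    apply: cvg_near_cst.
    near=> n; rewrite g1 ?indicE ?mem_set ?subrr ?normr0//.
    apply: subset_trans rU; apply: le_ball; apply: ltW.
    by near: n; exact: (near_infty_natSinv_lt (PosNum r0)).
rewrite sub0r normrN => /(le_trans (ler_norm _)) Gn.
by exists (g n).
Unshelve. all: end_near. Qed.

Lemma continuous_approximation_indic (B : set S) : measurable B ->
  forall e : R, 0 < e -> exists2 g, unit_continuous g &
    L (fun u => `|g u - \1_B u|) <= e.
Proof.
suff : @measurable d S `<=` approximable by move=> /[apply] -[].
rewrite S_borel; apply: smallest_sub; last exact: approximable_open.
split; first exact: approximable0.
- by move=> A aA; rewrite setTD; exact: approximableC.
- exact: approximable_bigcup.
Qed.

End approximation.

Local Notation tv := (@tv_norm_sub R d S).

Lemma tv_norm_sub_Rintegral P Q g (t : R) : continuous g ->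
  (forall u, `|g u| <= 1) -> (tv P Q <= t%:E)%E ->
  `|\int[P]_u g u - \int[Q]_u g u| <= t.
Proof.
move=> cg g1 tvt.
have one_side f : continuous f -> (forall u, `|f u| <= 1) ->
    \int[P]_u f u - \int[Q]_u f u <= t.
  move=> cf f1; have bf : bounded_measurable f.
    by split; [exact: continuous_measurable|exists 1].
  rewrite -lee_fin EFinB -!EFin_Rintegral//; apply: le_trans tvt.
  by apply: ereal_sup_ubound; exists f.
have bg : bounded_measurable g by split; [exact: continuous_measurable|exists 1].
rewrite ler_norml one_side// andbT.
have := one_side (fun u => -1 * g u).
have [_ _ LZ _] := mean_functional_probability P; rewrite LZ//.
have [_ _ LZ' _] := mean_functional_probability Q; rewrite LZ'//.
have cNg : continuous (fun u => -1 * g u).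
  by move=> u; apply: cvgM; [exact: cvg_cst|exact: cg].
by move=> /(_ cNg) h; rewrite lerNl; move: h; rewrite !mulN1r opprK addrC opprB; apply => u;
  rewrite mulN1r normrN.
Qed.

(** The norm tests continuous functions only, so the indicator is first replaced by one.
    Approximating for the half-sum L of P and Q within e/2 bounds the sum of the errors under P and
    under Q by e. *)
Lemma tv_norm_sub_setwise P Q (B : set S) (t : R) : measurable B ->
  (tv P Q <= t%:E)%E -> `|fine (P B) - fine (Q B)| <= t.
Proof.
move=> mB tvt; apply/ler_addgt0Pr => e e0.
pose L f := 2^-1 * (\int[P]_u f u + \int[Q]_u f u).
have [P1 PD PZ Ple] := mean_functional_probability P.
have [Q1 QD QZ Qle] := mean_functional_probability Q.
have ML : mean_functional L.
  split.
  - by rewrite /L P1 Q1; field.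
  - by move=> f g bf bg; rewrite /L PD// QD//; ring.
  - by move=> c f bf; rewrite /L PZ// QZ//; ring.
  - by move=> f g bf bg fg; rewrite /L ler_wpM2l// lerD//; [exact: Ple|exact: Qle].
have Lc (f_ : nat -> S -> R) : (forall n, bounded_measurable (f_ n)) ->
  (forall n u, `|f_ n u| <= 1) -> (forall u, f_ n u @[n --> \oo] --> (0 : R)) ->
  L (f_ n) @[n --> \oo] --> 0.
  move=> bf f1 f0; rewrite -(mulr0 2^-1) -[X in _ * X](addr0 0).
  by apply: cvgM; [exact: cvg_cst|apply: cvgD; exact: bounded_cvg_Rintegral].
have e20 : 0 < e / 2 by rewrite divr_gt0.
have [g [cg g01] gB] := continuous_approximation_indic ML Lc mB e20.
have g1 u : `|g u| <= 1 by have /andP[? ?] := g01 u; rewrite ger0_norm.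
have bg : bounded_measurable g by split; [exact: continuous_measurable|exists 1].
have bB : bounded_measurable (\1_B : S -> R) by exact: bounded_measurable_indic.
have bd : bounded_measurable (fun u => `|g u - \1_B u|).
  by apply: bounded_measurable_norm; exact: bounded_measurableB.
have close (P' : probability S R) :
    `|\int[P']_u g u - fine (P' B)| <= \int[P']_u `|g u - \1_B u|.
  rewrite -Rintegral_indic//.
  rewrite -(mean_functionalB (mean_functional_probability P'))//.
  apply: le_normr_Rintegral => //.
  by apply: bounded_measurable_integrable; exact: bounded_measurableB.
have cP := close P; have cQ := close Q.
have tg := tv_norm_sub_Rintegral cg g1 tvt.
move: gB cP cQ tg; rewrite /L.
move: (\int[P]_u g u) (\int[Q]_u g u) (fine (P B)) (fine (Q B)) => a b a' b'.
move: (\int[P]_u _) (\int[Q]_u _) => x y.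
rewrite !ler_norml => h /andP[? ?] /andP[? ?] /andP[? ?].
by apply/andP; split; lra.
Qed.

End continuous_approximation.

Section kernel_probability.
Context d d' (X : measurableType d) (Y : measurableType d') (R : realType).
Variables (k : R.-pker X ~> Y) (x : X).

(** The same set function as [k x], renamed so that it can carry the structure of a probability. *)
Definition kernel_probability : set Y -> \bar R := k x.

HB.instance Definition _ := isMeasure.Build _ _ _ kernel_probability
  (measure0 (k x)) (measure_ge0 (k x)) (@measure_semi_sigma_additive _ _ _ (k x)).

HB.instance Definition _ := Measure_isProbability.Build _ _ _
  kernel_probability (prob_kernel x).

End kernel_probability.

(** * Subsolutions of the Poisson equation of the limiting kernel *)

Section poisson.
Context {R : realType} {d : measure_display} {S : measurableMetricType R d}.
Hypothesis S_compact : compact [set: S].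
Hypothesis S_borel : @measurable d S = <<s @open S >>.
Variables (K : R.-pker S ~> S) (pi : probability S R).
Hypothesis K_unique : forall nu : probability S R, invariant_probability K nu ->
  forall B : set S, measurable B -> nu B = pi B.
Hypothesis K_continuous : forall u : S, tv_dist (K v) (K u) @[v --> u] --> 0%E.
Implicit Types f g : S -> R.

Lemma continuous_bounded_measurable f : continuous f -> bounded_measurable f.
Proof.
move=> cf; split; first exact: continuous_measurable.
have : compact [set f x | x in [set: S]].
  by apply: continuous_compact => //; exact: continuous_subspaceT.
move=> /compact_bounded[M [_ /(_ (M + 1))]].
rewrite ltrDl ltr01 => /(_ isT) fM; exists (M + 1) => u.
by apply: fM; exists u.
Qed.

Let Kp (u : S) : probability S R := kernel_probability K u.
Let T f (u : S) : R := \int[Kp u]_v f v.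

Let T_mean u : mean_functional (fun f => T f u).
Proof. exact: mean_functional_probability. Qed.

Let TD f g : bounded_measurable f -> bounded_measurable g ->
  T (fun u => f u + g u) = (fun u => T f u + T g u).
Proof. by move=> bf bg; apply/funext => u; have [_ + _ _] := T_mean u; apply. Qed.

Let TZ c f : bounded_measurable f -> T (fun u => c * f u) = (fun u => c * T f u).
Proof. by move=> bf; apply/funext => u; have [_ _ + _] := T_mean u; apply. Qed.

Let T_bounded f : bounded_measurable f -> bounded_measurable (T f).
Proof.
move=> bf; have [mf [M fM]] := bf; split; last first.
  by exists M => u; exact: (mean_functional_norm (T_mean u)).
have bM : bounded_measurable (fun _ : S => M) by exact: bounded_measurable_cst.
have bfM := bounded_measurableD bf bM.
(* Measurability of kernel integrals is available for nonnegative integrands; adding the bound M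
   makes f one. *)
have -> : T f = (fun u => fine (\int[K u]_v (f v + M)%:E)%E - M).
  apply/funext => u; rewrite -[fine _]/(T (fun v => f v + M) u) TD//.
  by rewrite (mean_functional_cst (T_mean u)) addrK.
apply: measurable_funB => //; apply: measurableT_comp => //.
apply: measurable_fun_integral_kernel.
- exact: measurable_kernel.
- by move=> v; rewrite lee_fin -lerBlDr sub0r; have := fM v; rewrite ler_norml => /andP[].
- by apply/measurable_EFinP; have [] := bfM.
Qed.

Let Tk_bounded k f : bounded_measurable f -> bounded_measurable (iter k T f).
Proof. by move=> bf; elim: k => [//|k IHk] /=; exact: T_bounded. Qed.

Let Tk_mean k u : mean_functional (fun f => iter k T f u).
Proof.
split.
- suff -> : iter k T (fun=> 1) = (fun=> 1) by [].
  elim: k => [//|k /= ->]; apply/funext => v.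
  by rewrite (mean_functional_cst (T_mean v)).
- move=> f g bf bg; suff -> : iter k T (fun x => f x + g x) =
    (fun x => iter k T f x + iter k T g x) by [].
  by elim: k => [//|k /= ->]; rewrite TD//; exact: Tk_bounded.
- move=> c f bf; suff -> : iter k T (fun x => c * f x) =
    (fun x => c * iter k T f x) by [].
  by elim: k => [//|k /= ->]; rewrite TZ//; exact: Tk_bounded.
- move=> f g bf bg fg; move: u; elim: k => [//|k /= IHk] u.
  have [_ _ _ Tle] := T_mean u.
  by apply: Tle => //; exact: Tk_bounded.
Qed.

Let A n f u := n.+1%:R^-1 * \sum_(k < n.+1) iter k T f u.

Let A_mean n u : mean_functional (fun f => A n f u).
Proof.
have n0 : 0 < n.+1%:R^-1 :> R by rewrite invr_gt0.
split.
- rewrite /A (eq_bigr (fun=> 1)); last first.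
    by move=> k _; have [] := Tk_mean k u.
  by rewrite sumr_const card_ord -[1 *+ _]/(n.+1%:R) mulVf.
- move=> f g bf bg; rewrite /A -mulrDr -big_split /=; congr (_ * _).
  by apply: eq_bigr => k _; have [_ + _ _] := Tk_mean k u; apply.
- move=> c f bf; rewrite /A mulrCA; congr (_ * _); rewrite mulr_sumr.
  by apply: eq_bigr => k _; have [_ _ + _] := Tk_mean k u; apply.
- move=> f g bf bg fg; rewrite /A ler_wpM2l ?(ltW n0)//; apply: ler_sum => k _.
  by have [_ _ _] := Tk_mean k u; apply.
Qed.

(** The sum telescopes to its two end terms. This asymptotic invariance makes every limit of the
    averages invariant. *)
Let A_T n f u (M : R) : bounded_measurable f -> (forall v, `|f v| <= M) ->
  `|A n (T f) u - A n f u| <= 2 * M * n.+1%:R^-1.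
Proof.
move=> bf fM.
have -> : A n (T f) u - A n f u = n.+1%:R^-1 * (iter n.+1 T f u - f u).
  rewrite /A -mulrBr -sumrB; congr (_ * _).
  rewrite (eq_bigr (fun k : 'I_n.+1 => iter k.+1 T f u - iter k T f u)); last first.
    by move=> k _; rewrite iterSr.
  by rewrite -(big_mkord xpredT (fun k => iter k.+1 T f u - iter k T f u)) telescope_sumr.
rewrite normrM ger0_norm ?invr_ge0// mulrC ler_wpM2r ?invr_ge0//.
rewrite (le_trans (ler_normB _ _))// mulrDl mul1r lerD//.
exact: (mean_functional_norm (Tk_mean n.+1 u)).
Qed.

Let tv_near u (e : R) : 0 < e ->
  \forall v \near u, (tv_norm_sub (Kp v) (Kp u) <= e%:E)%E.
Proof.
move=> e0; have e20 : 0 < e / 2 by rewrite divr_gt0.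
have /fine_cvgP[fn cn] := K_continuous u.
have /cvgrPdist_le/(_ _ e20) ne := cn.
apply: filterS2 fn ne => v tvf.
rewrite sub0r normrN => /(le_trans (ler_norm _)).
rewrite -lee_fin fineK// /tv_dist -/(tv_norm_sub (Kp v) (Kp u)).
case: (tv_norm_sub (Kp v) (Kp u)) => [r| |] //.
  by rewrite -EFinM !lee_fin; lra.
  by rewrite gt0_muley// lte_fin invr_gt0.
by rewrite leNye.
Qed.

Let T_continuous f : continuous f -> continuous (T f).
Proof.
move=> cf u; have bf := continuous_bounded_measurable cf.
have [_ [M0 fM0]] := bf; pose M := `|M0| + 1.
have M_gt0 : 0 < M by rewrite ltr_wpDl.
have fM v : `|f v| <= M.
  by rewrite (le_trans (fM0 v))// (le_trans (ler_norm _))// lerDl.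
pose g v := M^-1 * f v.
have cg : continuous g by move=> v; apply: cvgM; [exact: cvg_cst|exact: cf].
have g1 v : `|g v| <= 1.
  by rewrite normrM gtr0_norm ?invr_gt0// ler_pdivrMl// mulr1.
have fE : f = (fun v => M * g v) by apply/funext => v; rewrite /g mulVKf// gt_eqF.
have bg : bounded_measurable g by exact: bounded_measurableZ.
apply/cvgrPdist_le => e e0.
have eM : 0 < e / M by rewrite divr_gt0.
have := tv_near u eM; apply: filterS => v tvuv.
rewrite fE TZ// -mulrBr normrM gtr0_norm// mulrC -ler_pdivlMr// distrC.
exact: (tv_norm_sub_Rintegral S_borel cg g1 tvuv).
Qed.

Let T_indic (B : set S) u : measurable B -> T \1_B u = fine (K u B).
Proof. by move=> mB; rewrite /T Rintegral_indic. Qed.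

(* Dini's theorem: u |-> K u (B n) is continuous because u |-> K u is continuous
   in total variation. *)
Let T_dini (B : (set S)^nat) (e : R) : 0 < e -> (forall n, measurable (B n)) ->
  (forall n, B n.+1 `<=` B n) -> \bigcap_n B n = set0 ->
  \forall n \near \oo, forall u, T \1_(B n) u <= e.
Proof.
move=> e0 mB BS B0.
have e20 : 0 < e / 2 by rewrite divr_gt0.
have leB m n : (m <= n)%N -> B n `<=` B m.
  move=> mn; rewrite -(subnKC mn); elim: (n - m)%N => [|k IHk].
    by rewrite addn0.
  by rewrite addnS; exact: subset_trans (BS _) IHk.
have key (u : S) : \forall v \near u & n \near \oo, T \1_(B n) v <= e.
  have : (fine \o (fun n => Kp u (B n))) n @[n --> \oo] --> 0.
    have B0E : Kp u (\bigcap_n B n) = 0%:E by rewrite B0 measure0.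
    apply: fine_cvg; rewrite -B0E.
    apply: nonincreasing_cvg_mu => //.
    - by rewrite (le_lt_trans (probability_le1 _ _))// ltry.
    - by rewrite B0.
    - by apply/nonincreasing_seqP => n; apply/subsetPset; exact: BS.
  move=> /cvgr_dist_le/(_ _ e20)[m _ /(_ m (leqnn m)) /=].
  rewrite sub0r normrN => /(le_trans (ler_norm _)) um.
  exists ([set v | (tv_norm_sub (Kp v) (Kp u) <= (e / 2)%:E)%E], [set n | (m <= n)%N]).
    by split; [exact: tv_near|exists m].
  move=> [v n] [/= tvuv mn].
  apply: (@le_trans _ _ (T \1_(B m) v)).
    have [_ _ _ Tle] := T_mean v; apply: Tle.
    - exact: bounded_measurable_indic.
    - exact: bounded_measurable_indic.
    - by move=> w; rewrite !indicE ler_nat; case: (boolP (w \in B n)) => // /set_mem/(leB _ _ mn)/mem_set ->.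
  rewrite T_indic//.
  have := tv_norm_sub_setwise S_borel (mB m) tvuv.
  rewrite ler_norml => /andP[_]; rewrite -/(K v (B m)).
  move: um; rewrite /Kp /=; lra.
have /compact_near_coveringP/(_ _ _ (fun n v => T \1_(B n) v <= e) _ (fun u _ => key u)) := S_compact.
by apply: filterS => n H u; exact: H.
Qed.

(* If the Cesaro averages A n f exceeded c at points u n for all n, a limit of
   g |-> A n g (u n) along an ultrafilter would be an invariant probability, hence
   pi, contradicting \int f dpi < c. *)
Let mean_le f (c : R) : continuous f -> c < 0 -> \int[pi]_u f u < c ->
  exists n, forall u, A n f u <= c.
Proof.
move=> cf c0 pif; apply: contrapT => /forallNP nA.
have bf := continuous_bounded_measurable cf.
have {nA} uex n : exists u, c < A n f u.
  have /existsNP[u /negP] := nA n; rewrite -ltNge => ?; by exists u.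
pose u n := projT1 (cid (uex n)).
have uc n : c < A n f (u n) := projT2 (cid (uex n)).
have [U [UU oU]] := @ultraFilterLemma _ (\oo : set_system nat) _.
have UP := @ultra_proper _ _ UU.
pose a g n := A n g (u n).
pose L g : R := lim (a g @ U).
have aM g n (M : R) : bounded_measurable g -> (forall v, `|g v| <= M) -> `|a g n| <= M.
  by move=> bg gM; exact: (mean_functional_norm (A_mean n (u n))).
have acvg g : bounded_measurable g -> a g @ U --> L g.
  move=> bg; have [_ [M gM]] := bg.
  (* The averages stay in the compact interval [-M, M], where the image of an ultrafilter converges
     to its cluster point. *)
  have aI : U (a g @^-1` [set` `[- M, M]]).
    by apply: filterE => n; rewrite /= in_itv /= -ler_norml; exact: aM.
  have [l [_ cl]] := @segment_compact R (- M) M (a g @ U) _ aI.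
  apply/cvg_ex; exists l => B Bl.
  have [//|nB] := in_ultra_setVsetC (a g @^-1` B) UU.
  by have [x []] := cl (~` B) B nB Bl.
have ML : mean_functional L.
  split.
  - apply: cvg_lim => //; apply: cvg_near_cst; apply: nearW => n.
    by have [] := A_mean n (u n).
  - move=> f1 f2 b1 b2; apply: cvg_lim => //.
    have -> : a (fun x => f1 x + f2 x) = (fun n => a f1 n + a f2 n).
      by apply/funext => n; have [_ + _ _] := A_mean n (u n); apply.
    by apply: cvgD; exact: acvg.
  - move=> k f1 b1; apply: cvg_lim => //.
    have -> : a (fun x => k * f1 x) = (fun n => k * a f1 n).
      by apply/funext => n; have [_ _ + _] := A_mean n (u n); apply.
    by apply: cvgM; [exact: cvg_cst|exact: acvg].
  - move=> f1 f2 b1 b2 f12; apply: (@ler_cvg_to _ U _ _ (a f1) (a f2)); [exact: acvg|exact: acvg|].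
    by apply: nearW => n; have [_ _ _] := A_mean n (u n); apply.
have LT g : bounded_measurable g -> L (T g) = L g.
  move=> bg; have [_ [M gM]] := bg.
  apply/eqP; rewrite -subr_eq0; apply/eqP.
  have h1 : (fun n => a (T g) n - a g n) @ U --> L (T g) - L g.
    by apply: cvgB; apply: acvg => //; exact: T_bounded.
  apply: (cvg_unique _ h1) => //.
  apply: (@cvg_trans _ ((fun n => a (T g) n - a g n) @ \oo)).
    by move=> B; exact: oU.
  apply/cvgrPdist_le => e e0.
  have M1 : 0 < 2 * `|M| + 1 by rewrite ltr_wpDl// mulr_ge0.
  have eM : 0 < e / (2 * `|M| + 1) by rewrite divr_gt0.
  have := near_infty_natSinv_lt (PosNum eM); apply: filterS => n /= ne.
  rewrite sub0r normrN (le_trans (A_T n (u n) bg gM))//.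
  rewrite (@le_trans _ _ ((2 * `|M| + 1) * n.+1%:R^-1))//.
    rewrite ler_wpM2r ?invr_ge0//; have := ler_norm M; lra.
  by rewrite mulrC -ler_pdivlMr// ltW.
have Lcont (B : (set S)^nat) : (forall n, measurable (B n)) ->
    (forall n, B n.+1 `<=` B n) -> \bigcap_n B n = set0 ->
    L \1_(B n) @[n --> \oo] --> 0.
  (* By invariance the indicator may be replaced by its image under T, which is uniformly small by
     Dini's theorem. *)
  move=> mB BS B0; apply/cvgrPdist_le => e e0.
  have := T_dini e0 mB BS B0; apply: filterS => n Te.
  have bB : bounded_measurable (\1_(B n) : S -> R) by exact: bounded_measurable_indic.
  rewrite sub0r normrN -LT//; apply: (mean_functional_norm ML); first exact: T_bounded.
  by move=> v; rewrite ger0_norm// T_indic// fine_ge0.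
have [nu nuL] := mean_functional_representation ML Lcont.
have nu_inv : invariant_probability K nu.
  move=> B mB.
  have bB : bounded_measurable (\1_B : S -> R) by exact: bounded_measurable_indic.
  have -> : (\int[nu]_v K v B = \int[nu]_v (T \1_B v)%:E)%E.
    apply: eq_integral => v _; rewrite T_indic// fineK//.
    exact: (@fin_num_measure _ _ _ (Kp v)).
  rewrite EFin_Rintegral; last exact: T_bounded.
  rewrite -nuL; last exact: T_bounded.
  by rewrite LT// nuL// Rintegral_indic// fineK// fin_num_measure.
have Lpi : L f = \int[pi]_v f v.
  apply: (mean_functional_ext ML (mean_functional_probability pi)) => // B mB.
  rewrite nuL; last exact: bounded_measurable_indic.
  by rewrite !Rintegral_indic// (K_unique nu_inv).
have : c <= L f.
  apply: (@ler_cvg_to _ U _ _ (fun=> c) (a f)); [exact: cvg_cst|exact: acvg|].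
  by apply: nearW => n; rewrite ltW// uc.
by rewrite Lpi leNgt pif.
Qed.

(** Without a rate of convergence of the iterates the Poisson equation itself may have no solution.
    An inequality suffices, and it needs only one uniformly negative Cesaro average. *)
Lemma poisson_subsolution g : continuous g -> \int[pi]_u g u < 0 ->
  exists h c, [/\ continuous h, 0 < c &
    forall u, g u + \int[K u]_v h v - h u <= - c].
Proof.
move=> cg pig.
have bg := continuous_bounded_measurable cg.
(* Half of the mean of g, so that -c lies strictly between that mean and 0. *)
pose c := - (\int[pi]_u g u / 2).
have c0 : 0 < c by rewrite /c; lra.
have [||n An] := @mean_le g (- c) cg; [by rewrite /c; lra|by rewrite /c; lra|].
pose s m u := \sum_(k < m) iter k T g u.
have Tkc k : continuous (iter k T g) by elim: k => [//|k IHk] /=; exact: T_continuous.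
have cs m : continuous (s m).
  elim: m => [|m IHm].
    have -> : s 0%N = (fun=> 0) by apply/funext => u; rewrite /s big_ord0.
    by move=> u; exact: cvg_cst.
  have -> : s m.+1 = (fun u => s m u + iter m T g u).
    by apply/funext => u; rewrite /s big_ord_recr.
  by move=> u; apply: cvgD; [exact: IHm|exact: Tkc].
pose w m u := \sum_(i < m) s i u.
have cw m : continuous (w m).
  elim: m => [|m IHm].
    have -> : w 0%N = (fun=> 0) by apply/funext => u; rewrite /w big_ord0.
    by move=> u; exact: cvg_cst.
  have -> : w m.+1 = (fun u => w m u + s m u).
    by apply/funext => u; rewrite /w big_ord_recr.
  by move=> u; apply: cvgD; [exact: IHm|exact: cs].
have bs m := continuous_bounded_measurable (cs m).
have bw m := continuous_bounded_measurable (cw m).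
have Ts m : T (s m) = (fun u => s m.+1 u - g u).
  elim: m => [|m IHm].
    apply/funext => u; rewrite /s big_ord1 /= subrr.
    have -> : (fun u => \sum_(k < 0) iter k T g u) = (fun=> 0).
      by apply/funext => v; rewrite big_ord0.
    exact: (mean_functional_cst (T_mean u)).
  have -> : s m.+1 = (fun u => s m u + iter m T g u).
    by apply/funext => u; rewrite /s big_ord_recr.
  rewrite TD//; last exact: Tk_bounded.
  rewrite IHm; apply/funext => u.
  by rewrite -[T (iter m T g) u]/(iter m.+1 T g u) addrAC /s [in RHS]big_ord_recr.
(* T w - w = s - m g, the discrete identity behind the choice of h: dividing by m leaves only the
   average of the iterates. *)
have Tw m : T (w m) = (fun u => w m u + s m u - m%:R * g u).
  elim: m => [|m IHm].
    apply/funext => u; rewrite /w /s !big_ord0 mul0r subr0 addr0.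
    have -> : (fun u => \sum_(i < 0) s i u) = (fun=> 0).
      by apply/funext => v; rewrite big_ord0.
    exact: (mean_functional_cst (T_mean u)).
  have -> : w m.+1 = (fun u => w m u + s m u).
    by apply/funext => u; rewrite /w big_ord_recr.
  rewrite TD// IHm Ts; apply/funext => u.
  by rewrite -natr1; ring.
(* w telescopes: g + T h - h is the Cesaro average A n g for this h. *)
exists (fun u => n.+1%:R^-1 * w n.+1 u), c; split => //.
  by move=> u; apply: cvgM; [exact: cvg_cst|exact: cw].
move=> u; rewrite -[\int[_]_v _]/(T (fun v => n.+1%:R^-1 * w n.+1 v) u) TZ// Tw.
apply: le_trans (An u); rewrite /A -/(s n.+1 u) le_eqVlt; apply/orP; left; apply/eqP.
have n0 : n.+1%:R != 0 :> R by rewrite pnatr_eq0.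
by move: (n.+1%:R) n0 => N N0; field.
Qed.

End poisson.

(** * Second order expansions of powers *)

Section power_expansion.
Context {R : realType}.
Implicit Types (theta eps t z a : R).

Lemma powR_first_order theta eps : 0 < eps -> exists2 eta, 0 < eta <= 2^-1 &
  forall t, `|t - 1| <= eta ->
    `|t `^ theta - 1 - theta * (t - 1)| <= eps * `|t - 1|.
Proof.
move=> e0.
have [dv dvE] := is_derive1_powR theta (@ltr01 R).
move: dv; rewrite /derivable => dv.
have dvl : (fun h : R => h^-1 *: (((@powR R)^~ theta \o shift 1) (h *: 1) - 1))
    @ 0^' --> theta.
  move: dv dvE; rewrite /derive !powR1 mulr1 => dv dvE.
  by rewrite -[X in _ --> X]dvE; exact: dv.
have /cvgr_dist_le/(_ _ e0) [eta0 /= eta0_gt0 H] := dvl.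
exists (Num.min (eta0 / 2) 2^-1).
  by rewrite lt_min ge_min lexx orbT andbT divr_gt0 //= invr_gt0 ltr0n.
move=> t; rewrite le_min => /andP[t1 _].
have [->|tn] := eqVneq t 1; first by rewrite powR1 !subrr mulr0 !subr0 normr0 mulr0.
have tn0 : t - 1 != 0 by rewrite subr_eq0.
have /= := H (t - 1); rewrite /ball /= sub0r normrN => /(_ _ tn0).
rewrite -[(t - 1) *: 1]/((t - 1) * 1) mulr1 subrK.
rewrite -[_ *: _]/((t - 1)^-1 * (t `^ theta - 1)) => Ht.
have -> : t `^ theta - 1 - theta * (t - 1) =
    - ((theta - (t - 1)^-1 * (t `^ theta - 1)) * (t - 1)) by field.
rewrite normrN normrM ler_wpM2r// Ht// (le_lt_trans t1)//.
by rewrite ltr_pdivrMr// ltr_pMr// ltr1n.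
Qed.

(** Up to a constant, D is the remainder of the second order expansion at 1. Its derivative is theta
    times the first order remainder for the exponent theta - 1, so the mean value theorem reduces
    the claim to [powR_first_order]. *)
Lemma powR_second_order theta eps : 0 < eps -> exists2 eta, 0 < eta <= 2^-1 &
  forall t, `|t - 1| <= eta ->
    `|t `^ theta - 1 - theta * (t - 1) -
      theta * (theta - 1) / 2 * (t - 1) ^+ 2| <= eps * (t - 1) ^+ 2.
Proof.
move=> e0.
have e'0 : 0 < eps / (`|theta| + 1) by rewrite divr_gt0// ltr_wpDl.
have [eta eta01 H] := powR_first_order (theta - 1) e'0.
have [eta0 eta1] := andP eta01.
exists eta => // t t1.
pose D s := s `^ theta - theta * s - theta * (theta - 1) / 2 * (s - 1) ^+ 2.
pose D' s := theta * s `^ (theta - 1) - theta - theta * (theta - 1) * (s - 1).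
have dD (s : R) : 0 < s -> is_derive s 1 D (D' s).
  move=> s0; have dp := is_derive1_powR theta s0.
  by apply: is_derive_eq; rewrite /D' /= /GRing.scale /=; field.
have D'le (s : R) : `|s - 1| <= eta -> `|D' s| <= eps * `|s - 1|.
  move=> /H Hs.
  have -> : D' s = theta * (s `^ (theta - 1) - 1 - (theta - 1) * (s - 1)).
    by rewrite /D'; ring.
  rewrite normrM; apply: (le_trans (ler_wpM2l (normr_ge0 _) Hs)).
  rewrite mulrA ler_wpM2r// mulrCA ger_pMr// ler_pdivrMr ?mul1r ?lerDl//.
suff : `|D t - D 1| <= eps * (t - 1) ^+ 2.
  congr (`|_| <= _); rewrite /D powR1; ring.
have pos (s : R) : `|s - 1| <= eta -> 0 < s.
  by rewrite ler_distl => /andP[h _]; move: eta1 h; lra.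
have cD (x y : R) : 0 < x -> {within `[x, y], continuous D}.
  move=> x0; apply: derivable_within_continuous => s.
  rewrite in_itv /= => /andP[xs _].
  by have [] := dD s (lt_le_trans x0 xs).
have main (c : R) : `|c - 1| <= `|t - 1| -> D t - D 1 = D' c * (t - 1) ->
    `|D t - D 1| <= eps * (t - 1) ^+ 2.
  move=> ct ->; rewrite normrM -real_normK ?num_real// expr2 mulrA ler_wpM2r//.
  by apply: (le_trans (D'le c (le_trans ct t1))); rewrite ler_pM2l.
have [lt1|gt1|->] := ltgtP t 1; last by rewrite !subrr normr0 expr0n mulr0.
- have t0 := pos _ t1.
  have [c] : exists2 c, c \in `]t, 1[ & D 1 - D t = D' c * (1 - t).
    apply: (MVT lt1 _ (cD _ _ t0)) => x.
    by rewrite in_itv /= => /andP[tx _]; apply: dD; exact: lt_trans tx.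
  rewrite in_itv /= => /andP[tc c1] E.
  apply: (main c) => //; last by rewrite -opprB E -mulrN opprB.
  by rewrite !ltr0_norm ?subr_lt0// lerN2 lerD2r ltW.
- have [c] : exists2 c, c \in `]1, t[ & D t - D 1 = D' c * (t - 1).
    apply: (MVT gt1 _ (cD _ _ ltr01)) => x.
    by rewrite in_itv /= => /andP[tx _]; apply: dD; exact: lt_trans tx.
  rewrite in_itv /= => /andP[tc c1] E.
  apply: (main c) => //.
  by rewrite !gtr0_norm ?subr_gt0// lerD2r ltW.
Qed.

(** Here z is the increment relative to the radius x and a stands for h/x^2. The coefficient theta
    (2 theta - 1) of z^2 collects theta from the first order term and 2 theta (theta - 1) from the
    second. *)
Lemma square_powR_expansion theta eps : 0 < eps ->
  exists2 eta, 0 < eta <= 4^-1 & forall z a, `|z| <= eta -> 0 <= a <= eta ->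
  `|((1 + z) ^+ 2 + a) `^ theta -
    (1 + 2 * theta * z + theta * (2 * theta - 1) * z ^+ 2 + theta * a)|
  <= eps * (z ^+ 2 + a).
Proof.
move=> e0; pose k : R := theta * (theta - 1) / 2.
(* Each of two errors gets eps/2: (t - 1)^2 <= 7 (z^2 + a) explains 14, and |(t - 1)^2 - 4 z^2| <= 6
   eta (z^2 + a) explains the 12 below. *)
have e14 : 0 < eps / 14 by rewrite divr_gt0.
have [eta0 /andP[eta0_gt0 _] H] := powR_second_order theta e14.
have k0 : 0 <= `|k| by [].
have ek : 0 < eps / (12 * (`|k| + 1)) by rewrite divr_gt0// mulr_gt0// ltr_wpDl.
exists (Num.min (eta0 / 4) (Num.min 4^-1 (eps / (12 * (`|k| + 1))))).
  rewrite lt_min lt_min divr_gt0//= ek invr_gt0 ltr0n /=.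
  by rewrite !ge_min lexx orbT.
move=> z a; set eta := Num.min _ _.
have eta_1 : eta <= eta0 / 4 by rewrite ge_min lexx.
have eta_2 : eta <= 4^-1 by rewrite !ge_min lexx orbT.
have eta_3 : eta * (12 * (`|k| + 1)) <= eps.
  by rewrite -ler_pdivlMr ?mulr_gt0 ?ltr_wpDl// !ge_min lexx !orbT.
move: eta eta_1 eta_2 eta_3 => eta eta_1 eta_2 eta_3 ze /andP[a0 ae].
have zz : z ^+ 2 <= eta * `|z|.
  by rewrite -real_normK ?num_real// expr2 ler_wpM2r.
have z0 : 0 <= `|z| by [].
have z20 : 0 <= z ^+ 2 by exact: sqr_ge0.
have zn : - `|z| <= z <= `|z| by rewrite -ler_norml.
have eta_0 : 0 <= eta by exact: le_trans ze.
have zz1 : z ^+ 2 <= `|z| by nra.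
set t := (1 + z) ^+ 2 + a.
have tE : t - 1 = 2 * z + (z ^+ 2 + a) by rewrite /t; ring.
have t1 : `|t - 1| <= eta0.
  by rewrite tE ler_norml; apply/andP; split; lra.
have sqE : (t - 1) ^+ 2 - 4 * z ^+ 2 = (z ^+ 2 + a) * (4 * z + z ^+ 2 + a).
  by rewrite tE; ring.
have fac : `|4 * z + z ^+ 2 + a| <= 6 * eta.
  by rewrite ler_norml; apply/andP; split; lra.
have za0 : 0 <= z ^+ 2 + a by exact: addr_ge0.
have sqB : `|(t - 1) ^+ 2 - 4 * z ^+ 2| <= (z ^+ 2 + a) * (6 * eta).
  by rewrite sqE normrM (ger0_norm za0) ler_wpM2l.
have t2 : (t - 1) ^+ 2 <= 7 * (z ^+ 2 + a).
  by move: sqB; rewrite ler_norml => /andP[_ ?]; nra.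
have -> : t `^ theta -
    (1 + 2 * theta * z + theta * (2 * theta - 1) * z ^+ 2 + theta * a) =
  (t `^ theta - 1 - theta * (t - 1) - k * (t - 1) ^+ 2) +
    k * ((t - 1) ^+ 2 - 4 * z ^+ 2) by rewrite tE /k; field.
apply: (le_trans (ler_normD _ _)); rewrite (normrM k).
have := H t t1; rewrite -/k => Ht.
have := ler_wpM2l k0 sqB => Hk.
have Hke : `|k| * eta * 12 <= eps by nra.
apply: (le_trans (lerD Ht Hk)).
have : eps / 14 * (t - 1) ^+ 2 <= eps / 14 * (7 * (z ^+ 2 + a)).
  by rewrite ler_wpM2l// ltW.
have : `|k| * eta * 12 * (z ^+ 2 + a) <= eps * (z ^+ 2 + a) by rewrite ler_wpM2r.
lra.
Qed.

(** For |z| <= eta this is the local expansion, and the truncation at 4^theta is inactive. For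
    larger |z| the term C |z|^p dominates everything, since p >= 2 theta and p > 2: it exceeds the
    power in the upper bound and makes the lower bound nonpositive. *)
Lemma square_powR_bounds theta p eps :
  0 < theta -> 2 < p -> 2 * theta <= p -> 0 < eps ->
  exists C a0 : R, [/\ 0 <= C, 0 < a0 & forall z a, -1 <= z -> 0 <= a <= a0 ->
    ((1 + z) ^+ 2 + a) `^ theta <=
      1 + 2 * theta * z + (theta * (2 * theta - 1) + eps) * z ^+ 2
      + (theta + eps) * a + C * `|z| `^ p /\
    1 + 2 * theta * z + (theta * (2 * theta - 1) - eps) * z ^+ 2
      + (theta - eps) * a - C * `|z| `^ p <=
      Num.min (((1 + z) ^+ 2 + a) `^ theta) (4 `^ theta)].
Proof.
move=> th0 p2 thp e0.
have [eta /andP[eta0 eta4] H] := square_powR_expansion theta e0.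
pose k : R := theta * (2 * theta - 1).
(* M adds up the coefficients of all terms that |z|^p has to dominate when |z| > eta; 5^theta
   belongs to the power itself. *)
pose M : R := 5 `^ theta + 1 + 3 * theta + `|k| + eps.
have five0 : 0 <= 5 `^ theta :> R by exact: powR_ge0.
have M0 : 0 <= M by rewrite /M !addr_ge0// ?mulr_ge0// ltW.
exists (M * (eta^-1 `^ p)), eta; split => //.
  by rewrite mulr_ge0// powR_ge0.
move=> z a z1 /andP[a0 ae].
have z20 : 0 <= z ^+ 2 by exact: sqr_ge0.
have [zs|zl] := leP `|z| eta.
  have := H z a zs; rewrite a0 ae ler_norml => /(_ isT) /andP[lo hi].
  have zn : - eta <= z <= eta by rewrite -ler_norml.
  have Cz : 0 <= M * eta^-1 `^ p * `|z| `^ p by rewrite !mulr_ge0// powR_ge0.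
  split; first by lra.
  rewrite min_l; first by lra.
  rewrite ge0_ler_powR ?nnegrE ?ltW//.
    by rewrite ltr_wpDr// exprn_gt0//; lra.
  have : (1 + z) ^+ 2 <= (5/4) ^+ 2.
    by rewrite ler_sqr ?nnegrE; lra.
  lra.
(* Rescaling by eta gives L > 1, so that L, L^2 and L^(2 theta) are all at most Q = L^p. *)
pose L : R := `|z| / eta; pose Q : R := L `^ p.
have L1 : 1 < L by rewrite /L ltr_pdivlMr// mul1r.
have L0 : 0 < L by exact: lt_trans L1.
have zL : `|z| = L * eta by rewrite /L divfK// gt_eqF.
have QE : M * eta^-1 `^ p * `|z| `^ p = M * Q.
  by rewrite -mulrA -powRM ?invr_ge0// ?(ltW eta0)// /Q /L mulrC mulrC [_^-1 * _]mulrC.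
have L2Q : L ^+ 2 <= Q.
  by rewrite -powR_mulrn ?(ltW L0)// /Q ler_powR// ltW.
have zLe : `|z| <= L by rewrite zL ger_pMr//; lra.
have z2L : z ^+ 2 <= L ^+ 2.
  by rewrite -[z ^+ 2]real_normK ?num_real// ler_sqr ?nnegrE// ltW.
have LL : L <= L ^+ 2 by rewrite expr2 ler_peMr ?(ltW L0)// ltW.
have Q1 : 1 <= Q by lra.
have zQ : `|z| <= Q by lra.
have z2Q : z ^+ 2 <= Q by lra.
have zn : - `|z| <= z <= `|z| by rewrite -ler_norml.
have kz : `|k * z ^+ 2| <= `|k| * Q.
  by rewrite normrM (ger0_norm z20) ler_wpM2l.
have psiQ : ((1 + z) ^+ 2 + a) `^ theta <= 5 `^ theta * Q.
  apply: (@le_trans _ _ ((5 * L ^+ 2) `^ theta)).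
    rewrite ge0_ler_powR ?nnegrE ?(ltW th0)//; first by rewrite addr_ge0 ?sqr_ge0.
      by rewrite mulr_ge0 ?sqr_ge0.
    have -> : (1 + z) ^+ 2 = 1 + 2 * z + z ^+ 2 by ring.
    lra.
  rewrite powRM ?sqr_ge0// ler_wpM2l//.
  by rewrite -powR_mulrn ?(ltW L0)// -powRrM /Q ler_powR// ltW.
rewrite QE; move: kz; rewrite ler_norml => /andP[kz1 kz2].
have ez : 0 <= eps * z ^+ 2 by rewrite mulr_ge0// ltW.
have ea : 0 <= eps * a by rewrite mulr_ge0// ltW.
have ta : 0 <= theta * a by rewrite mulr_ge0// ltW.
have ta1 : theta * a <= theta * Q by rewrite ler_wpM2l ?(ltW th0)//; lra.
have tz1 : theta * z <= theta * Q by rewrite ler_wpM2l ?(ltW th0)//; lra.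
have tz2 : - (theta * Q) <= theta * z by rewrite -mulrN ler_wpM2l ?(ltW th0)//; lra.
have psi0 : 0 <= Num.min (((1 + z) ^+ 2 + a) `^ theta) (4 `^ theta).
  by rewrite le_min !powR_ge0.
have eQ : 0 <= eps * Q by rewrite mulr_ge0 ?ltW// (lt_le_trans _ Q1).
have tQ : 0 <= theta * Q by rewrite mulr_ge0 ?ltW// (lt_le_trans _ Q1).
have fQ : 0 <= 5 `^ theta * Q by rewrite mulr_ge0// (le_trans _ Q1).
have MQ : M * Q = 5 `^ theta * Q + Q + 3 * (theta * Q) + `|k| * Q + eps * Q.
  by rewrite /M; ring.
rewrite MQ -/k; clearbody k; split; lra.
Qed.

End power_expansion.

(** * One-step means of the expanded power *)

Section expansion_mean.
Context {d : measure_display} {T : measurableType d} {R : realType}.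
Variables (m : probability T R) (Y hh : T -> R) (p : R).
Hypotheses (mY : measurable_fun setT Y) (bh : bounded_measurable hh) (p2 : 2 < p).
Hypothesis Yp : m.-integrable setT (EFin \o (fun z => `|Y z| `^ p)).

Local Notation I f := (m.-integrable setT (EFin \o f)).

Let ID (f g : T -> R) : I f -> I g -> I (fun z => f z + g z).
Proof. by move=> If Ig; have := integrableD measurableT If Ig; apply. Qed.

Let IZ (c : R) (f : T -> R) : I f -> I (fun z => c * f z).
Proof. by move=> If; have := integrableZl measurableT c If; apply. Qed.

Let I1 (c : R) : I (fun=> c).
Proof. exact: bounded_measurable_integrable (bounded_measurable_cst c). Qed.

Let Ip1 : I (fun z => 1 + `|Y z| `^ p).
Proof. by apply: ID; [exact: I1|exact: Yp]. Qed.

Let powp (y : R) : 0 <= y -> y <= 1 + y `^ p /\ y ^+ 2 <= 1 + y `^ p.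
Proof.
move=> y0; have yp : 0 <= y `^ p by exact: powR_ge0.
have [y1|y1] := leP y 1.
  by split; nra.
have : y ^+ 2 <= y `^ p by rewrite -powR_mulrn// ler_powR// ltW.
by split; nra.
Qed.

Lemma integrable_increment : I Y.
Proof.
apply: (@le_integrable _ _ _ m _ measurableT _ _ _ _ Ip1).
  exact/measurable_EFinP.
move=> z _ /=; rewrite lee_fin (le_trans (powp (normr_ge0 _)).1)//.
by rewrite ler_norm.
Qed.

Lemma integrable_increment_sqr : I (fun z => Y z ^+ 2).
Proof.
apply: (@le_integrable _ _ _ m _ measurableT _ _ _ _ Ip1).
  by apply/measurable_EFinP; exact: measurable_funX.
move=> z _ /=; rewrite lee_fin normrX (le_trans (powp (normr_ge0 _)).2)//.
by rewrite ler_norm.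
Qed.

Let lin (c0 c1 c2 c3 c4 : R) (z : T) :=
  c0 + c1 * Y z + c2 * Y z ^+ 2 + c3 * hh z + c4 * `|Y z| `^ p.

Let lin_integrable c0 c1 c2 c3 c4 : I (lin c0 c1 c2 c3 c4).
Proof.
apply: ID; [apply: ID; [apply: ID; [apply: ID|]|]|];
  [exact: I1|apply: IZ..|apply: IZ] => //.
- exact: integrable_increment.
- exact: integrable_increment_sqr.
- exact: bounded_measurable_integrable.
Qed.

Let lin_mean c0 c1 c2 c3 c4 : \int[m]_z lin c0 c1 c2 c3 c4 z =
  c0 + c1 * \int[m]_z Y z + c2 * \int[m]_z (Y z ^+ 2) +
  c3 * \int[m]_z hh z + c4 * \int[m]_z (`|Y z| `^ p).
Proof.
have iY := integrable_increment; have iY2 := integrable_increment_sqr.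
have ih : I hh by exact: bounded_measurable_integrable.
have J1 : I (fun z => c0 + c1 * Y z) by apply: ID => //; exact: IZ.
have J2 : I (fun z => c0 + c1 * Y z + c2 * Y z ^+ 2) by apply: ID => //; exact: IZ.
have J3 : I (fun z => c0 + c1 * Y z + c2 * Y z ^+ 2 + c3 * hh z).
  by apply: ID => //; exact: IZ.
rewrite /lin RintegralD//; last exact: IZ.
rewrite RintegralD//; last exact: IZ.
rewrite RintegralD//; last exact: IZ.
rewrite RintegralD//; last exact: IZ.
rewrite !RintegralZl// Rintegral_cst//.
by rewrite (congr1 fine (probability_setT m)) mulr1.
Qed.

Variables (X theta eps C a0 : R).
Hypotheses (X0 : 0 < X) (XY : forall z, - X <= Y z).
Hypothesis hX : forall z, 0 <= hh z <= a0 * X ^+ 2.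
Hypothesis bounds : forall z a, -1 <= z -> 0 <= a <= a0 ->
    ((1 + z) ^+ 2 + a) `^ theta <=
      1 + 2 * theta * z + (theta * (2 * theta - 1) + eps) * z ^+ 2
      + (theta + eps) * a + C * `|z| `^ p /\
    1 + 2 * theta * z + (theta * (2 * theta - 1) - eps) * z ^+ 2
      + (theta - eps) * a - C * `|z| `^ p <=
      Num.min (((1 + z) ^+ 2 + a) `^ theta) (4 `^ theta).

Let f z := ((X + Y z) ^+ 2 + hh z) `^ theta.

Let m1 := \int[m]_z Y z.
Let m2 := \int[m]_z (Y z ^+ 2).
Let mh := \int[m]_z hh z.
Let mp := \int[m]_z (`|Y z| `^ p).
Let t := (X ^+ 2)^-1.

Let fE z : f z = (X ^+ 2) `^ theta * ((1 + Y z / X) ^+ 2 + hh z / X ^+ 2) `^ theta.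
Proof.
have Xn : X != 0 by rewrite gt_eqF.
rewrite -powRM ?sqr_ge0//; last first.
  by rewrite addr_ge0 ?sqr_ge0// divr_ge0 ?sqr_ge0//; have /andP[] := hX z.
by congr (_ `^ _); field.
Qed.

Let side z : -1 <= Y z / X /\ 0 <= hh z / X ^+ 2 <= a0.
Proof.
have X20 : 0 < X ^+ 2 by exact: exprn_gt0.
have /andP[h0 h1] := hX z.
by rewrite ler_pdivlMr// mulN1r XY ler_pdivrMr// divr_ge0// ltW.
Qed.

Let measurable_f : measurable_fun setT f.
Proof.
apply: (measurableT_comp (measurable_powR theta)); apply: measurable_funD.
  by apply: measurable_funX; exact: measurable_funD.
by have [] := bh.
Qed.

Let scaled (c4 : R) z : c4 * `|Y z / X| `^ p = c4 / X `^ p * `|Y z| `^ p.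
Proof.
rewrite normrM powRM// normfV (gtr0_norm X0).
have -> : X^-1 `^ p = (X `^ p)^-1.
  by rewrite -powR_inv1 ?(ltW X0)// -powRrM mulN1r powRN.
by ring.
Qed.

(** All corrections carry the common factor X^-2. What multiplies it has limits: X m1 tends to e, m2
    to sigma2, mh to the mean of h under K, and the p-th moment enters with X^(2 - p), which
    vanishes because p > 2. *)
Let coef (c0 c1 c2 c3 c4 : R) :
  \int[m]_z lin c0 (c1 / X) (c2 / X ^+ 2) (c3 / X ^+ 2) (c4 / X `^ p) z =
  c0 + t * (c1 * (X * m1) + c2 * m2 + c3 * mh + c4 * (X ^+ 2 / X `^ p * mp)).
Proof.
have Xn : X != 0 by rewrite gt_eqF.
have Xpn : X `^ p != 0 by rewrite gt_eqF// powR_gt0.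
rewrite lin_mean -/m1 -/m2 -/mh -/mp /t.
by move: (X `^ p) Xpn => Q Q0; field; rewrite Q0 Xn.
Qed.

Lemma mean_upper : (\int[m]_z (f z)%:E <= ((X ^+ 2) `^ theta *
  (1 + t * (2 * theta * (X * m1) + (theta * (2 * theta - 1) + eps) * m2 +
    (theta + eps) * mh + C * (X ^+ 2 / X `^ p * mp))))%:E)%E.
Proof.
rewrite -coef; set l := lin _ _ _ _ _.
have il : I l by exact: lin_integrable.
have fl z : f z <= (X ^+ 2) `^ theta * l z.
  rewrite fE ler_wpM2l ?powR_ge0// /l /lin -scaled.
  have [z1 za] := side z; have [+ _] := bounds z1 za.
  by move=> /le_trans; apply; rewrite le_eqVlt; apply/orP; left; apply/eqP;
    rewrite expr_div_n; ring.
have -> : ((X ^+ 2) `^ theta * \int[m]_z l z)%:E =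
    (\int[m]_z ((X ^+ 2) `^ theta * l z)%:E)%E.
  rewrite -RintegralZl// /Rintegral fineK//.
  by apply: integrable_fin_num => //; exact: IZ.
apply: ge0_le_integral => //.
- by move=> z _; rewrite lee_fin powR_ge0.
- by apply/measurable_EFinP; exact: measurable_f.
- by apply: measurable_int; exact: IZ.
- by move=> z _; rewrite lee_fin.
Qed.

(** The truncation at twice the radius costs nothing in the lower bound, and it is what later allows
    the comparison with [capped]. *)
Lemma mean_lower : (X ^+ 2) `^ theta *
  (1 + t * (2 * theta * (X * m1) + (theta * (2 * theta - 1) - eps) * m2 +
    (theta - eps) * mh - C * (X ^+ 2 / X `^ p * mp))) <=
  \int[m]_z Num.min (f z) ((4 * X ^+ 2) `^ theta).
Proof.
rewrite -(mulNr C) -coef; set l := lin _ _ _ _ _.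
have il : I l by exact: lin_integrable.
have fl z : (X ^+ 2) `^ theta * l z <= Num.min (f z) ((4 * X ^+ 2) `^ theta).
  have -> : (4 * X ^+ 2) `^ theta = (X ^+ 2) `^ theta * 4 `^ theta.
    by rewrite powRM ?sqr_ge0// mulrC.
  rewrite fE -minr_pMr ?powR_ge0//.
  rewrite ler_wpM2l ?powR_ge0// /l /lin -scaled.
  have [z1 za] := side z; have [_ +] := bounds z1 za.
  by move=> /(le_trans _); apply; rewrite le_eqVlt; apply/orP; left; apply/eqP;
    rewrite expr_div_n; ring.
rewrite -RintegralZl//; apply: le_Rintegral => //; first exact: IZ.
apply: bounded_measurable_integrable; split.
  by apply: measurable_minr.
exists ((4 * X ^+ 2) `^ theta) => z.
by rewrite ger0_norm ?ge_min ?lexx ?orbT// le_min !powR_ge0.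
Qed.

End expansion_mean.

Lemma powR_ge_near {R : realType} (r M : R) : 0 < r ->
  exists2 x1, 0 < x1 & forall x, x1 <= x -> M <= x `^ r.
Proof.
move=> r0; have M0 : 0 < `|M| + 1 by rewrite ltr_wpDl.
exists ((`|M| + 1) `^ r^-1); first by rewrite powR_gt0.
move=> x xM; apply: (@le_trans _ _ (`|M| + 1)).
  by rewrite (le_trans (ler_norm _))// lerDl.
have -> : `|M| + 1 = ((`|M| + 1) `^ r^-1) `^ r.
  by rewrite -powRrM mulVf ?gt_eqF// powRr1// ltW.
by rewrite ge0_ler_powR ?nnegrE ?powR_ge0 ?(ltW r0)// (le_trans _ xM)// powR_ge0.
Qed.

(** * Bookkeeping of the error terms *)

Section expansion_arithmetic.
Context {R : realType}.
Implicit Types (theta eps eta del M H : R).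

(** At z = 0 the bounds for the next value also describe the current one, so both sides of the drift
    inequality are expanded with the same eps. *)
Lemma expansion_at0 theta p eps C a0 a : 0 < theta -> 0 < p -> 0 <= a <= a0 ->
  a <= 1 ->
  (forall z a, -1 <= z -> 0 <= a <= a0 ->
    ((1 + z) ^+ 2 + a) `^ theta <=
      1 + 2 * theta * z + (theta * (2 * theta - 1) + eps) * z ^+ 2
      + (theta + eps) * a + C * `|z| `^ p /\
    1 + 2 * theta * z + (theta * (2 * theta - 1) - eps) * z ^+ 2
      + (theta - eps) * a - C * `|z| `^ p <=
      Num.min (((1 + z) ^+ 2 + a) `^ theta) (4 `^ theta)) ->
  1 + (theta - eps) * a <= (1 + a) `^ theta <= 1 + (theta + eps) * a /\
  1 <= (1 + a) `^ theta <= 2 `^ theta.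
Proof.
move=> th0 p0 aa0 a1 bounds; have /andP[ale _] := aa0.
have [] := bounds 0 a _ aa0; first by rewrite oppr_le0.
rewrite normr0 powR0 ?gt_eqF// !addr0 expr1n expr0n /= !mulr0 !addr0 subr0.
rewrite le_min => -> /andP[-> _]; split => //; apply/andP; split.
  have one : 1 = 1 `^ theta :> R by rewrite powR1.
  rewrite [leLHS]one ge0_ler_powR ?nnegrE ?(ltW th0)//; lra.
by rewrite ge0_ler_powR ?nnegrE ?(ltW th0)//; lra.
Qed.

(** Half of eta pays for the errors in eps, the other half for those in del. Here m1 stands for X
    times the mean increment and q for the p-th moment term. The summand eps * h is set aside for
    the expansion of the current value. *)
Lemma expansion_arith theta eps eta del M H m1 m2 mh k q e0 s2 h :
  let kap := theta * (2 * theta - 1) in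
  0 < theta -> 0 < eps -> 0 <= M -> 0 < del -> del <= 1 ->
  eps * (M + 2 + 2 * H) = eta / 2 -> del * (3 * theta + `|kap| + 1) <= eta / 2 ->
  `|m1 - e0| <= del -> `|m2 - s2| <= del -> `|mh - k| <= del ->
  `|s2| <= M -> `|k| <= H -> `|h| <= H -> 0 <= q <= del ->
  2 * theta * m1 + (kap + eps) * m2 + (theta + eps) * mh + q <=
    theta * (2 * e0 + (2 * theta - 1) * s2 + k) + eta - eps * h /\
  theta * (2 * e0 + (2 * theta - 1) * s2 + k) - eta + eps * h <=
  2 * theta * m1 + (kap - eps) * m2 + (theta - eps) * mh - q.
Proof.
move=> kap th0 eps0 M_ge0 del0 del1 epsE delE m1e m2s mhk sM kH hH /andP[q0 qd].
have key : `|2 * theta * m1 + kap * m2 + theta * mh -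
    theta * (2 * e0 + (2 * theta - 1) * s2 + k)| <=
    del * (3 * theta + `|kap|).
  have -> : 2 * theta * m1 + kap * m2 + theta * mh -
      theta * (2 * e0 + (2 * theta - 1) * s2 + k) =
      2 * theta * (m1 - e0) + kap * (m2 - s2) + theta * (mh - k).
    by rewrite /kap; ring.
  have n1 : `|2 * theta * (m1 - e0)| <= 2 * theta * del.
    by rewrite normrM ger0_norm ?mulr_ge0 ?(ltW th0)// ler_wpM2l ?mulr_ge0 ?(ltW th0).
  have n2 : `|kap * (m2 - s2)| <= `|kap| * del by rewrite normrM ler_wpM2l.
  have n3 : `|theta * (mh - k)| <= theta * del.
    by rewrite normrM gtr0_norm// ler_wpM2l// ltW.
  apply: (le_trans (ler_normD _ _)).
  have n4 := ler_normD (2 * theta * (m1 - e0)) (kap * (m2 - s2)).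
  apply: (le_trans (lerD (le_trans n4 (lerD n1 n2)) n3)).
  by rewrite le_eqVlt; apply/orP; left; apply/eqP; ring.
move: key; rewrite ler_norml => /andP[key1 key2].
move: m2s mhk sM kH hH; rewrite !ler_norml.
move=> /andP[? ?] /andP[? ?] /andP[? ?] /andP[? ?] /andP[? ?].
have em1 : eps * m2 <= eps * (M + 1) by rewrite ler_pM2l//; lra.
have em2 : eps * (- (M + 1)) <= eps * m2 by rewrite ler_pM2l//; lra.
have eh1 : eps * mh <= eps * (H + 1) by rewrite ler_pM2l//; lra.
have eh2 : eps * (- (H + 1)) <= eps * mh by rewrite ler_pM2l//; lra.
have ehu : eps * h <= eps * H by rewrite ler_pM2l.
move: key1 key2; move: (theta * (2 * e0 + (2 * theta - 1) * s2 + k)) => G.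
by clearbody kap => key1 key2; split; lra.
Qed.

(** The summand eps * h cancels exactly the error of the current value psi, whose first order term
    theta h t supplies the -h of the corrected drift g + k - h. *)
Lemma expansion_assembly theta eps eta s t h psi b b' g k : 0 < s -> 0 < t ->
  1 + (theta - eps) * (h * t) <= psi <= 1 + (theta + eps) * (h * t) ->
  b <= theta * (g + k) + eta - eps * h ->
  theta * (g + k) - eta + eps * h <= b' ->
  s * (1 + t * b) <= s * psi + s * t * (theta * (g + k - h) + eta) /\
  s * psi + s * t * (theta * (g + k - h) - eta) <= s * (1 + t * b').
Proof.
move=> s0 t0 /andP[p1 p2] bu bl; split; rewrite -mulrA -mulrDr ler_pM2l//.
  have := ler_wpM2l (ltW t0) bu; move: p1; rewrite !(mulrBl, mulrDl, mulrBr, mulrDr) => *.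
  lra.
have := ler_wpM2l (ltW t0) bl; move: p2; rewrite !(mulrBl, mulrDl, mulrBr, mulrDr) => *.
lra.
Qed.

Lemma scaled_range (X2 h a0 H : R) : 0 < X2 -> 0 <= h <= a0 * X2 -> h <= H ->
  H <= X2 -> 0 <= h * X2^-1 <= a0 /\ h * X2^-1 <= 1.
Proof.
move=> X0 /andP[h0 ha] hH HX; rewrite !ler_pdivrMr// ha mul1r (le_trans hH)//.
by rewrite divr_ge0// ltW.
Qed.

End expansion_arithmetic.

Lemma littleo_pinfty_sup (R : realType) (S : Type) (F : halfline R -> S -> \bar R)
    (g : halfline R -> R) :
  littleo_pinfty (fun x => ereal_sup [set `|F x u|%E | u in [set: S]]) g ->
  forall eps : R, 0 < eps -> exists M : R, forall x, M < hval x ->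
    forall u, (`|F x u| <= (eps * `|g x|)%:E)%E.
Proof.
move=> Fg eps /Fg[M FM]; exists M => x /FM Fx u.
apply: le_trans Fx; apply: le_trans (lee_abs _).
by apply: ereal_sup_ubound; exists u.
Qed.

Section angular_probability.
Context (R : realType) (d : measure_display) (S : measurableMetricType R d).
Variables (Ks : R.-pker (halfline R * S)%type ~> (halfline R * S)%type)
  (x : halfline R) (u : S).

Definition angular_probability : set S -> \bar R := angular_kernel Ks x u.

Let angular0 : angular_probability set0 = 0%E.
Proof. by rewrite /angular_probability /angular_kernel setX0 measure0. Qed.

Let angular_ge0 B : (0 <= angular_probability B)%E.
Proof. exact: measure_ge0. Qed.

Let angular_sigma_additive : semi_sigma_additive angular_probability.
Proof.
move=> F mF tF mUF; rewrite /angular_probability /angular_kernel setX_bigcupr.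
apply: measure_semi_sigma_additive.
- by move=> n; exact: measurableX.
- apply/trivIsetP => i j _ _ ij; rewrite -setXI setIid.
  by have /trivIsetP/(_ i j I I ij) -> := tF; rewrite setX0.
- by rewrite -setX_bigcupr; exact: measurableX.
Qed.

HB.instance Definition _ := isMeasure.Build _ _ _ angular_probability
  angular0 angular_ge0 angular_sigma_additive.

Let angularT : angular_probability setT = 1%E.
Proof. by rewrite /angular_probability /angular_kernel setXTT prob_kernel. Qed.

HB.instance Definition _ := Measure_isProbability.Build _ _ _
  angular_probability angularT.

Lemma angular_probability_mean (h : S -> R) : bounded_measurable h ->
  \int[angular_probability]_v h v = \int[Ks (x, u)]_z h z.2.
Proof.
move=> bh; rewrite /Rintegral; congr fine.
have E : angular_probability =
    pushforward (Ks (x, u)) (snd : (halfline R * S)%type -> S).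
  apply/funext => B; rewrite /angular_probability /angular_kernel /pushforward.
  by congr (Ks _ _); apply/seteqP; split => [z []|z].
rewrite (_ : (\int[angular_probability]_v (h v)%:E)%E =
  \int[pushforward (Ks (x, u)) (snd : (halfline R * S)%type -> S)]_v (h v)%:E)%E; last first.
  by rewrite -E.
rewrite (@integral_pushforward _ _ _ _ _ snd)//.
- by apply/measurable_EFinP; have [] := bh.
- have bh2 : bounded_measurable (h \o (snd : (halfline R * S)%type -> S)).
    have [mh [M hM]] := bh; split; first exact: measurableT_comp.
    by exists M => z; exact: hM.
  exact: (bounded_measurable_integrable (kernel_probability Ks (x, u)) bh2).
Qed.

End angular_probability.

Definition lyapunov (R : realType) (S : Type) (h : S -> R) (theta : R)
  (z : halfline R * S) : R := (hval z.1 ^+ 2 + h z.2) `^ theta.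

Lemma lyapunov_scaled (R : realType) (S : Type) (h : S -> R) (theta : R)
    (x : halfline R) (u : S) : 0 < hval x -> 0 <= h u ->
  lyapunov h theta (x, u) =
    (hval x ^+ 2) `^ theta * (1 + h u * (hval x ^+ 2)^-1) `^ theta.
Proof.
move=> X0 h0; have X20 : 0 < hval x ^+ 2 by exact: exprn_gt0.
rewrite -powRM ?(ltW X20)//; last by rewrite addr_ge0// divr_ge0// ltW.
by rewrite mulrDr mulr1 (mulrC (h u)) mulVKf// gt_eqF.
Qed.

(* A C^1 function of the radius equal to 1 beyond y and nonpositive below y/2,
   whose conditional mean decreases by at most O(1/y^2) per step. *)
Definition bump (R : realType) (S : Type) (y : R) (z : halfline R * S) : R :=
  1 - 4 * (Num.max 0 (y - hval z.1)) ^+ 2 / y ^+ 2.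

Lemma hval_ge0 (R : realType) (x : halfline R) : 0 <= hval x.
Proof. by rewrite /hval. Qed.

Lemma bump_range (R : realType) (S : Type) (y : R) (z : halfline R * S) : 0 < y ->
  0 <= 4 * (Num.max 0 (y - hval z.1)) ^+ 2 / y ^+ 2 <= 4.
Proof.
move=> y0; have y20 : 0 < y ^+ 2 by exact: exprn_gt0.
have m0 : 0 <= Num.max 0 (y - hval z.1) by rewrite le_max lexx.
have my : Num.max 0 (y - hval z.1) <= y by rewrite ge_max (ltW y0) gerBl hval_ge0.
apply/andP; split; last first.
  by rewrite ler_pdivrMr// ler_pM2l// ler_sqr ?nnegrE// ltW.
apply: mulr_ge0; last by rewrite invr_ge0 ltW.
by apply: mulr_ge0 => //; exact: sqr_ge0.
Qed.

(* bump makes up for the loss of drift of the truncated Lyapunov function near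
   and beyond the level y. *)
Definition capped (R : realType) (S : Type) (h : S -> R) (theta y : R)
    (z : halfline R * S) : R :=
  Num.max (Num.min (lyapunov h theta z / (4 * y ^+ 2) `^ theta) 1) (bump y z).

(** * Drift of the Lyapunov functions *)

Section kernel_drift.
Context {R : realType} {d : measure_display} {S : measurableMetricType R d}.
Hypothesis S_compact : compact [set: S].
Hypothesis S_borel : @measurable d S = <<s @open S >>.
Variables (Ks : R.-pker (halfline R * S)%type ~> (halfline R * S)%type)
  (K : R.-pker S ~> S) (pi : probability S R) (p Bp : R) (e sigma2 : S -> R).
Hypothesis K_unique : forall nu : probability S R, invariant_probability K nu ->
  forall B : set S, measurable B -> nu B = pi B.
Hypothesis K_continuous : forall u : S, tv_dist (K v) (K u) @[v --> u] --> 0%E.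
Hypothesis asymptotically_markov :
  ereal_sup [set tv_norm_sub (angular_kernel Ks x u) (K u) | u in [set: S]]
    @[x --> @halfline_pinfty R] --> 0%E.
Hypothesis hp : 2 < p.
Hypotheses (e_continuous : continuous e) (sigma2_continuous : continuous sigma2).
Hypothesis drift : littleo_pinfty (fun x => ereal_sup
  [set `|increment_moment Ks 1 x u - (e u / hval x)%:E|%E | u in [set: S]])
  (fun x => (hval x)^-1).
Hypothesis variance : littleo_pinfty (fun x => ereal_sup
  [set `|increment_moment Ks 2 x u - (sigma2 u)%:E|%E | u in [set: S]])
  (fun=> 1).

Let Kp z : probability (halfline R * S)%type R := kernel_probability Ks z.
Let Y (x : halfline R) (z : halfline R * S) : R := hval z.1 - hval x.

(** A premise of the drift estimates rather than a fact about all states: [moment_ok_ae] provides it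
    at almost every visited state beyond xB. *)
Definition moment_ok (x : halfline R) (u : S) :=
  (\int[Ks (x, u)]_z (`|hval z.1 - hval x| `^ p)%:E <= Bp%:E)%E.

Let mX : measurable_fun [set: (halfline R * S)%type] (fun z => hval z.1).
Proof. exact: measurableT_comp (@measurable_hval R) measurable_fst. Qed.

Let mY x : measurable_fun setT (Y x).
Proof. exact: measurable_funB. Qed.

Let bump_bounded y : 0 < y -> bounded_measurable (bump y : (halfline R * S)%type -> R).
Proof.
move=> y0; split.
  apply: measurable_funB => //; apply: measurable_funM => //.
  apply: measurable_funM => //; apply: measurable_funX.
  by apply: measurable_maxr => //; exact: measurable_funB.
exists (1 + 4) => z; rewrite /bump (le_trans (ler_normB _ _))// normr1 lerD2l.
by have /andP[b0 b4] := bump_range z y0; rewrite ger0_norm.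
Qed.

Let Yp x u : moment_ok x u ->
  (Kp (x, u)).-integrable setT (EFin \o (fun z => `|Y x z| `^ p)).
Proof.
move=> ok; apply/integrableP; split.
  apply/measurable_EFinP; apply: (measurableT_comp (measurable_powR p)).
  by apply: measurableT_comp => //; exact: mY.
rewrite (le_lt_trans _ (ltry Bp))//; apply: le_trans ok.
rewrite le_eqVlt; apply/orP; left; apply/eqP; apply: eq_integral => z _ /=.
by rewrite ger0_norm ?powR_ge0.
Qed.

Let moment_ge0 x u : 0 <= \int[Kp (x, u)]_z (`|Y x z| `^ p).
Proof. by apply: Rintegral_ge0 => z _; exact: powR_ge0. Qed.

Let moment_le x u : moment_ok x u -> \int[Kp (x, u)]_z (`|Y x z| `^ p) <= Bp.
Proof.
move=> ok; rewrite -lee_fin /Rintegral fineK//.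
by apply: integrable_fin_num => //; exact: Yp.
Qed.

Let kernel_moments (eps : R) : 0 < eps -> exists2 x1, 0 < x1 & forall x u,
  x1 < hval x -> moment_ok x u ->
  `|hval x * \int[Kp (x, u)]_z Y x z - e u| <= eps /\
  `|\int[Kp (x, u)]_z (Y x z ^+ 2) - sigma2 u| <= eps.
Proof.
move=> eps0.
have [M1 H1] := littleo_pinfty_sup drift eps0.
have [M2 H2] := littleo_pinfty_sup variance eps0.
exists (Num.max 1 (Num.max M1 M2)); first by rewrite lt_max ltr01.
move=> x u; rewrite !gt_max => /and3P[x1 xM1 xM2] ok.
have x0 : 0 < hval x by exact: lt_trans x1.
have i1 := integrable_increment (mY x) hp (Yp ok).
have i2 := integrable_increment_sqr (mY x) hp (Yp ok).
split.
  have := H1 x xM1 u.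
  have -> : increment_moment Ks 1 x u = (\int[Kp (x, u)]_z Y x z)%:E.
    rewrite /Rintegral fineK; first by apply: eq_integral => z _; rewrite expr1.
    exact: (integrable_fin_num measurableT i1).
  rewrite -EFinB lee_fin (gtr0_norm (_ : 0 < (hval x)^-1)) ?invr_gt0// => h.
  have -> : hval x * \int[Kp (x, u)]_z Y x z - e u =
      hval x * (\int[Kp (x, u)]_z Y x z - e u / hval x).
    by field; rewrite gt_eqF.
  by rewrite normrM gtr0_norm// mulrC -ler_pdivlMr.
have := H2 x xM2 u.
have -> : increment_moment Ks 2 x u = (\int[Kp (x, u)]_z (Y x z ^+ 2))%:E.
  by rewrite /Rintegral fineK//; exact: (integrable_fin_num measurableT i2).
by rewrite -EFinB lee_fin normr1 mulr1.
Qed.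

Let angular_mean (h : S -> R) (H eps : R) : 0 < eps -> continuous h ->
  (forall u, `|h u| <= H) -> exists M, forall x u, M < hval x ->
  `|\int[Kp (x, u)]_z h z.2 - \int[K u]_v h v| <= eps.
Proof.
move=> eps0 ch hH0; pose N := `|H| + 1.
have N0 : 0 < N by rewrite ltr_wpDl.
have hN u : `|h u| <= N.
  by rewrite (le_trans (hH0 u))// (le_trans (ler_norm _))// lerDl.
have bh : bounded_measurable h by exact: continuous_bounded_measurable.
pose g u := N^-1 * h u.
have cg : continuous g by move=> u; apply: cvgM; [exact: cvg_cst|exact: ch].
have bg : bounded_measurable g by exact: bounded_measurableZ.
have g1 u : `|g u| <= 1.
  by rewrite normrM gtr0_norm ?invr_gt0// ler_pdivrMl// mulr1.
have hE : h = (fun u => N * g u) by apply/funext => u; rewrite /g mulVKf// gt_eqF.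
have eN : 0 < eps / N by rewrite divr_gt0.
have /fine_cvgP[fn cn] := asymptotically_markov.
have /cvgrPdist_le/(_ _ eN) ne := cn.
have [M HM] : halfline_pinfty (fun x => forall u,
    (tv_norm_sub (angular_probability Ks x u) (kernel_probability K u) <= (eps / N)%:E)%E).
  apply: filterS2 fn ne => x fx; rewrite sub0r normrN => /(le_trans (ler_norm _)).
  rewrite -lee_fin fineK// => sx u; apply: le_trans sx.
  by apply: ereal_sup_ubound; exists u.
exists M => x u /HM/(_ u) tvu.
have tg := tv_norm_sub_Rintegral S_borel cg g1 tvu.
have -> : \int[Kp (x, u)]_z h z.2 = N * \int[angular_probability Ks x u]_v g v.
  rewrite -[LHS](angular_probability_mean Ks x u bh) {1}hE.
  have [_ _ LZ _] := mean_functional_probability (angular_probability Ks x u).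
  exact: LZ.
have -> : \int[K u]_v h v = N * \int[kernel_probability K u]_v g v.
  rewrite {1}hE; have [_ _ LZ _] := mean_functional_probability (kernel_probability K u).
  exact: LZ.
by rewrite -mulrBr normrM gtr0_norm// mulrC -ler_pdivlMr.
Qed.

Let theta_g (theta : R) u := 2 * e u + (2 * theta - 1) * sigma2 u.

(** D is the corrected drift, which a Poisson subsolution makes of one sign for all angles. Upper
    and lower estimates share one expansion; for the lower one the next value is truncated, as the
    capped function requires. *)
Let lyapunov_expansion (h : S -> R) (H theta eta : R) :
  0 < theta -> 2 * theta <= p -> 0 < eta -> continuous h ->
  (forall u, 1 <= h u <= H) -> exists2 x1, 0 < x1 & forall x u,
  x1 < hval x -> moment_ok x u ->
  let s := (hval x ^+ 2) `^ theta in let t := (hval x ^+ 2)^-1 in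
  let D := theta_g theta u + \int[K u]_v h v - h u in
  [/\ (\int[Ks (x, u)]_z (lyapunov h theta z)%:E <=
        (lyapunov h theta (x, u) + s * t * (theta * D + eta))%:E)%E,
    lyapunov h theta (x, u) + s * t * (theta * D - eta) <=
      \int[Ks (x, u)]_z Num.min (lyapunov h theta z) ((4 * hval x ^+ 2) `^ theta) &
    s <= lyapunov h theta (x, u) <= 2 `^ theta * s].
Proof.
move=> th0 thp eta0 ch hH.
have [_ [M0 sM0]] := continuous_bounded_measurable S_compact S_borel sigma2_continuous.
pose M := `|M0|.
have M_ge0 : 0 <= M by exact: normr_ge0.
have sM u : `|sigma2 u| <= M by rewrite (le_trans (sM0 u))// ler_norm.
have bh := continuous_bounded_measurable S_compact S_borel ch.
(* H < 1 contradicts the bounds on h as soon as there is an angle u. *)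
have [H1|nS] := pselect (1 <= H); last first.
  exists 1 => // x u; exfalso; apply: nS; have /andP[] := hH u; exact: le_trans.
have h_norm u : `|h u| <= H.
  by have /andP[h1 hle] := hH u; rewrite ger0_norm// (le_trans _ h1).
pose kap := theta * (2 * theta - 1).
have W0 : 0 < 2 * (M + 2 + 2 * H) by lra.
pose eps := eta / (2 * (M + 2 + 2 * H)).
have eps0 : 0 < eps by rewrite divr_gt0.
have epsE : eps * (M + 2 + 2 * H) = eta / 2.
  by rewrite /eps; field; lra.
have V0 : 0 < 2 * (3 * theta + `|kap| + 1).
  by rewrite mulr_gt0// ltr_wpDl// addr_ge0// mulr_ge0// ltW.
pose del := Num.min 1 (eta / (2 * (3 * theta + `|kap| + 1))).
have del0 : 0 < del by rewrite lt_min ltr01 divr_gt0.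
have del1 : del <= 1 by rewrite ge_min lexx.
have delE : del * (3 * theta + `|kap| + 1) <= eta / 2.
  rewrite ler_pdivlMr// -mulrA (mulrC _ 2) -ler_pdivlMr//.
  by rewrite ge_min lexx orbT.
have [C [a0 [C0 a00 bounds]]] := square_powR_bounds th0 hp thp eps0.
have [xa xa0 Ha] := kernel_moments del0.
have [xb Hb] := angular_mean del0 ch h_norm.
have p20 : 0 < p - 2 by rewrite subr_gt0.
(* Beyond xc the p-th moment term C Bp x^(2 - p) is at most del; beyond xd both H <= x^2 and H <= a0
   x^2 hold, so that h/x^2 is in the range of the expansion. *)
have [xc xc0 Hc] := powR_ge_near (C * `|Bp| / del) p20.
have [xd xd0 Hd] := powR_ge_near (Num.max H (H / a0)) (ltr0n R 2).
exists (Num.max (Num.max xa xb) (Num.max xc xd)); first by rewrite !lt_max xa0.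
move=> x u; rewrite !gt_max => /andP[/andP[xxa xxb] /andP[xxc xxd]] ok s t D.
have X0 : 0 < hval x by exact: lt_trans xxa.
have X20 : 0 < hval x ^+ 2 by exact: exprn_gt0.
have s0 : 0 < s by exact: powR_gt0.
have t0 : 0 < t by rewrite invr_gt0.
have [m1e m2s] := Ha x u xxa ok.
have mhk := Hb x u xxb.
have := Hd _ (ltW xxd); rewrite powR_mulrn ?(ltW X0)// ge_max => /andP[XH XHa].
have hX v : 0 <= h v <= a0 * hval x ^+ 2.
  have /andP[h1 hle] := hH v; rewrite (le_trans _ h1)//= (le_trans hle)//.
  by rewrite mulrC -ler_pdivrMr.
pose mp := \int[Kp (x, u)]_z (`|Y x z| `^ p).
pose q := C * (hval x ^+ 2 / hval x `^ p * mp).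
have qd : 0 <= q <= del.
  have Xp : 0 < hval x `^ p by exact: powR_gt0.
  have mp0 : 0 <= mp := moment_ge0 x u.
  have XX0 : 0 <= hval x ^+ 2 / hval x `^ p by apply/ltW/divr_gt0.
  apply/andP; split; first by do 2?apply: mulr_ge0.
  rewrite /q; have := Hc _ (ltW xxc).
  rewrite powRB; last by rewrite gt_eqF ?implybT.
  rewrite powR_mulrn ?(ltW X0)// => Hq.
  have mpB : mp <= `|Bp| by rewrite (le_trans (moment_le ok))// ler_norm.
  rewrite mulrCA; apply: (le_trans (ler_wpM2l XX0 (ler_wpM2l C0 mpB))).
  rewrite mulrC -ler_pdivlMr ?divr_gt0// invf_div.
  by rewrite -ler_pdivrMl// mulrC.
have XY z : - hval x <= Y x z by rewrite /Y lerDr hval_ge0.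
have bh2 : bounded_measurable (fun z : halfline R * S => h z.2).
  have [mh [Mh hMh]] := bh; split; first exact: measurableT_comp.
  by exists Mh => z.
have lyE z : ((hval x + Y x z) ^+ 2 + h z.2) `^ theta = lyapunov h theta z.
  by rewrite /Y (addrC (hval x)) subrK.
have lyE2 : (\int[Kp (x, u)]_z (((hval x + Y x z) ^+ 2 + h z.2) `^ theta)%:E =
    \int[Ks (x, u)]_z (lyapunov h theta z)%:E)%E.
  by apply: eq_integral => z _; rewrite lyE.
have lyE3 : \int[Kp (x, u)]_z (Num.min (((hval x + Y x z) ^+ 2 + h z.2) `^ theta)
      ((4 * hval x ^+ 2) `^ theta)) =
    \int[Ks (x, u)]_z (Num.min (lyapunov h theta z) ((4 * hval x ^+ 2) `^ theta)).
  by apply: eq_Rintegral => z _; rewrite lyE.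
have /andP[_ huH] := hH u.
have [a_ok ht1] := scaled_range X20 (hX u) huH XH.
have /andP[hu0 _] := hX u.
have lyx := lyapunov_scaled theta X0 hu0.
have [b0l b0u] : 1 + (theta - eps) * (h u * t) <= (1 + h u * t) `^ theta <=
    1 + (theta + eps) * (h u * t) /\ 1 <= (1 + h u * t) `^ theta <= 2 `^ theta.
  exact: expansion_at0 th0 (lt_trans (ltr0n R 2) hp) a_ok ht1 bounds.
have kH : `|\int[K u]_v h v| <= H.
  exact: (mean_functional_norm (mean_functional_probability (kernel_probability K u)) bh h_norm).
have hHu : `|h u| <= H by exact: h_norm.
have [bup blo] := expansion_arith th0 eps0 M_ge0 del0 del1 epsE delE m1e m2s mhk
  (sM u) kH hHu qd.
have [aup alo] := expansion_assembly s0 t0 b0l bup blo.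
split.
- rewrite -lyE2; apply: (le_trans (mean_upper (mY x) bh2 hp (Yp ok) X0 XY (fun z => hX z.2) bounds)).
  by rewrite lee_fin lyx; exact: aup.
- rewrite -lyE3 lyx; apply: (le_trans alo).
  exact: (mean_lower (mY x) bh2 hp (Yp ok) X0 XY (fun z => hX z.2) bounds).
- rewrite lyx; have /andP[l1 l2] := b0u; apply/andP; split.
    by rewrite -[leLHS]mulr1 ler_pM2l.
  by rewrite mulrC ler_pM2r.
Qed.

Let theta_g_continuous theta : continuous (theta_g theta).
Proof.
by move=> u; apply: cvgD; apply: cvgM; (exact: cvg_cst || exact: e_continuous
  || exact: sigma2_continuous).
Qed.

(* Adding a constant to h leaves Kh - h unchanged. *)
Let normalise (h0 : S -> R) : continuous h0 -> exists (h : S -> R) (H : R),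
  [/\ continuous h, forall u : S, 1 <= h u <= H &
    forall u, \int[K u]_v h v - h u = \int[K u]_v h0 v - h0 u].
Proof.
move=> ch0.
have bh0 := continuous_bounded_measurable S_compact S_borel ch0.
have [_ [M hM]] := bh0.
exists (fun u => h0 u + (M + 1)), (2 * M + 1); split.
- by move=> u; apply: cvgD; [exact: ch0|exact: cvg_cst].
- by move=> u; have := hM u; rewrite ler_norml => /andP[? ?]; apply/andP; split; lra.
- move=> u; have MK := mean_functional_probability (kernel_probability K u).
  have [_ LD _ _] := MK.
  rewrite -[\int[K u]_v (h0 v + (M + 1))]/(\int[kernel_probability K u]_v (h0 v + (M + 1))).
  rewrite LD//; last exact: bounded_measurable_cst.
  rewrite (mean_functional_cst MK).
  by rewrite -[\int[K u]_v h0 v]/(\int[kernel_probability K u]_v h0 v); ring.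
Qed.

(** [sigma2] is introduced only as a limit of second moments; it inherits their sign. *)
Lemma variance_ge0 u : 0 <= sigma2 u.
Proof.
apply/ler_addgt0Pr => eps eps0.
have [M HM] := littleo_pinfty_sup variance eps0.
have M0 : 0 <= `|M| + 1 by rewrite addr_ge0.
have /HM/(_ u) : M < hval (NngNum M0 : halfline R).
  by rewrite /hval /= (le_lt_trans (ler_norm _))// ltrDl.
have : (0 <= increment_moment Ks 2 (NngNum M0 : halfline R) u)%E.
  by apply: integral_ge0 => z _; rewrite lee_fin sqr_ge0.
case: (increment_moment _ _ _ _) => [r| |] //.
  by rewrite lee_fin -EFinB lee_fin normr1 mulr1 ler_norml => r0 /andP[? ?]; lra.
Qed.

(** The exponential form, obtained from 1 - v <= exp(-v), makes the factors of successive steps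
    multiply to exp(-c n/y^2) below the level y. *)
Lemma drift_upper theta : 0 < theta -> 2 * theta <= p ->
  delta pi e sigma2 theta < 0 -> exists (h : S -> R) (H c x1 : R),
  [/\ continuous h, forall u : S, 1 <= h u <= H, 0 < c, 0 < x1 &
    forall x u, x1 < hval x -> moment_ok x u ->
    (\int[Ks (x, u)]_z (lyapunov h theta z)%:E <=
      (expR (- (c / hval x ^+ 2)) * lyapunov h theta (x, u))%:E)%E].
Proof.
move=> th0 thp dneg.
have [h0 [c0 [ch0 c00 hc]]] := poisson_subsolution S_compact S_borel
  K_unique K_continuous (@theta_g_continuous theta) dneg.
have [h [H [ch hH hE]]] := normalise ch0.
have tc0 : 0 < theta * c0 by exact: mulr_gt0.
have eta0 : 0 < theta * c0 / 2 by rewrite divr_gt0.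
have [x1 x10 Hx] := lyapunov_expansion th0 thp eta0 ch hH.
have two0 : 0 < 2 `^ theta :> R by exact: powR_gt0.
(* Half of theta * c0 absorbs the error eta; the division by 2^theta converts a multiple of x^(2
   theta) into one of f, as f <= 2^theta x^(2 theta). *)
exists h, H, (theta * c0 / 2 / 2 `^ theta), x1; split => //; first exact: divr_gt0.
move=> x u xx ok; have [up _ /andP[_ l2]] := Hx x u xx ok.
apply: (le_trans up); rewrite lee_fin.
have X20 : 0 < hval x ^+ 2 by rewrite exprn_gt0// (lt_trans x10).
set s := (hval x ^+ 2) `^ theta in l2 *; set t := (hval x ^+ 2)^-1.
set f := lyapunov h theta (x, u) in l2 *.
have f0 : 0 <= f by exact: powR_ge0.
have t0 : 0 < t by rewrite invr_gt0.
rewrite (@le_trans _ _ ((1 + - (theta * c0 / 2 / 2 `^ theta / hval x ^+ 2)) * f))//; last first.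
  by rewrite ler_wpM2r// expR_ge1Dx.
have hcu : theta_g theta u + \int[K u]_v h v - h u <= - c0.
  by rewrite -addrA hE addrA.
have : theta * (theta_g theta u + \int[K u]_v h v - h u) <= - (theta * c0).
  by rewrite -mulrN ler_pM2l.
move: (theta * (_ - h u)) => D Dle.
have s0 : 0 <= s by exact: powR_ge0.
have st : s * t * (D + theta * c0 / 2) <= - (s * t * (theta * c0 / 2)).
  by rewrite -mulrN ler_wpM2l ?mulr_ge0 ?(ltW t0)//; lra.
have ft : t * (theta * c0 / 2) / 2 `^ theta * f <= s * t * (theta * c0 / 2).
  rewrite (_ : t * _ / _ * f = t * (theta * c0 / 2) * (f / 2 `^ theta)); last by ring.
  rewrite (_ : s * t * _ = t * (theta * c0 / 2) * s); last by ring.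
  apply: ler_wpM2l; first exact: mulr_ge0 (ltW t0) (ltW eta0).
  by rewrite ler_pdivrMr// mulrC.
rewrite mulrDl mul1r lerD2l (le_trans st)// mulNr lerN2.
apply: le_trans ft; rewrite le_eqVlt; apply/orP; left; apply/eqP.
by rewrite /t; ring.
Qed.

(** With r the positive part of y - x, the squared positive part at the next radius is at most (r -
    Y)^2. So [bump] lies above a quadratic polynomial in the increment Y that agrees with it at Y =
    0 and has an explicit mean. As r <= 2 x, the linear term is controlled by x E[Y], which is
    bounded. *)
Let bump_drift : exists lam x1 : R, [/\ 0 < lam, 0 < x1 & forall y x u, 0 < y ->
  x1 < hval x -> y <= 2 * hval x -> moment_ok x u ->
  bump y (x, u) - lam / y ^+ 2 <= \int[Kp (x, u)]_z bump y z].
Proof.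
have [_ [E0 eE]] := continuous_bounded_measurable S_compact S_borel e_continuous.
have [_ [M0 sM]] := continuous_bounded_measurable S_compact S_borel sigma2_continuous.
pose E := `|E0|; pose M := `|M0|.
have E_ge0 : 0 <= E by exact: normr_ge0.
have M_ge0 : 0 <= M by exact: normr_ge0.
have [x1 x10 Hx] := kernel_moments (@ltr01 R).
(* The linear term contributes 8 times 2 (E + 1), the quadratic one 4 (M + 1). *)
exists (16 * (E + 1) + 4 * (M + 1)), x1; split => //; first by lra.
move=> y x u y0 xx yx ok; have [m1 m2] := Hx x u xx ok.
have X0 : 0 < hval x by exact: lt_trans xx.
have y20 : 0 < y ^+ 2 by exact: exprn_gt0.
pose r := Num.max 0 (y - hval x).
have r0 : 0 <= r by rewrite le_max lexx.
have r2 : r <= 2 * hval x by rewrite ge_max; apply/andP; split; lra.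
have i1 := integrable_increment (mY x) hp (Yp ok).
have i2 := integrable_increment_sqr (mY x) hp (Yp ok).
pose l z := 1 - 4 * r ^+ 2 / y ^+ 2 + (8 * r / y ^+ 2) * Y x z + (- 4 / y ^+ 2) * Y x z ^+ 2.
have J1 : (Kp (x, u)).-integrable setT (EFin \o (fun z => (8 * r / y ^+ 2) * Y x z)).
  by have := integrableZl measurableT (8 * r / y ^+ 2) i1; apply.
have J2 : (Kp (x, u)).-integrable setT (EFin \o (fun z => (- 4 / y ^+ 2) * Y x z ^+ 2)).
  by have := integrableZl measurableT (- 4 / y ^+ 2) i2; apply.
have J0 : (Kp (x, u)).-integrable setT (EFin \o (fun=> 1 - 4 * r ^+ 2 / y ^+ 2)).
  exact: bounded_measurable_integrable (bounded_measurable_cst _).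
have J01 : (Kp (x, u)).-integrable setT
    (EFin \o (fun z => 1 - 4 * r ^+ 2 / y ^+ 2 + (8 * r / y ^+ 2) * Y x z)).
  by have := integrableD measurableT J0 J1; apply.
have Jl : (Kp (x, u)).-integrable setT (EFin \o l).
  by have := integrableD measurableT J01 J2; apply.
have lE : \int[Kp (x, u)]_z l z = 1 - 4 * r ^+ 2 / y ^+ 2 +
    (8 * r / y ^+ 2) * \int[Kp (x, u)]_z Y x z +
    (- 4 / y ^+ 2) * \int[Kp (x, u)]_z (Y x z ^+ 2).
  rewrite /l RintegralD// RintegralD// !RintegralZl// Rintegral_cst//.
  by rewrite (congr1 fine (probability_setT (Kp (x, u)))) mulr1.
have lb z : l z <= bump y z.
  have : (Num.max 0 (y - hval z.1)) ^+ 2 <= (r - Y x z) ^+ 2.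
    have [yz|yz] := leP (y - hval z.1) 0.
      by rewrite expr0n sqr_ge0.
    rewrite ler_sqr ?nnegrE ?(ltW yz)//.
      by rewrite /Y; have : y - hval x <= r by [rewrite le_max lexx orbT]; lra.
    by rewrite /Y; have : y - hval x <= r by [rewrite le_max lexx orbT]; lra.
  rewrite /l /bump => h.
  rewrite (_ : 1 - _ + _ + _ = 1 - 4 * (r - Y x z) ^+ 2 / y ^+ 2); last by ring.
  by rewrite lerD2l lerN2 ler_pM2r ?invr_gt0// ler_pM2l.
have bumpb := bump_bounded y0.
apply: (@le_trans _ _ (\int[Kp (x, u)]_z l z)); last first.
  apply: le_Rintegral => //; exact: bounded_measurable_integrable.
rewrite lE /bump /= -/r.
move: m1 m2; move: (\int[_]_z Y x z) (\int[_]_z (Y x z ^+ 2)) => a b m1 m2.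
have eu := eE u; have su := sM u.
have eEu : `|e u| <= E by rewrite (le_trans eu)// ler_norm.
have sMu : `|sigma2 u| <= M by rewrite (le_trans su)// ler_norm.
have xa : `|hval x * a| <= E + 1.
  by move: m1 eEu; rewrite !ler_norml => /andP[? ?] /andP[? ?]; apply/andP; split; lra.
have bM : b <= M + 1.
  by move: m2 sMu; rewrite !ler_norml => /andP[? ?] /andP[? ?]; lra.
have ra : - (2 * (E + 1)) <= r * a.
  have : `|r * a| <= 2 * (E + 1).
    rewrite normrM (ger0_norm r0) (le_trans (ler_wpM2r (normr_ge0 _) r2))//.
    by rewrite -mulrA ler_pM2l// -[hval x in leLHS](gtr0_norm X0) -normrM.
  by rewrite ler_norml => /andP[].
rewrite -[leRHS]addrA lerD2l.
rewrite (_ : 8 * r / y ^+ 2 * a + _ = (8 * (r * a) - 4 * b) / y ^+ 2); last by ring.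
by rewrite -mulNr ler_pM2r ?invr_gt0//; lra.
Qed.

Lemma capped_bounded (h : S -> R) (theta y : R) : continuous h -> 0 < y ->
  bounded_measurable (capped h theta y) /\ forall z, 0 <= capped h theta y z <= 1.
Proof.
move=> ch y0; have y20 : 0 < y ^+ 2 by exact: exprn_gt0.
have mh : measurable_fun setT h by exact: continuous_measurable.
have c01 z : 0 <= capped h theta y z <= 1.
  rewrite /capped le_max le_min ler01 andbT divr_ge0 ?powR_ge0//=.
  rewrite ge_max ge_min lexx orbT /= /bump gerBl.
  by have /andP[] := bump_range z y0.
split => //; split; last first.
  by exists 1 => z; have /andP[? ?] := c01 z; rewrite ger0_norm.
apply: measurable_maxr.
  apply: measurable_minr => //; apply: measurable_funM => //.
  apply: (measurableT_comp (measurable_powR theta)); apply: measurable_funD.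
    exact: measurable_funX.
  exact: measurableT_comp mh measurable_snd.
apply: measurable_funB => //; apply: measurable_funM => //.
apply: measurable_funM => //; apply: measurable_funX.
by apply: measurable_maxr => //; exact: measurable_funB.
Qed.

(** Beyond y the capped function is 1 and [bump] alone bounds the loss. Below y, if the truncated f
    realises the maximum, its mean does not decrease. If [bump] does, it is positive there, so x >=
    y/2 and the truncated f is at least 16^(-theta); an absolute loss lam0/y^2 is then a relative
    loss with lam = lam0 16^theta. *)
Lemma drift_lower theta : 0 < theta -> 2 * theta <= p ->
  0 < delta pi e sigma2 theta -> exists (h : S -> R) (H lam x1 : R),
  [/\ continuous h, forall u : S, 1 <= h u <= H, 0 < lam, 0 < x1 &
    forall y x u, 0 < y -> x1 < hval x -> moment_ok x u ->
    (1 - lam / y ^+ 2) * capped h theta y (x, u) <=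
      \int[Ks (x, u)]_z capped h theta y z].
Proof.
move=> th0 thp dpos.
have cNg : continuous (fun u => -1 * theta_g theta u).
  by move=> u; apply: cvgM; [exact: cvg_cst|exact: theta_g_continuous].
have bg := continuous_bounded_measurable S_compact S_borel (@theta_g_continuous theta).
have Ndneg : \int[pi]_u (-1 * theta_g theta u) < 0.
  have [_ _ LZ _] := mean_functional_probability pi.
  by rewrite LZ// mulN1r oppr_lt0.
have [h0 [c0 [ch0 c00 hc]]] := poisson_subsolution S_compact S_borel
  K_unique K_continuous cNg Ndneg.
(* The subsolution was found for the negated drift, so the correction is the negative of h0. *)
have cNh0 : continuous (fun u => -1 * h0 u).
  by move=> u; apply: cvgM; [exact: cvg_cst|exact: ch0].
have [h [H [ch hH hE]]] := normalise cNh0.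
have bh0 := continuous_bounded_measurable S_compact S_borel ch0.
have tc0 : 0 < theta * c0 by exact: mulr_gt0.
have [xa xa0 Ha] := lyapunov_expansion th0 thp tc0 ch hH.
have [lam0 [xb [lam00 xb0 Hb]]] := bump_drift.
(* For y <= 2 x the ratio x^2/(4 y^2) is at least 1/16. *)
have a0 : 0 < 16^-1 `^ theta :> R by rewrite powR_gt0.
have a1 : 16^-1 `^ theta <= 1 :> R.
  have one : 1 = 1 `^ theta :> R by rewrite powR1.
  by rewrite [leRHS]one ge0_ler_powR ?nnegrE ?(ltW th0)//; lra.
(* Beyond xc, x^2 >= H; for x < y this gives x^2 + h <= 4 y^2, so the current value is not
   truncated. *)
have [xc xc0 Hc] := powR_ge_near H (ltr0n R 2).
exists h, H, (lam0 / 16^-1 `^ theta), (Num.max xa (Num.max xb xc)); split => //.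
  exact: divr_gt0.
  by rewrite lt_max xa0.
move=> y x u y0; rewrite !gt_max => /and3P[xxa xxb xxc] ok.
have X0 : 0 < hval x by exact: lt_trans xxa.
have y20 : 0 < y ^+ 2 by exact: exprn_gt0.
have Q0 : 0 < (4 * y ^+ 2) `^ theta by rewrite powR_gt0// mulr_gt0.
set lam := lam0 / 16^-1 `^ theta.
have lam_ge : lam0 <= lam by rewrite /lam ler_pdivlMr// ger_pMr.
have lam_gt0 : 0 < lam by exact: lt_le_trans lam_ge.
have ly0 : 0 < lam / y ^+ 2 by rewrite divr_gt0.
have [bG G01] := capped_bounded theta ch y0.
have iG := bounded_measurable_integrable (Kp (x, u)) bG.
have bumpG : y <= 2 * hval x -> bump y (x, u) - lam0 / y ^+ 2 <=
    \int[Ks (x, u)]_z capped h theta y z.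
  move=> yx; apply: (le_trans (Hb y x u y0 xxb yx ok)).
  apply: le_Rintegral => //.
    exact: bounded_measurable_integrable (bump_bounded y0).
  by move=> z _; rewrite /capped le_max lexx orbT.
have [yX|Xy] := leP y (hval x).
  have b1 : bump y (x, u) = 1.
    by rewrite /bump /= max_l ?subr_le0// expr0n mulr0 mul0r subr0.
  have -> : capped h theta y (x, u) = 1.
    by rewrite /capped b1 max_r// ge_min lexx orbT.
  have yx2 : y <= 2 * hval x by lra.
  apply: le_trans (bumpG yx2); rewrite b1 mulr1 lerD2l lerN2.
  by rewrite ler_pM2r ?invr_gt0.
have [_ lo /andP[sl _]] := Ha x u xxa ok.
have X20 : 0 < hval x ^+ 2 by exact: exprn_gt0.
set f := lyapunov h theta (x, u) in lo sl *.
have hcu : c0 <= theta_g theta u + \int[K u]_v h v - h u.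
  rewrite -addrA hE.
  have -> : \int[K u]_v (-1 * h0 v) = - \int[K u]_v h0 v.
    have [_ _ LZ _] := mean_functional_probability (kernel_probability K u).
    by rewrite -[LHS]/(\int[kernel_probability K u]_v (-1 * h0 v)) LZ// mulN1r.
  by have := hc u; lra.
have flo : f <= \int[Ks (x, u)]_z Num.min (lyapunov h theta z) ((4 * hval x ^+ 2) `^ theta).
  apply: le_trans lo; rewrite lerDl mulr_ge0//.
    by rewrite mulr_ge0 ?powR_ge0// invr_ge0 ltW.
  by rewrite subr_ge0 ler_pM2l.
have f0 : 0 <= f by exact: powR_ge0.
have fQ : f <= (4 * y ^+ 2) `^ theta.
  have /andP[h1 hle] := hH u.
  have := Hc _ (ltW xxc); rewrite powR_mulrn ?(ltW X0)// => HX.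
  have Xy2 : hval x ^+ 2 <= y ^+ 2 by rewrite ler_sqr ?nnegrE ?ltW.
  rewrite /f /lyapunov /= ge0_ler_powR ?nnegrE ?(ltW th0)//; try lra.
have AG : f / (4 * y ^+ 2) `^ theta <= \int[Ks (x, u)]_z capped h theta y z.
  rewrite ler_pdivrMr//; apply: (le_trans flo).
  have [_ _ LZ _] := mean_functional_probability (Kp (x, u)).
  rewrite [leRHS]mulrC -[leRHS](LZ _ _ bG).
  have mlyap : measurable_fun setT (lyapunov h theta).
    apply: (measurableT_comp (measurable_powR theta)); apply: measurable_funD.
      exact: measurable_funX.
    by apply: measurableT_comp (continuous_measurable S_borel ch) measurable_snd.
  apply: le_Rintegral => //.
  - apply: (bounded_measurable_integrable (Kp (x, u))); split; first exact: measurable_minr.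
    exists ((4 * hval x ^+ 2) `^ theta) => z.
    by rewrite ger0_norm ?ge_min ?lexx ?orbT// le_min !powR_ge0.
  - exact: (bounded_measurable_integrable (Kp (x, u)) (bounded_measurableZ _ bG)).
  move=> z _; rewrite -ler_pdivrMl// mulrC /capped le_max; apply/orP; left.
  rewrite le_min !ler_pdivrMr// mul1r divfK ?gt_eqF// ge_min lexx /=.
  rewrite ge_min; apply/orP; right; rewrite ge0_ler_powR ?nnegrE ?(ltW th0)//.
  + by rewrite mulr_ge0// ltW.
  + by rewrite mulr_ge0// ltW.
  + by rewrite ler_pM2l// ler_sqr ?nnegrE ?ltW.
have AE : Num.min (lyapunov h theta (x, u) / (4 * y ^+ 2) `^ theta) 1 =
    f / (4 * y ^+ 2) `^ theta.
  by rewrite min_l// ler_pdivrMr// mul1r.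
rewrite {1}/capped AE; have [BA|AB] := leP (bump y (x, u)) (f / (4 * y ^+ 2) `^ theta).
  apply: le_trans AG; rewrite ger_pMl ?gerBl ?(ltW ly0)//.
  by rewrite mulr_gt0 ?invr_gt0// (lt_le_trans _ sl)// powR_gt0.
have A0 : 0 <= f / (4 * y ^+ 2) `^ theta by rewrite divr_ge0 ?powR_ge0.
have yx2 : y <= 2 * hval x.
  rewrite leNgt; apply/negP => xy2.
  have : bump y (x, u) <= 0.
    rewrite /bump /= max_r ?subr_ge0 ?(ltW Xy)// subr_le0 ler_pdivlMr// mul1r.
    have -> : 4 * (y - hval x) ^+ 2 = (2 * (y - hval x)) ^+ 2 by ring.
    by rewrite ler_sqr ?nnegrE ?(ltW y0)//; lra.
  by rewrite leNgt (le_lt_trans A0 AB).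
apply: le_trans (bumpG yx2); rewrite mulrBl mul1r lerD2l lerN2.
rewrite mulrAC ler_pM2r ?invr_gt0// /lam mulrAC ler_pdivlMr// ler_pM2l//.
apply: le_trans (ltW AB); rewrite ler_pdivlMr//.
have y4 : 0 <= 4 * y ^+ 2 by apply: mulr_ge0 => //; exact: sqr_ge0.
have i16 : 0 <= 16^-1 :> R by rewrite invr_ge0.
apply: le_trans sl; rewrite -powRM//.
rewrite ge0_ler_powR ?nnegrE ?(ltW th0) ?sqr_ge0//; first exact: mulr_ge0.
have : y ^+ 2 <= (2 * hval x) ^+ 2 by rewrite ler_sqr ?nnegrE ?(ltW y0)//; lra.
by rewrite exprMn; lra.
Qed.

End kernel_drift.

(** * The Markov property for integrals *)

Section markov_integral.
Context {R : realType} {dO dT : measure_display} {Omega : measurableType dO}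
  {T : measurableType dT}.
Variables (P : probability Omega R) (k : R.-pker T ~> T) (G : set (set Omega))
  (X X' : Omega -> T) (B : set Omega).
Hypotheses (G_sigma : sigma_algebra [set: Omega] G) (G_measurable : G `<=` measurable).
Hypotheses (GX : forall A, measurable A -> G (X @^-1` A)) (GB : G B).
Hypothesis mX' : measurable_fun setT X'.
Hypothesis markov : forall A, measurable A -> forall D, G D ->
  (\int[P]_(w in D) k (X w) A = \int[P]_(w in D) (\1_(X' @^-1` A) w)%:E)%E.

Let mX : measurable_fun setT X.
Proof. by move=> _ A mA; rewrite setTI; apply/G_measurable/GX. Qed.

Let mB : measurable B.
Proof. exact: G_measurable. Qed.

Let GI : setI_closed G.
Proof.
have [G0 GC GU] := G_sigma.
have GC' A : G A -> G (~` A) by move=> /GC; rewrite setTD.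
have GU2 A D : G A -> G D -> G (A `|` D).
  move=> GA GD; rewrite -bigcup2E; apply: GU => -[|[|n]] //=.
by move=> A D GA GD; rewrite -[A `&` D]setCK setCI; apply/GC'/GU2; exact: GC'.
Qed.

Let kp (x : T) : probability T R := kernel_probability k x.

Let inner (Psi : T * T -> R) (x : T) : R := \int[kp x]_z Psi (x, z).

Let slice_bounded (Psi : T * T -> R) x : bounded_measurable Psi ->
  bounded_measurable (fun z => Psi (x, z)).
Proof.
move=> [mPsi [M PM]]; split; last by exists M => z.
by apply: measurableT_comp => //; exact: measurable_pair1.
Qed.

Let inner_bounded (Psi : T * T -> R) : bounded_measurable Psi ->
  bounded_measurable (inner Psi).
Proof.
move=> bP; have [mPsi [M PM]] := bP; split; last first.
  exists M => x; apply: (mean_functional_norm (mean_functional_probability (kp x))).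
    exact: slice_bounded.
  by move=> z.
have bM : bounded_measurable (fun _ : T * T => M) by exact: bounded_measurable_cst.
have bPM := bounded_measurableD bP bM.
have -> : inner Psi = (fun x => fine (\int[k x]_z (Psi (x, z) + M)%:E)%E - M).
  apply/funext => x; have [_ LD _ _] := mean_functional_probability (kp x).
  rewrite -[fine _]/(\int[kp x]_z (Psi (x, z) + M)) LD//.
  - by rewrite (mean_functional_cst (mean_functional_probability (kp x))) addrK.
  - exact: slice_bounded.
  - exact: bounded_measurable_cst.
apply: measurable_funB => //; apply: measurableT_comp => //.
apply: (@measurable_fun_integral_finite_kernel _ _ _ _ _ (fun z => (Psi z + M)%:E) k).
- by move=> v; rewrite lee_fin -lerBlDr sub0r; have := PM v; rewrite ler_norml => /andP[].
- by apply/measurable_EFinP; have [] := bPM.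
Qed.

Let pair_bounded (Psi : T * T -> R) : bounded_measurable Psi ->
  bounded_measurable (fun w => \1_B w * Psi (X w, X' w)).
Proof.
move=> [mPsi [M PM]]; split.
  apply: measurable_funM; first exact: measurable_indic.
  by apply: measurableT_comp => //; exact: measurable_fun_pair.
exists `|M| => w; rewrite normrM indicE; case: (w \in B) => /=.
  by rewrite normr1 mul1r (le_trans (PM _))// ler_norm.
by rewrite normr0 mul0r.
Qed.

Let comp_bounded (f : T -> R) : bounded_measurable f ->
  bounded_measurable (fun w => \1_B w * f (X w)).
Proof.
move=> [mf [M fM]]; split.
  apply: measurable_funM; first exact: measurable_indic.
  exact: measurableT_comp.
exists `|M| => w; rewrite normrM indicE; case: (w \in B) => /=.
  by rewrite normr1 mul1r (le_trans (fM _))// ler_norm.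
by rewrite normr0 mul0r.
Qed.

(* The constant completes the expectation over B to a mean functional. *)
Let L1 (Psi : T * T -> R) : R := \int[P]_w (\1_B w * Psi (X w, X' w)) +
  (1 - fine (P B)) * Psi point.
Let L2 (Psi : T * T -> R) : R := \int[P]_w (\1_B w * inner Psi (X w)) +
  (1 - fine (P B)) * Psi point.

Let PB1 : 0 <= 1 - fine (P B).
Proof.
rewrite subr_ge0 -lee_fin fineK ?fin_num_measure//.
exact: probability_le1.
Qed.

Let MP := mean_functional_probability P.

Let L1_mean : mean_functional L1.
Proof.
have [_ PD PZ Ple] := MP; split.
- rewrite /L1 (_ : (fun w => _) = \1_B); last by apply/funext => w; rewrite mulr1.
  by rewrite Rintegral_indic// mulr1 addrC subrK.
- move=> f g bf bg; rewrite /L1.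
  rewrite (_ : (fun w => _) = (fun w => \1_B w * f (X w, X' w) + \1_B w * g (X w, X' w))).
    by rewrite PD; [ring|exact: pair_bounded|exact: pair_bounded].
  by apply/funext => w; rewrite mulrDr.
- move=> c f bf; rewrite /L1.
  rewrite (_ : (fun w => _) = (fun w => c * (\1_B w * f (X w, X' w)))).
    by rewrite PZ; [ring|exact: pair_bounded].
  by apply/funext => w; rewrite mulrCA.
- move=> f g bf bg fg; rewrite /L1 lerD ?ler_wpM2l//.
  by apply: Ple => [||w]; [exact: pair_bounded|exact: pair_bounded|rewrite ler_wpM2l].
Qed.

Let L2_mean : mean_functional L2.
Proof.
have [_ PD PZ Ple] := MP; split.
- rewrite /L2 (_ : (fun w => _) = \1_B).
    by rewrite Rintegral_indic// mulr1 addrC subrK.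
  apply/funext => w; rewrite /inner.
  by rewrite (mean_functional_cst (mean_functional_probability (kp (X w)))) mulr1.
- move=> f g bf bg; rewrite /L2.
  rewrite (_ : (fun w => _) = (fun w => \1_B w * inner f (X w) + \1_B w * inner g (X w))).
    by rewrite PD; [ring|apply: comp_bounded; exact: inner_bounded..].
  apply/funext => w; rewrite -mulrDr; congr (_ * _).
  have [_ LD _ _] := mean_functional_probability (kp (X w)).
  by apply: LD; exact: slice_bounded.
- move=> c f bf; rewrite /L2.
  rewrite (_ : (fun w => _) = (fun w => c * (\1_B w * inner f (X w)))).
    by rewrite PZ; [ring|apply: comp_bounded; exact: inner_bounded].
  apply/funext => w; rewrite mulrCA; congr (_ * _).
  have [_ _ LZ _] := mean_functional_probability (kp (X w)).
  by apply: LZ; exact: slice_bounded.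
- move=> f g bf bg fg; rewrite /L2 lerD ?ler_wpM2l//.
  apply: Ple => [||w]; [apply: comp_bounded; exact: inner_bounded..|].
  rewrite ler_wpM2l//.
  have [_ _ _ Lle] := mean_functional_probability (kp (X w)).
  by apply: Lle => [||z] //; exact: slice_bounded.
Qed.

Let L_cvg (f_ : nat -> T * T -> R) : (forall n, bounded_measurable (f_ n)) ->
  (forall n x, `|f_ n x| <= 1) -> (forall x, f_ n x @[n --> \oo] --> 0) ->
  L1 (f_ n) @[n --> \oo] --> 0 /\ L2 (f_ n) @[n --> \oo] --> 0.
Proof.
move=> bf f1 f0.
have B1 (w : Omega) (c : R) : `|c| <= 1 -> `|\1_B w * c| <= 1.
  by move=> c1; rewrite indicE; case: (w \in B); rewrite ?mul1r ?mul0r ?normr0.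
have cz : (1 - fine (P B)) * f_ n point @[n --> \oo] --> 0.
  by rewrite -(mulr0 (1 - fine (P B))); apply: cvgM; [exact: cvg_cst|exact: f0].
split; rewrite -[X in _ --> X](addr0 0); apply: cvgD => //; apply: bounded_cvg_Rintegral.
- by move=> n; exact: pair_bounded.
- by move=> n w; exact: B1.
- by move=> w; rewrite -(mulr0 (\1_B w)); apply: cvgM; [exact: cvg_cst|exact: f0].
- by move=> n; apply: comp_bounded; exact: inner_bounded.
- move=> n w; apply: B1.
  apply: (mean_functional_norm (mean_functional_probability (kp (X w)))) => //.
  exact: slice_bounded.
- move=> w; rewrite -(mulr0 (\1_B w)); apply: cvgM; first exact: cvg_cst.
  apply: bounded_cvg_Rintegral => // n; exact: slice_bounded.
Qed.

(** The condition X in C is absorbed into the conditioning event, which leaves the Markov property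
    for the set D. *)
Let L_rectangle (C D : set T) : measurable C -> measurable D ->
  L1 \1_(C `*` D) = L2 \1_(C `*` D).
Proof.
move=> mC mD; rewrite /L1 /L2; congr (_ + _).
have GBC : G (B `&` X @^-1` C) by apply: GI => //; exact: GX.
have mBC : measurable (B `&` X @^-1` C) by exact: G_measurable.
have mXD : measurable (X' @^-1` D) by rewrite -[_ @^-1` _]setTI; exact: mX'.
have bk : bounded_measurable (fun x => fine (k x D)).
  split; first by apply: measurableT_comp => //; exact: measurable_kernel.
  exists 1 => x; rewrite ger0_norm ?fine_ge0// -lee_fin.
  rewrite (@fineK _ (k x D)); last exact: (@fin_num_measure _ _ _ (kp x)).
  exact: (probability_le1 (kp x)).
have := markov mD GBC; rewrite integral_indic// => E.
transitivity (fine (P (X' @^-1` D `&` (B `&` X @^-1` C)))).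
  rewrite -Rintegral_indic; last exact: measurableI.
  apply: eq_Rintegral => w _; rewrite !indicE.
  rewrite [X in _ * (nat_of_bool X)%:R](_ : _ = (X w \in C) && (X' w \in D)); last first.
    by apply/idP/andP; rewrite !inE.
  have mp (g : Omega -> T) A : (w \in g @^-1` A) = (g w \in A).
    by apply/idP/idP; rewrite !inE.
  rewrite !in_setI !mp.
  by case: (X' w \in D); case: (w \in B); case: (X w \in C); rewrite ?mulr1 ?mulr0.
rewrite -E integral_mkcond /Rintegral; congr fine; apply: eq_integral => w _.
have mp (g : Omega -> T) A : (w \in g @^-1` A) = (g w \in A).
  by apply/idP/idP; rewrite !inE.
rewrite /patch in_setI indicE mp.
have innerE : inner \1_(C `*` D) (X w) = (X w \in C)%:R * fine (k (X w) D).
  rewrite /inner -(@Rintegral_indic _ _ _ (kp (X w)))//.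
  have [_ _ LZ _] := mean_functional_probability (kp (X w)).
  rewrite -LZ; last exact: bounded_measurable_indic.
  apply: eq_Rintegral => z _; rewrite !indicE.
  rewrite [X in (nat_of_bool X)%:R = _](_ : _ = (X w \in C) && (z \in D)); last first.
    by apply/idP/andP; rewrite !inE.
  by case: (_ \in C); case: (_ \in D);
    rewrite ?mulr1 ?mulr0 ?mul1r ?mul0r.
rewrite innerE; case: (w \in B); case: (X w \in C) => //=; rewrite ?mul0r ?mul1r ?mulr0 ?mulr0n ?mulr1n ?mul1r//.
by rewrite (@fineK _ (k (X w) D))//; exact: (@fin_num_measure _ _ _ (kp (X w))).
Qed.

Let markov_bounded (Psi : T * T -> R) : bounded_measurable Psi -> L1 Psi = L2 Psi.
Proof.
pose GG : set (set (T * T)) := [set A `*` D | A in measurable & D in measurable].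
apply: (mean_functional_pi_system (G := GG) L1_mean L2_mean L_cvg).
- by rewrite measurable_prod_measurableType.
- move=> _ _ [A mA [D mD <-]] [A' mA' [D' mD' <-]]; rewrite -setXI.
  by exists (A `&` A'); [exact: measurableI|exists (D `&` D') => //; exact: measurableI].
- by exists setT => //; exists setT => //; rewrite setXTT.
- by move=> _ [A mA [D mD <-]]; exact: L_rectangle.
Qed.

(** The setwise Markov property is the case of rectangles; a pi-system argument extends it to
    bounded functions and monotone convergence to nonnegative ones. Functions of both states are
    needed for the moments of increments. *)
Lemma markov_integral (Phi : T * T -> R) : measurable_fun setT Phi ->
  (forall z, 0 <= Phi z) ->
  (\int[P]_(w in B) (Phi (X w, X' w))%:E =
   \int[P]_(w in B) \int[k (X w)]_z (Phi (X w, z))%:E)%E.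
Proof.
move=> mPhi Phi0.
pose f n (z : T * T) : R := Num.min (Phi z) n%:R.
have f_ge0 n z : 0 <= f n z by rewrite le_min Phi0/=.
have bf n : bounded_measurable (f n).
  split; first exact: measurable_minr.
  by exists n%:R => z; rewrite ger0_norm// ge_min lexx orbT.
have nd_f z : {homo (fun n => (f n z)%:E) : n m / (n <= m)%N >-> (n <= m)%E}.
  by move=> n m nm; rewrite lee_fin le_min !ge_min lexx /= ler_nat nm orbT.
have f_cvg z : (f n z)%:E @[n --> \oo] --> (Phi z)%:E.
  apply: cvg_EFin; first exact: nearW.
  by apply: cvg_near_cst; apply: filterS (nbhs_infty_ger (Phi z)) => n zn; rewrite /= /f min_l.
have lhs : (\int[P]_(w in B) (f n (X w, X' w))%:E)%E @[n --> \oo] -->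
    (\int[P]_(w in B) (Phi (X w, X' w))%:E)%E.
  have -> : (\int[P]_(w in B) (Phi (X w, X' w))%:E)%E =
      (\int[P]_(w in B) (limn (fun n => (f n (X w, X' w))%:E)))%E.
    by apply: eq_integral => w _; apply/esym/cvg_lim.
  apply: cvg_monotone_convergence => //.
  - move=> n; apply/measurable_EFinP; apply: measurable_funTS.
    apply: measurableT_comp; first by have [] := bf n.
    exact: measurable_fun_pair.
  - by move=> n w _; rewrite lee_fin.
have inn x : (\int[k x]_z (f n (x, z))%:E)%E @[n --> \oo] -->
    (\int[k x]_z (Phi (x, z))%:E)%E.
  have -> : (\int[k x]_z (Phi (x, z))%:E)%E =
      (\int[k x]_z (limn (fun n => (f n (x, z))%:E)))%E.
    by apply: eq_integral => w _; apply/esym/cvg_lim.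
  apply: cvg_monotone_convergence => //.
  - by move=> n; apply/measurable_EFinP; have [] := slice_bounded x (bf n).
  - by move=> n w _; rewrite lee_fin.
have nd_inn x : {homo (fun n => (\int[k x]_z (f n (x, z))%:E)%E) :
    n m / (n <= m)%N >-> (n <= m)%E}.
  move=> n m nm; apply: ge0_le_integral => //.
  - by move=> z _; rewrite lee_fin.
  - by apply/measurable_EFinP; have [] := slice_bounded x (bf n).
  - by apply/measurable_EFinP; have [] := slice_bounded x (bf m).
  - by move=> z _; exact: (nd_f (x, z) n m nm).
have rhs : (\int[P]_(w in B) \int[k (X w)]_z (f n (X w, z))%:E)%E @[n --> \oo] -->
    (\int[P]_(w in B) \int[k (X w)]_z (Phi (X w, z))%:E)%E.
  have -> : (\int[P]_(w in B) \int[k (X w)]_z (Phi (X w, z))%:E)%E =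
      (\int[P]_(w in B) (limn (fun n => \int[k (X w)]_z (f n (X w, z))%:E)))%E.
    by apply: eq_integral => w _; apply/esym/cvg_lim => //; exact: inn.
  apply: cvg_monotone_convergence => //.
  - move=> n; apply: measurable_funTS.
    apply: (measurableT_comp (f := fun x => \int[k x]_z (f n (x, z))%:E)%E) => //.
    apply: (@measurable_fun_integral_finite_kernel _ _ _ _ _ (fun z => (f n z)%:E) k).
      by move=> z; rewrite lee_fin.
    by apply/measurable_EFinP; have [] := bf n.
  - by move=> n w _; apply: integral_ge0 => z _; rewrite lee_fin.
have eqn n : (\int[P]_(w in B) (f n (X w, X' w))%:E =
    \int[P]_(w in B) \int[k (X w)]_z (f n (X w, z))%:E)%E.
  have := markov_bounded (bf n); rewrite /L1 /L2 => /addIr h.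
  rewrite integral_mkcond [RHS]integral_mkcond.
  transitivity ((\int[P]_w (\1_B w * f n (X w, X' w)))%:E).
    rewrite -EFin_Rintegral; last exact: pair_bounded.
    apply: eq_integral => w _; rewrite /patch indicE.
    by case: (w \in B); rewrite ?mul1r ?mul0r.
  rewrite h -EFin_Rintegral; last by apply: comp_bounded; exact: inner_bounded.
  apply: eq_integral => w _; rewrite /patch indicE.
  case: (w \in B); rewrite ?mul1r ?mul0r// /inner.
  by rewrite -EFin_Rintegral//; exact: slice_bounded.
apply: (cvg_unique _ lhs) => //.
by rewrite (funext eqn).
Qed.

End markov_integral.

(** * Exit and survival probabilities *)

Section halfstrip.
Context {R : realType} {d : measure_display} {S : measurableMetricType R d}.
Variables (Ks : R.-pker (halfline R * S)%type ~> (halfline R * S)%type).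
Context {dO : measure_display} {Omega : measurableType dO}.
Variables (P : probability Omega R) (F : nat -> set (set Omega))
  (xi : nat -> Omega -> halfline R * S) (x0 : halfline R) (u0 : S).
Hypothesis process : halfstrip_process P Ks x0 u0 F xi.
Local Notation state := (halfline R * S)%type.
Local Notation X := (radial xi).

Let F_filtration : filtration F := halfstrip_filtration process.

Let F_sigma n : sigma_algebra [set: Omega] (F n).
Proof. by have [+ _ _] := F_filtration; apply. Qed.

Let F_measurable n : F n `<=` measurable.
Proof. by have [_ + _] := F_filtration; apply. Qed.

Let F_le m n : (m <= n)%N -> F m `<=` F n.
Proof. by have [_ _ +] := F_filtration; apply. Qed.

Let F_setC n A : F n A -> F n (~` A).
Proof. by have [_ FC _] := F_sigma n; rewrite -setTD => /FC. Qed.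

Let F_setI n A B : F n A -> F n B -> F n (A `&` B).
Proof.
have [_ _ FU] := F_sigma n; move=> FA FB.
rewrite -[A `&` B]setCK setCI; apply: F_setC.
rewrite -bigcup2E; apply: FU => -[|[|i]] /=; [exact: F_setC..|].
by have [] := F_sigma n.
Qed.

Let F_preimage n (A : set state) : measurable A -> F n (xi n @^-1` A).
Proof. exact: (halfstrip_adapted process). Qed.

Lemma measurable_radius : measurable_fun [set: state] (fun z => hval z.1).
Proof. exact: measurableT_comp (@measurable_hval R) measurable_fst. Qed.

Let measurable_xi n : measurable_fun setT (xi n).
Proof. by move=> _ A mA; rewrite setTI; apply: (@F_measurable n); exact: F_preimage. Qed.

Let F_lt n (r : R) : F n [set w | X n w < r].
Proof.
rewrite (_ : [set w | _] = ~` [set w | r <= X n w]); last first.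
  by apply/seteqP; split => w /=; [rewrite ltNge => /negP|move=> /negP; rewrite -ltNge].
apply/F_setC/(F_preimage n (A := [set z : state | r <= hval z.1])).
rewrite -[X in measurable X]setTI; apply: measurable_fun_le => //.
exact: measurable_radius.
Qed.

Let F_gt n (r : R) : F n [set w | r < X n w].
Proof.
rewrite (_ : [set w | _] = ~` [set w | X n w <= r]); last first.
  by apply/seteqP; split => w /=; [rewrite ltNge => /negP|move=> /negP; rewrite -ltNge].
apply/F_setC/(F_preimage n (A := [set z : state | hval z.1 <= r])).
rewrite -[X in measurable X]setTI; apply: measurable_fun_le => //.
exact: measurable_radius.
Qed.

Lemma step_integral n (B : set Omega) (f : state -> R) : F n B ->
  measurable_fun setT f -> (forall z, 0 <= f z) ->
  (\int[P]_(w in B) (f (xi n.+1 w))%:E =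
   \int[P]_(w in B) \int[Ks (xi n w)]_z (f z)%:E)%E.
Proof.
move=> FB mf f0.
apply: (markov_integral (F_sigma n) (@F_measurable n) (fun A => @F_preimage n A) FB
  (measurable_xi n.+1) _ (Phi := fun z => f z.2)) => //; last first.
  by apply: measurableT_comp => //; exact: measurable_snd.
move=> A mA D FD; have [_ _ cE] := halfstrip_markov process n mA.
exact: cE.
Qed.

Let measurable_kernel_integral (f : state -> R) : measurable_fun setT f ->
  (forall z, 0 <= f z) ->
  measurable_fun setT (fun x => \int[Ks x]_z (f z)%:E)%E.
Proof.
move=> mf f0; apply: measurable_fun_integral_kernel => //.
- exact: measurable_kernel.
- exact/measurable_EFinP.
Qed.

Section moments.
Variables (p q xB Bp Bq : R).
Hypothesis moments : moment_bounds P F X p q xB Bp Bq.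

Let B' := `|Bp| + 1.

Let kappa (x : state) : \bar R :=
  (\int[Ks x]_z (`|hval z.1 - hval x.1| `^ p)%:E)%E.

Let Phi (z : state * state) : R := `|hval z.2.1 - hval z.1.1| `^ p.

Let measurable_Phi : measurable_fun setT Phi.
Proof.
apply: (measurableT_comp (measurable_powR p)); apply: measurableT_comp => //.
apply: measurable_funB.
  exact: measurableT_comp measurable_radius measurable_snd.
exact: measurableT_comp measurable_radius measurable_fst.
Qed.

Let measurable_kappa : measurable_fun setT kappa.
Proof.
apply: (@measurable_fun_integral_finite_kernel _ _ _ _ _ (fun z => (Phi z)%:E) Ks).
  by move=> z; rewrite lee_fin powR_ge0.
exact/measurable_EFinP.
Qed.

(** On the event that the state lies beyond xB with kernel moment at least |Bp| + 1, the integral of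
    that moment is at least (|Bp| + 1) times the probability, and at most |Bp| times it by the
    conditional bound. The gap 1 forces probability 0. *)
Lemma moment_ok_ae : {ae P, forall w n, xB <= X n w ->
  moment_ok Ks p B' (xi n w).1 (xi n w).2}.
Proof.
apply: ae_foralln => n.
pose A : set state := [set z | xB <= hval z.1] `&` [set z | (B'%:E <= kappa z)%E].
have mA : measurable A.
  apply: measurableI.
    rewrite -[X in measurable X]setTI; apply: measurable_fun_le => //.
    exact: measurable_radius.
  rewrite -[X in measurable X]setTI.
  exact: emeasurable_fun_c_infty.
have FN : F n (xi n @^-1` A) by exact: F_preimage.
have mN : measurable (xi n @^-1` A) by exact: F_measurable FN.
exists (xi n @^-1` A); split => //; last first.
  move=> w /= /not_implyP[xX nok]; split => //=.
  by rewrite leNgt; apply/negP => k; apply: nok; rewrite /moment_ok -surjective_pairing ltW.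
have [[Z [[FZ Z0 ZE] Zle]] _] := moments n.
have up : (\int[P]_(w in xi n @^-1` A) kappa (xi n w) <= `|Bp|%:E * P (xi n @^-1` A))%E.
  have := markov_integral (F_sigma n) (@F_measurable n) (fun A => @F_preimage n A) FN
    (measurable_xi n.+1) _ measurable_Phi (fun z => powR_ge0 _ _).
  move=> <-; last first.
    move=> D mD E FE; have [_ _ cE] := halfstrip_markov process n mD.
    exact: cE.
  rewrite -[leLHS](ZE _ FN) -integral_cst//.
  apply: ae_ge0_le_integral.
  - exact: mN.
  - by move=> w _; exact: Z0.
  - apply: measurable_funTS => _ C mC; apply: (@F_measurable n).
    by apply: FZ; exists C.
  - by move=> w _; rewrite lee_fin.
  - exact: measurable_cst.
  - apply: filterS Zle => w h [xX _]; apply: (le_trans (h xX)).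
    by rewrite lee_fin ler_norm.
have lo : (B'%:E * P (xi n @^-1` A) <= \int[P]_(w in xi n @^-1` A) kappa (xi n w))%E.
  rewrite -integral_cst//; apply: ge0_le_integral => //.
  - by move=> w _; rewrite lee_fin addr_ge0.
  - by apply: measurable_funTS; exact: measurableT_comp measurable_kappa (measurable_xi n).
  - by move=> w [].
have := le_trans lo up.
rewrite -[P _]fineK ?fin_num_measure// -!EFinM lee_fin => h.
have : fine (P (xi n @^-1` A)) <= 0 by rewrite /B' in h; lra.
rewrite -lee_fin fineK ?fin_num_measure// => h'.
by apply/eqP; rewrite eq_le h' measure_ge0.
Qed.

End moments.

Definition above (r : R) (n : nat) : set Omega :=
  [set w | forall k, (k <= n)%N -> r < X k w].

Definition between (r y : R) (n : nat) : set Omega :=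
  [set w | forall k, (k <= n)%N -> r < X k w < y].

Lemma aboveS r n : above r n.+1 = above r n `&` [set w | r < X n.+1 w].
Proof.
apply/seteqP; split => w.
  by move=> H; split => [k kn|]; apply: H => //; exact: ltnW.
by move=> [H Hn] k; rewrite leq_eqVlt => /predU1P[->//|]; exact: H.
Qed.

Lemma betweenS r y n :
  between r y n.+1 = between r y n `&` [set w | r < X n.+1 w < y].
Proof.
apply/seteqP; split => w.
  by move=> H; split => [k kn|]; apply: H => //; exact: ltnW.
by move=> [H Hn] k; rewrite leq_eqVlt => /predU1P[->//|]; exact: H.
Qed.

Let F_between1 n r y : F n [set w | r < X n w < y].
Proof.
rewrite (_ : [set w | _] = [set w | r < X n w] `&` [set w | X n w < y]).
  by apply: F_setI; [exact: F_gt|exact: F_lt].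
by apply/seteqP; split => w /=; [move/andP|move=> h; apply/andP].
Qed.

Lemma F_above r n : F n (above r n).
Proof.
elim: n => [|n IHn].
  rewrite (_ : above r 0 = [set w | r < X 0 w]); first exact: F_gt.
  by apply/seteqP; split => w; [exact|move=> h k; rewrite leqn0 => /eqP ->].
by rewrite aboveS; apply: F_setI; [exact: F_le IHn|exact: F_gt].
Qed.

Lemma F_between r y n : F n (between r y n).
Proof.
elim: n => [|n IHn].
  rewrite (_ : between r y 0 = [set w | r < X 0 w < y]); first exact: F_between1.
  by apply/seteqP; split => w; [exact|move=> h k; rewrite leqn0 => /eqP ->].
by rewrite betweenS; apply: F_setI; [exact: F_le IHn|exact: F_between1].
Qed.

Lemma measurable_above r n : measurable (above r n).
Proof. exact: F_measurable (F_above r n). Qed.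

Lemma measurable_between r y n : measurable (between r y n).
Proof. exact: F_measurable (F_between r y n). Qed.

Let X0E w : X 0 w = hval x0.
Proof. by rewrite /radial (halfstrip_initial process). Qed.

(* Optional stopping for f at the exit from (r, y): staying in (r, y) costs a
   factor exp(-c/y^2) per step, leaving through y costs M. *)
Lemma exit_bound (r y c M : R) (f : state -> R) :
  0 < c -> 0 < y -> measurable_fun setT f -> (forall z, 1 <= f z) ->
  0 <= M -> (forall z, y <= hval z.1 -> M <= f z) ->
  {ae P, forall w n, r < X n w -> (\int[Ks (xi n w)]_z (f z)%:E <=
     (expR (- (c / X n w ^+ 2)) * f (xi n w))%:E)%E} -> 0 <= r ->
  forall n, (P (above r n) <= (expR (- (c / y ^+ 2) * n%:R) * f (x0, u0))%:E +
    P (above r n `\` between r y n) /\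
  M%:E * P (above r n `\` between r y n) <= (f (x0, u0))%:E)%E.
Proof.
move=> c0 y0 mf f1 M0 fM drift r0 n.
have f0 z : 0 <= f z by exact: le_trans (f1 z).
have mfx m : measurable_fun setT (fun w => (f (xi m w))%:E).
  by apply/measurable_EFinP; exact: (measurableT_comp mf (measurable_xi m)).
pose E m := between r y m; pose D m := above r m.
have mE m : measurable (E m) by exact: measurable_between.
have mD m : measurable (D m) by exact: measurable_above.
have mDE m : measurable (D m `\` E m) by exact: measurableD.
pose a := expR (- (c / y ^+ 2)).
have a0 : 0 <= a by exact: expR_ge0.
have a1 : a <= 1 by rewrite -expR0 ler_expR oppr_le0 divr_ge0 ?sqr_ge0 ?ltW.
pose b m : \bar R := (\int[P]_(w in E m) (f (xi m w))%:E)%E.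
(* The mean after one step splits into paths still between the levels, paths at or beyond y, where f
   >= M, and paths fallen to r or below, which are dropped since f >= 0. *)
have step m : (b m.+1 + M%:E * P (E m `&` [set w | (y <= X m.+1 w)%R]) <= a%:E * b m)%E.
  have FE : F m (E m) by exact: F_between.
  have mup : measurable (E m `&` [set w | (y <= X m.+1 w)%R]).
    apply: measurableI => //.
    rewrite (_ : [set w | _] = ~` [set w | X m.+1 w < y]).
      exact: F_measurable (F_setC (F_lt _ _)).
    by apply/seteqP; split => w /=; rewrite leNgt => /negP.
  apply: (@le_trans _ _ (\int[P]_(w in E m) (f (xi m.+1 w))%:E)%E).
    rewrite -integral_cst//.
    apply: (@le_trans _ _ (\int[P]_(w in E m.+1) (f (xi m.+1 w))%:E +
      \int[P]_(w in E m `&` [set w | (y <= X m.+1 w)%R]) (f (xi m.+1 w))%:E)%E).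
      apply: leeD => //; apply: ge0_le_integral => //.
      - by apply: measurable_funTS; exact: mfx.
      - by move=> w [_ /= yX]; rewrite lee_fin fM.
    rewrite -ge0_integral_setU//.
    - apply: ge0_subset_integral => //.
      + exact: measurableU.
      + by apply: measurable_funTS; exact: mfx.
      + by move=> w _; rewrite lee_fin.
      + by rewrite /E betweenS => w [[]|[]].
    - by apply: measurable_funTS; exact: mfx.
    - by move=> w _; rewrite lee_fin.
    - apply/disj_setPS => w []; rewrite /E betweenS => -[_ /= /andP[_ Xy]] [_ /=].
      by rewrite leNgt Xy.
  rewrite step_integral//.
  have -> : (a%:E * b m = \int[P]_(w in E m) (a%:E * (f (xi m w))%:E))%E.
    rewrite ge0_integralZl//.
      by apply: measurable_funTS; exact: mfx.
    by move=> w _; rewrite lee_fin.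
  apply: ae_ge0_le_integral.
  - exact: mE.
  - by move=> w _; apply: integral_ge0 => z _; rewrite lee_fin.
  - apply: measurable_funTS.
    exact: measurableT_comp (measurable_kernel_integral mf f0) (measurable_xi m).
  - by move=> w _; rewrite -EFinM lee_fin mulr_ge0.
  - by apply: measurable_funTS; apply: measurable_funeM; exact: mfx.
  apply: filterS drift => w h Ew.
  have /andP[rX Xy] := Ew m (leqnn m).
  apply: (le_trans (h m rX)); rewrite -EFinM lee_fin ler_wpM2r//.
  have X0 : 0 < X m w by exact: le_lt_trans rX.
  rewrite ler_expR lerN2 ler_pM2l// lef_pV2 ?posrE ?exprn_gt0//.
  by rewrite ler_sqr ?nnegrE ltW.
have b0 m : (0 <= b m)%E by apply: integral_ge0 => w _; rewrite lee_fin.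
(* A path above r that is not between the levels has reached y, either earlier or exactly at the
   last step. *)
have exitS m : (P (D m.+1 `\` E m.+1) <= P (D m `\` E m) +
    P (E m `&` [set w | (y <= X m.+1 w)%R]))%E.
  have mup : measurable (E m `&` [set w | (y <= X m.+1 w)%R]).
    apply: measurableI => //.
    rewrite (_ : [set w | _] = ~` [set w | X m.+1 w < y]).
      exact: F_measurable (F_setC (F_lt _ _)).
    by apply/seteqP; split => w /=; rewrite leNgt => /negP.
  apply: (le_trans _ (measureU2 _ _ _)) => //.
  apply: le_measure; rewrite ?inE//; first exact: measurableU.
  rewrite /D /E aboveS betweenS => w [[Dw rX] nE].
  have [Ew|nEw] := pselect (between r y m w); last by left.
  right; split => //=; rewrite leNgt; apply/negP => Xy; apply: nE; split => //=.
  by rewrite rX.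
have bE m : (b m <= (expR (- (c / y ^+ 2) * m%:R) * f (x0, u0))%:E)%E.
  elim: m => [|m IHm].
    rewrite mulr0 expR0 mul1r /b.
    rewrite (eq_integral (fun=> (f (x0, u0))%:E)); last first.
      by move=> w _; rewrite (halfstrip_initial process).
    rewrite integral_cst//= -[leRHS]mule1 lee_wpmul2l ?lee_fin//.
    exact: probability_le1.
  apply: (@le_trans _ _ (a%:E * b m)%E).
    by apply: le_trans (step m); rewrite leeDl// mule_ge0 ?lee_fin.
  apply: (@le_trans _ _ (a%:E * (expR (- (c / y ^+ 2) * m%:R) * f (x0, u0))%:E)%E).
    by rewrite lee_wpmul2l ?lee_fin.
  by rewrite -EFinM lee_fin mulrA -expRD -natr1 mulrDr mulr1 addrC.
have total m : (b m + M%:E * P (D m `\` E m) <= (f (x0, u0))%:E)%E.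
  elim: m => [|m IHm].
    rewrite /b (eq_integral (fun=> (f (x0, u0))%:E)); last first.
      by move=> w _; rewrite (halfstrip_initial process).
    rewrite integral_cst//=.
    (* At time 0 the exit event is nonempty only if the start is already at or beyond y, and then f
       >= M there. *)
    have MP : (M%:E * P (D 0%N `\` E 0%N) <= (f (x0, u0))%:E * P (D 0%N `\` E 0%N))%E.
      have [->|/set0P[w [Dw nEw]]] := eqVneq (D 0%N `\` E 0%N) set0.
        by rewrite measure0 !mule0.
      rewrite lee_wpmul2r// lee_fin; apply: fM => /=.
      rewrite leNgt -(X0E w); apply/negP => Xy; apply: nEw => k.
      by rewrite leqn0 => /eqP ->; rewrite Xy andbT; exact: Dw.
    apply: (le_trans (leeD (lexx _) MP)).
    rewrite -ge0_muleDr// -measureU//; last by rewrite setIDA setIC -setIDA setDv setI0.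
    rewrite -[leRHS]mule1 lee_wpmul2l ?lee_fin//.
    by apply: probability_le1; exact: measurableU.
  apply: le_trans IHm.
  apply: (@le_trans _ _ (b m.+1 + (M%:E * P (D m `\` E m) +
      M%:E * P (E m `&` [set w | (y <= X m.+1 w)%R])))%E).
    by rewrite leeD2l// -ge0_muleDr// lee_wpmul2l ?lee_fin.
  rewrite addeCA addeC leeD2r//; apply: (le_trans (step m)).
  by rewrite -[leRHS]mul1e lee_wpmul2r ?lee_fin.
split; last by apply: le_trans (total n); rewrite leeDr.
have ED : E n `<=` D n by move=> w H k /H/andP[].
have -> : P (above r n) = (P (E n) + P (D n `\` E n))%E.
  by rewrite -measureU ?setDIK// setDUK.
rewrite leeD2r//; apply: le_trans (bE n).
rewrite -[leLHS]mul1e -integral_cst//; apply: ge0_le_integral => //.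
- by apply: measurable_funTS; exact: mfx.
- by move=> w _; rewrite lee_fin.
Qed.

(* Each step multiplies E[f(xi n); above r n] + m P(not above r n) by at least kap. *)
Lemma survival_bound (r kap m : R) (f : state -> R) :
  measurable_fun setT f -> (forall z, 0 <= f z <= 1) -> 0 <= kap -> kap <= 1 ->
  0 <= m -> (forall z, hval z.1 <= r -> f z <= m) -> r < hval x0 ->
  {ae P, forall w n, r < X n w ->
    kap * f (xi n w) <= \int[Ks (xi n w)]_z f z} ->
  forall n, ((kap ^+ n * f (x0, u0))%:E <= P (above r n) + m%:E)%E.
Proof.
move=> mf f01 kap0 kap1 m0 fm rx0 drift n.
have f0 z : 0 <= f z by have /andP[] := f01 z.
have f1 z : f z <= 1 by have /andP[] := f01 z.
have bf : bounded_measurable f by split => //; exists 1 => z; rewrite ger0_norm.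
have mfx k : measurable_fun setT (fun w => (f (xi k w))%:E).
  by apply/measurable_EFinP; exact: (measurableT_comp mf (measurable_xi k)).
pose D k := above r k.
have mD k : measurable (D k) by exact: measurable_above.
pose b k : \bar R := (\int[P]_(w in D k) (f (xi k w))%:E + m%:E * P (~` D k))%E.
have step k : (kap%:E * b k <= b k.+1)%E.
  have DS : D k.+1 `<=` D k by rewrite /D aboveS => w [].
  have mDD : measurable (D k `\` D k.+1) by exact: measurableD.
  have key : (kap%:E * (\int[P]_(w in D k) (f (xi k w))%:E) <=
      \int[P]_(w in D k.+1) (f (xi k.+1 w))%:E + m%:E * P (D k `\` D k.+1))%E.
    apply: (@le_trans _ _ (\int[P]_(w in D k) (f (xi k.+1 w))%:E)%E).
      rewrite step_integral//; last exact: F_above.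
      rewrite -ge0_integralZl//.
      - apply: ae_ge0_le_integral.
        + exact: mD.
        + by move=> w _; rewrite -EFinM lee_fin mulr_ge0.
        + by apply: measurable_funTS; apply: measurable_funeM; exact: mfx.
        + by move=> w _; apply: integral_ge0 => z _; rewrite lee_fin.
        + apply: measurable_funTS.
          exact: measurableT_comp (measurable_kernel_integral mf f0) (measurable_xi k).
        + apply: filterS drift => w h Dw; rewrite -EFinM.
          have := h k (Dw k (leqnn k)); rewrite -lee_fin => /le_trans; apply.
          rewrite -[(\int[Ks (xi k w)]_z f z)%R]/(\int[kernel_probability Ks (xi k w)]_z f z)%R.
          by rewrite -EFin_Rintegral.
      - by apply: measurable_funTS; exact: mfx.
      - by move=> w _; rewrite lee_fin.
    have -> : (\int[P]_(w in D k) (f (xi k.+1 w))%:E = \int[P]_(w in D k.+1) (f (xi k.+1 w))%:E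
        + \int[P]_(w in D k `\` D k.+1) (f (xi k.+1 w))%:E)%E.
      rewrite -ge0_integral_setU ?setDUK//.
      - by apply: measurable_funTS; exact: mfx.
      - by move=> w _; rewrite lee_fin.
      - by apply/disj_setPS; rewrite setDIK.
    rewrite leeD2l// -integral_cst//; apply: ge0_le_integral => //.
    - by move=> w _; rewrite lee_fin.
    - by apply: measurable_funTS; exact: mfx.
    - move=> w []; rewrite /D aboveS => Dw nD; rewrite lee_fin fm// leNgt.
      by apply/negP => rX; apply: nD.
  have -> : b k.+1 = (\int[P]_(w in D k.+1) (f (xi k.+1 w))%:E +
      m%:E * P (D k `\` D k.+1) + m%:E * P (~` D k))%E.
    rewrite /b -addeA -ge0_muleDr// -measureU//; last 2 first.
    - exact: measurableC.
    - by rewrite setDE setIAC setICr set0I.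
    congr (_ + _ * P _)%E; apply/seteqP; split => w.
      by move=> nD; have [Dw|] := pselect (D k w); [left|right].
    by move=> [[]//|nD /DS].
  rewrite /b ge0_muleDr ?mule_ge0 ?lee_fin//; last first.
    by apply: integral_ge0 => w _; rewrite lee_fin.
  apply: leeD => //.
  by rewrite -[leRHS]mul1e lee_wpmul2r ?mule_ge0 ?lee_fin.
have bE k : ((kap ^+ k * f (x0, u0))%:E <= b k)%E.
  elim: k => [|k IHk].
    rewrite expr0 mul1r /b.
    have -> : D 0%N = setT.
      by apply/seteqP; split => // w _ j; rewrite leqn0 => /eqP ->; rewrite X0E.
    rewrite setCT measure0 mule0 adde0.
    rewrite (eq_integral (fun=> (f (x0, u0))%:E)); last first.
      by move=> w _; rewrite (halfstrip_initial process).
    by rewrite integral_cst//= probability_setT mule1.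
  rewrite exprS -mulrA EFinM; apply: le_trans (step k).
  by rewrite lee_wpmul2l ?lee_fin.
apply: (le_trans (bE n)); rewrite /b; apply: leeD.
  rewrite -[leRHS]mul1e -integral_cst//; apply: ge0_le_integral => //.
  - by move=> w _; rewrite lee_fin.
  - by apply: measurable_funTS; exact: mfx.
  - by move=> w _; rewrite lee_fin.
rewrite -[leRHS]mule1 lee_wpmul2l ?lee_fin//.
by apply: probability_le1; exact: measurableC.
Qed.

End halfstrip.

(** * Moments of the hitting time *)

Section tail_sum.
Context {R : realType}.

(** The term of order m + 1 of the exponential series suffices once (m + 1) b >= M. *)
Lemma expR_Npow (c b M : R) : 0 < c -> 0 < b -> exists2 K, 0 <= K &
  forall N, 1 <= N -> expR (- (c * N `^ b)) <= K * N `^ (- M).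
Proof.
move=> c0 b0.
have [m _ /(_ m (leqnn m)) /= mM] := nbhs_infty_ger (M / b).
exists ((m.+1)`!%:R / c ^+ m.+1).
  by rewrite divr_ge0// exprn_ge0// ltW.
move=> N N1; have N0 : 0 < N by exact: lt_le_trans N1.
have Nb0 : 0 < N `^ b by exact: powR_gt0.
have x0 : 0 < c * N `^ b by exact: mulr_gt0.
have f0 : 0 < (m.+1)`!%:R :> R by rewrite ltr0n fact_gt0.
have := expR_ge1Dxn m (ltW x0) => hx.
have {hx} : (c * N `^ b) ^+ m.+1 / (m.+1)`!%:R <= expR (c * N `^ b).
  by apply: le_trans hx; rewrite lerDr.
have y0 : 0 < (c * N `^ b) ^+ m.+1 / (m.+1)`!%:R by rewrite divr_gt0// exprn_gt0.
rewrite -lef_pV2 ?posrE ?expR_gt0// -expRN invf_div => /le_trans; apply.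
rewrite exprMn invfM mulrA ler_wpM2l//.
  by rewrite divr_ge0// exprn_ge0// ltW.
rewrite -powR_mulrn ?powR_ge0// -powRrM -powRN ler_powR// lerN2.
rewrite -ler_pdivrMl// mulrC (le_trans mM)// ler_nat//.
Qed.

(* At n = 2^j take y^2 = n^kap with s/theta < kap < 1. *)
Lemma tail_geometric (pr : nat -> R) (f0 c theta s : R) : 0 <= f0 -> 0 < c ->
  0 <= s -> s < theta ->
  (forall n (y : R), 0 < y ->
    pr n <= f0 * (expR (- (c / y ^+ 2) * n%:R) + ((y ^+ 2) `^ theta)^-1)) ->
  exists K rho : R, [/\ 0 <= K, 0 <= rho, rho < 1 & forall j,
    (2 ^ j.+1)%:R `^ s * pr (2 ^ j)%N <= K * rho ^+ j].
Proof.
move=> f00 c0 s0 sth prb.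
have th0 : 0 < theta by exact: le_lt_trans sth.
(* The midpoint of s/theta and 1: kap < 1 makes exp(-c n^(1 - kap)) decay, and kap * theta > s makes
   y^(-2 theta) beat n^s. *)
pose kap := (s / theta + 1) / 2.
have st1 : s / theta < 1 by rewrite ltr_pdivrMr// mul1r.
have st0 : 0 <= s / theta by rewrite divr_ge0// ltW.
have kap1 : kap < 1 by rewrite /kap; lra.
have kap0 : 0 < kap by rewrite /kap; lra.
have ks : s / theta < kap by rewrite /kap; lra.
have gam0 : 0 < kap * theta - s by rewrite subr_gt0 -ltr_pdivrMr.
have b0 : 0 < 1 - kap by rewrite subr_gt0.
(* The exponent s + 1 leaves N^-1 after multiplication by N^s. *)
have [K K0 HK] := expR_Npow (s + 1) c0 b0.
pose gam := kap * theta - s.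
(* Along N = 2^j the two terms decay like 2^(-j) and 2^(-gam j). *)
pose rho := Num.max 2^-1 (2 `^ (- gam)) : R.
have rho_ge : 2^-1 <= rho by rewrite le_max lexx.
have rho_ge' : 2 `^ (- gam) <= rho by rewrite le_max lexx orbT.
have rho0 : 0 <= rho by apply: le_trans rho_ge; rewrite invr_ge0.
exists (2 `^ s * f0 * (K + 1)), rho; split => //.
- by rewrite !mulr_ge0 ?powR_ge0// addr_ge0.
- rewrite /rho gt_max invf_lt1// ltr1n /= powRN invf_lt1 ?powR_gt0//.
  have one : 1 = 1 `^ gam :> R by rewrite powR1.
  by rewrite [ltLHS]one gt0_ltr_powR ?nnegrE// ltr1n.
move=> j; pose N : R := (2 ^ j)%:R.
have N1 : 1 <= N by rewrite ler1n expn_gt0.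
have N0 : 0 < N by exact: lt_le_trans N1.
pose y := N `^ (kap / 2).
have y0 : 0 < y by exact: powR_gt0.
have y2 : y ^+ 2 = N `^ kap.
  by rewrite -powR_mulrn ?powR_ge0// -powRrM divfK.
have := prb (2 ^ j)%N y y0; rewrite -/N y2 -powRrM.
have -> : - (c / N `^ kap) * N = - (c * N `^ (1 - kap)).
  rewrite powRB ?powRr1 ?(ltW N0)//; first by ring.
  by rewrite gt_eqF ?implybT.
rewrite -powRN => pN.
have e1 := HK N N1.
have NsN : (2 ^ j.+1)%:R `^ s = 2 `^ s * N `^ s.
  by rewrite expnS natrM powRM.
have Ns0 : 0 < N `^ s by exact: powR_gt0.
have r1 : N `^ s * N `^ (- (s + 1)) <= rho ^+ j.
  rewrite -powRD ?(gt_eqF N0) ?implybT//.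
  rewrite (_ : s + - (s + 1) = -1); last by ring.
  rewrite powR_inv1 ?(ltW N0)// /N natrX -exprVn.
  by rewrite lerXn2r ?nnegrE ?invr_ge0.
have r2 : N `^ s * N `^ (- (kap * theta)) <= rho ^+ j.
  rewrite -powRD ?(gt_eqF N0) ?implybT//.
  rewrite (_ : s + - (kap * theta) = - gam); last by rewrite /gam; ring.
  rewrite /N natrX -powR_mulrn// powRAC powR_mulrn ?powR_ge0//.
  by rewrite lerXn2r ?nnegrE ?powR_ge0.
rewrite NsN.
have := ler_wpM2l (ltW Ns0) pN => h1.
have h2 : N `^ s * expR (- (c * N `^ (1 - kap))) <= K * rho ^+ j.
  apply: (le_trans (ler_wpM2l (ltW Ns0) e1)).
  by rewrite mulrCA ler_wpM2l.
have s20 : 0 <= 2 `^ s :> R by exact: powR_ge0.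
rewrite -(mulrA (2 `^ s)) -(mulrA (2 `^ s)) -(mulrA (2 `^ s)) ler_wpM2l// (le_trans h1)//.
rewrite mulrCA -(mulrA f0) ler_wpM2l//.
by rewrite mulrDr mulrDl mul1r lerD.
Qed.

Lemma geometric_nneseries_lty (a : nat -> \bar R) (K rho : R) :
  0 <= K -> 0 <= rho -> rho < 1 -> (forall j, (0 <= a j)%E) ->
  (forall j, (a j <= (K * rho ^+ j)%:E)%E) -> (\sum_(0 <= j <oo) a j < +oo)%E.
Proof.
move=> K0 r0 r1 a0 aK.
have r10 : 0 < 1 - rho by rewrite subr_gt0.
apply: (@le_lt_trans _ _ (K / (1 - rho))%:E); last exact: ltry.
apply: lime_le; first by apply: is_cvg_nneseries => n _ _; exact: a0.
apply: nearW => n; apply: (@le_trans _ _ (\sum_(0 <= j < n) (K * rho ^+ j)%:E)%E).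
  by apply: lee_sum => j _; exact: aK.
rewrite sumEFin lee_fin big_mkord -mulr_sumr ler_wpM2l// -div1r ler_pdivlMr//.
have := subrX1 rho n; rewrite -[rho ^+ n - 1]opprB -[rho - 1]opprB mulNr.
move=> /oppr_inj; rewrite mulrC => <-.
by rewrite gerBl exprn_ge0.
Qed.

End tail_sum.

Section hitting_time.
Context {R : realType} {dO : measure_display} {Omega : measurableType dO}.
Variables (P : probability Omega R) (X : nat -> Omega -> R) (r s : R).

Let D n := [set w | forall k, (k <= n)%N -> r < X k w].

Lemma tau_ge n w : D n w -> (n%:R%:E <= tau X r w)%E.
Proof.
move=> Dw; apply: le_ereal_inf_tmp => _ [m /= Xm <-].
rewrite lee_fin ler_nat ltnW// ltnNge; apply/negP => mn.
by have := Dw m mn; rewrite ltNge Xm.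
Qed.

Lemma tau_ge0 w : (0 <= tau X r w)%E.
Proof. by apply: le_ereal_inf_tmp => _ [m _ <-]; rewrite lee_fin. Qed.

(** Read off the definition of the integral as a supremum over simple functions. It asks for no
    measurability, so the powers of [tau] can be compared without establishing theirs. *)
Lemma le_ge0_integral (f g : Omega -> \bar R) : (forall w, 0 <= f w)%E ->
  (forall w, f w <= g w)%E -> (\int[P]_w f w <= \int[P]_w g w)%E.
Proof.
move=> f0 fg; rewrite !ge0_integralTE//; last first.
  by move=> w; exact: le_trans (fg w).
apply: le_ereal_sup => _ [h hf <-]; exists h => //= w.
exact: le_trans (hf w) (fg w).
Qed.

Lemma tau_moment_ge n : 0 <= s -> measurable (D n) ->
  ((n%:R `^ s)%:E * P (D n) <= tau_moment P X r s)%E.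
Proof.
move=> s0 mD; rewrite -integral_cst// integral_mkcond.
apply: le_ge0_integral => w; rewrite /patch.
  by case: ifP => // _; rewrite lee_fin powR_ge0.
case: ifPn => [/set_mem Dw|_]; last exact: poweR_ge0.
rewrite -poweR_EFin; apply: gt0_ler_poweR => //.
- by rewrite in_itv /= lee_fin ler0n leey.
- by rewrite in_itv /= tau_ge0 leey.
- exact: tau_ge.
Qed.

(** Dyadic decomposition: when 2^j < tau <= 2^(j + 1), the j-th term alone is large enough, and the
    leading 1 covers tau <= 1. *)
Lemma tau_powR_le w : 0 <= s -> (tau X r w `^ s <=
  1 + \sum_(0 <= j <oo) ((2 ^ j.+1)%:R `^ s * \1_(D (2 ^ j)%N) w)%:E)%E.
Proof.
move=> s0; pose a j : \bar R := ((2 ^ j.+1)%:R `^ s * \1_(D (2 ^ j)%N) w)%:E.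
change (tau X r w `^ s <= 1 + \sum_(0 <= j <oo) a j)%E.
have a0 j : (0 <= a j)%E.
  by rewrite lee_fin mulr_ge0 ?powR_ge0// indicE.
have sum0 : (0 <= \sum_(0 <= j <oo) a j)%E by exact: nneseries_ge0.
have [[n0 Xn0]|none] := pselect (exists n, X n w <= r); last first.
  (* A path that never hits makes every term at least 1, so the series diverges. *)
  have Dw n : D n w by move=> k _; rewrite ltNge; apply/negP => Xk; apply: none; exists k.
  suff -> : (\sum_(0 <= j <oo) a j = +oo)%E by rewrite addey// leey.
  apply/eqyP => A A0.
  have [n _ /(_ n (leqnn n)) /= An] := nbhs_infty_ger A.
  apply: (@le_trans _ _ (\sum_(0 <= j < n) a j)%E); last first.
    by apply: nneseries_lim_ge => k _ _; exact: a0.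
  apply: (@le_trans _ _ (\sum_(0 <= j < n) 1%:E)%E).
    by rewrite sumEFin lee_fin big_mkord sumr_const card_ord.
  apply: lee_sum => j _; rewrite lee_fin indicE mem_set// mulr1.
  rewrite -[leLHS](powRr0 (2 ^ j.+1)%:R) ler_powR//.
  by rewrite ler1n expn_gt0.
pose n := ex_minn (ex_intro (fun n => X n w <= r) n0 Xn0).
have Xn : X n w <= r by rewrite /n; case: ex_minnP.
have nmin k : X k w <= r -> (n <= k)%N by rewrite /n; case: ex_minnP => m _; apply.
have tn : (tau X r w <= n%:R%:E)%E by apply: ereal_inf_lbound; exists n.
have tns : (tau X r w `^ s <= (n%:R `^ s)%:E)%E.
  rewrite -poweR_EFin; apply: gt0_ler_poweR => //.
  - by rewrite in_itv /= tau_ge0 leey.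
  - by rewrite in_itv /= lee_fin ler0n leey.
apply: (le_trans tns).
have [n1|n2] := leqP n 1.
  rewrite -[leLHS]adde0 leeD// lee_fin.
  have [->|sn] := eqVneq s 0; first by rewrite powRr0.
  have one : 1 = 1 `^ s :> R by rewrite powR1.
  rewrite [leRHS]one ge0_ler_powR ?nnegrE ?ler0n//.
  by move: n1; rewrite -(ler_nat R).
(* The rounded up logarithm is j + 1, which gives 2^j < n <= 2^(j + 1); the strict inequality places
   the path in the event of index 2^j. *)
have /andP[lo hi] := up_log_bounds (ltnSn 1) n2.
move: lo hi; set j := (up_log 2 n).-1.
have jE : up_log 2 n = j.+1 by rewrite /j prednK// up_log_gt0.
rewrite jE => lo hi.
rewrite -[leLHS]add0e leeD//; apply: (@le_trans _ _ (a j)).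
  rewrite lee_fin indicE mem_set ?mulr1.
    by rewrite ge0_ler_powR ?nnegrE ?ler0n// ler_nat.
  move=> k kj; rewrite ltNge; apply/negP => /nmin nk.
  by have := leq_trans nk kj; rewrite leqNgt lo.
apply: (@le_trans _ _ (\sum_(0 <= i < j.+1) a i)%E).
  by rewrite big_nat_recr//= leeDr// sume_ge0.
by apply: nneseries_lim_ge => k _ _; exact: a0.
Qed.

Lemma tau_moment_lty (K rho : R) : 0 <= s -> (forall n, measurable (D n)) ->
  0 <= K -> 0 <= rho -> rho < 1 ->
  (forall j, (2 ^ j.+1)%:R `^ s * fine (P (D (2 ^ j)%N)) <= K * rho ^+ j) ->
  (tau_moment P X r s < +oo)%E.
Proof.
move=> s0 mD K0 r0 r1 Pj.
pose a j w : \bar R := ((2 ^ j.+1)%:R `^ s * \1_(D (2 ^ j)%N) w)%:E.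
have a0 j w : (0 <= a j w)%E by rewrite lee_fin mulr_ge0 ?powR_ge0// indicE.
have ma j : measurable_fun setT (a j).
  apply/measurable_EFinP; apply: measurable_funM; first exact: measurable_cst.
  by apply: measurable_indic; exact: mD.
apply: (@le_lt_trans _ _ (\int[P]_w (1 + \sum_(0 <= j <oo) a j w))%E).
  apply: le_ge0_integral => w; first exact: poweR_ge0.
  exact: tau_powR_le.
rewrite ge0_integralD//; last 2 first.
- by move=> w _; apply: nneseries_ge0 => n _ _; exact: a0.
- by apply: ge0_emeasurable_sum => //.
rewrite integral_cst//= probability_setT mule1.
rewrite integral_nneseries//.
apply: lte_add_pinfty; first exact: ltry.
apply: (geometric_nneseries_lty K0 r0 r1).
- by move=> j; apply: integral_ge0.
move=> j; rewrite /a.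
under eq_integral do rewrite EFinM.
rewrite ge0_integralZl//; last first.
  by apply/measurable_EFinP; exact: measurable_indic.
rewrite integral_indic// setIT.
have Pf : P (D (2 ^ j)%N) \is a fin_num by exact: fin_num_measure.
change (((2 ^ j.+1)%:R `^ s)%:E * P (D (2 ^ j)%N) <= (K * rho ^+ j)%:E)%E.
by rewrite -(fineK Pf) -EFinM lee_fin.
Qed.

End hitting_time.

Lemma bernoulli_expr (R : realDomainType) (a : R) n :
  0 <= a <= 1 -> 1 - a *+ n <= (1 - a) ^+ n.
Proof.
move=> /andP[a0 a1]; elim: n => [|n IHn]; first by rewrite mulr0n subr0 expr0.
have a10 : 0 <= 1 - a by rewrite subr_ge0.
rewrite exprSr; apply: le_trans (ler_wpM2r a10 IHn).
have : 0 <= a *+ n by rewrite mulrn_wge0.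
by rewrite mulrS; nra.
Qed.

(** * From drift inequalities to moments of the hitting time *)

Section conclusion.
Context {R : realType} {d : measure_display} {S : measurableMetricType R d}.
Hypothesis S_borel : @measurable d S = <<s @open S >>.
Variables (Ks : R.-pker (halfline R * S)%type ~> (halfline R * S)%type).
Context {dO : measure_display} {Omega : measurableType dO}.
Variables (P : probability Omega R) (F : nat -> set (set Omega))
  (xi : nat -> Omega -> halfline R * S) (x0 : halfline R) (u0 : S).
Hypothesis process : halfstrip_process P Ks x0 u0 F xi.
Local Notation X := (radial xi).
Variables (h : S -> R) (H theta r : R).
Hypotheses (h_continuous : continuous h) (h_bounds : forall u, 1 <= h u <= H)
  (theta_gt0 : 0 < theta) (r_ge0 : 0 <= r).

Let h_ge1 u : 1 <= h u. Proof. by have /andP[] := h_bounds u. Qed.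
Let h_le u : h u <= H. Proof. by have /andP[] := h_bounds u. Qed.

Let lyapunov_ge1 z : 1 <= lyapunov h theta z.
Proof.
have one : 1 = 1 `^ theta :> R by rewrite powR1.
rewrite [leLHS]one /lyapunov ge0_ler_powR ?nnegrE ?(ltW theta_gt0)//.
  by rewrite addr_ge0 ?sqr_ge0// (le_trans ler01).
by rewrite (le_trans (h_ge1 z.2))// lerDr sqr_ge0.
Qed.

Let lyapunov_le (y : R) z : hval z.1 <= y -> lyapunov h theta z <= (y ^+ 2 + H) `^ theta.
Proof.
move=> zy; have y0 : 0 <= y by exact: le_trans (hval_ge0 _) zy.
have H0 : 0 <= H by rewrite (le_trans _ (h_le z.2))// (le_trans ler01).
rewrite /lyapunov ge0_ler_powR ?nnegrE ?(ltW theta_gt0)//.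
- by rewrite addr_ge0 ?sqr_ge0// (le_trans ler01).
- by rewrite addr_ge0 ?sqr_ge0.
- by rewrite lerD// ler_sqr ?nnegrE// hval_ge0.
Qed.

Let lyapunov_ge (y : R) z : 0 <= y -> y <= hval z.1 ->
  (y ^+ 2) `^ theta <= lyapunov h theta z.
Proof.
move=> y0 yz.
rewrite /lyapunov ge0_ler_powR ?nnegrE ?(ltW theta_gt0)//.
- exact: sqr_ge0.
- by rewrite addr_ge0 ?sqr_ge0// (le_trans ler01).
- by rewrite -[leLHS]addr0 lerD ?(le_trans ler01)// ler_sqr ?nnegrE// hval_ge0.
Qed.

Let lyapunov_measurable : measurable_fun setT (lyapunov h theta).
Proof.
apply: (measurableT_comp (measurable_powR theta)); apply: measurable_funD.
  by apply: measurable_funX; exact: measurable_radius.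
exact: measurableT_comp (continuous_measurable S_borel h_continuous) measurable_snd.
Qed.

Lemma tau_moment_finite (c s : R) : 0 < c -> 0 <= s -> s < theta ->
  {ae P, forall w n, r < X n w -> (\int[Ks (xi n w)]_z (lyapunov h theta z)%:E <=
     (expR (- (c / X n w ^+ 2)) * lyapunov h theta (xi n w))%:E)%E} ->
  (tau_moment P X r s < +oo)%E.
Proof.
move=> c0 s0 sth drift.
have mD n : measurable (above xi r n) by exact: measurable_above process _ _.
set f0 := lyapunov h theta (x0, u0).
have f00 : 0 <= f0 by exact: le_trans (lyapunov_ge1 _).
have bound n (y : R) : 0 < y -> fine (P (above xi r n)) <=
    f0 * (expR (- (c / y ^+ 2) * n%:R) + ((y ^+ 2) `^ theta)^-1).
  (* Leaving through y costs M = y^(2 theta), the lower bound of f there. *)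
  move=> y0; have M0 : 0 < (y ^+ 2) `^ theta by rewrite powR_gt0// exprn_gt0.
  have [le1 le2] := exit_bound process c0 y0 lyapunov_measurable lyapunov_ge1 (ltW M0)
    (fun z => @lyapunov_ge y z (ltW y0)) drift r_ge0 n.
  have mE : measurable (above xi r n `\` between xi r y n).
    by apply: measurableD => //; exact: measurable_between process _ _ _.
  have fD : P (above xi r n) \is a fin_num by exact: fin_num_measure.
  have fE : P (above xi r n `\` between xi r y n) \is a fin_num.
    exact: fin_num_measure.
  move: le1 le2; rewrite -(fineK fD) -(fineK fE) -EFinD -EFinM !lee_fin -/f0.
  move=> le1 le2; apply: (le_trans le1).
  rewrite mulrDr [f0 * expR _]mulrC lerD2l.
  by rewrite ler_pdivlMr// mulrC.
have [K [rho [K0 rho0 rho1 HK]]] := tail_geometric f00 c0 s0 sth bound.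
exact: tau_moment_lty s0 mD K0 rho0 rho1 HK.
Qed.

(** With B = (r^2 + H)^theta and Q = (8 lam N)^theta, the capped function is at most B/Q up to
    radius r and at least 4 B/Q at the start. Losing no more than half of it in N steps leaves 2 B/Q
    - B/Q >= 1/Q for the probability; this is the origin of the factor 4 in the premise. *)
Lemma survival_probability (lam : R) N : 0 < lam -> r < hval x0 ->
  4 * (r ^+ 2 + H) `^ theta <= (hval x0 ^+ 2) `^ theta ->
  (forall y, 0 < y -> {ae P, forall w n, r < X n w ->
    (1 - lam / y ^+ 2) * capped h theta y (xi n w) <=
      \int[Ks (xi n w)]_z capped h theta y z}) ->
  (0 < N)%N -> 4 * r ^+ 2 <= 2 * lam * N%:R -> hval x0 ^+ 2 <= 8 * lam * N%:R ->
  (((8 * lam * N%:R) `^ theta)^-1%:E <= P (above xi r N))%E.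
Proof.
move=> lam0 rx0 x0B drift N0 rN xN.
have N0' : 0 < N%:R :> R by rewrite ltr0n.
have N1 : 1 <= N%:R :> R by rewrite ler1n.
have Y0 : 0 < 2 * lam * N%:R by rewrite !mulr_gt0.
(* This level makes the loss per step 1/(2 N), so Bernoulli's inequality keeps a factor 1/2 over N
   steps. *)
pose y := Num.sqrt (2 * lam * N%:R).
have y2 : y ^+ 2 = 2 * lam * N%:R by rewrite sqr_sqrtr// ltW.
have y0 : 0 < y by rewrite sqrtr_gt0.
have Q4 : 4 * y ^+ 2 = 8 * lam * N%:R by rewrite y2; ring.
set Q := (8 * lam * N%:R) `^ theta.
have Q0 : 0 < Q by rewrite powR_gt0// !mulr_gt0.
set B := (r ^+ 2 + H) `^ theta in x0B.
have B1 : 1 <= B.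
  have := lyapunov_le (z := (NngNum r_ge0 : halfline R, u0)) (lexx r).
  exact: le_trans (lyapunov_ge1 _).
have B0 : 0 <= B by exact: le_trans B1.
have [[mG _] G01] := capped_bounded S_borel theta h_continuous y0.
have lamy : lam / y ^+ 2 = (2 * N%:R)^-1.
  by rewrite y2 !invfM; field; rewrite !gt_eqF.
have a01 : 0 <= (2 * N%:R : R)^-1 <= 1.
  by rewrite invr_ge0 mulr_ge0//= invf_le1 ?mulr_gt0//; lra.
have kap0 : 0 <= 1 - lam / y ^+ 2 by rewrite lamy; lra.
have kap1 : 1 - lam / y ^+ 2 <= 1 by rewrite lamy; lra.
have r2y : 2 * r <= y.
  rewrite -ler_sqr ?nnegrE ?(ltW y0)// ?mulr_ge0// y2 exprMn.
  by apply: le_trans rN; lra.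
(* Since 2 r <= y, [bump] is nonpositive up to radius r, and only the Lyapunov part counts. *)
have Gm z : hval z.1 <= r -> capped h theta y z <= B / Q.
  move=> zr; rewrite /capped ge_max ge_min Q4 -/Q; apply/andP; split.
    by rewrite ler_pM2r ?invr_gt0// lyapunov_le.
  apply: (@le_trans _ _ 0); last by rewrite divr_ge0// ltW.
  rewrite /bump subr_le0 ler_pdivlMr ?exprn_gt0// mul1r.
  rewrite (_ : y ^+ 2 = 4 * (y / 2) ^+ 2); last by field.
  rewrite ler_pM2l// ler_sqr ?nnegrE; first by rewrite le_max; apply/orP; right; lra.
  - by rewrite divr_ge0// ltW.
  - by rewrite le_max lexx.
have G0 : 4 * B / Q <= capped h theta y (x0, u0).
  have xQ : (hval x0 ^+ 2) `^ theta <= Q.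
    by rewrite ge0_ler_powR ?nnegrE ?sqr_ge0 ?(ltW theta_gt0)// !mulr_ge0 ?ltW.
  rewrite /capped le_max le_min Q4 -/Q; apply/orP; left; apply/andP; split.
    rewrite ler_pM2r ?invr_gt0// (le_trans x0B)//.
    by apply: lyapunov_ge => //; exact: hval_ge0.
  by rewrite ler_pdivrMr// mul1r (le_trans x0B).
have := survival_bound process mG G01 kap0 kap1 (divr_ge0 B0 (ltW Q0)) Gm rx0
  (drift y y0) N.
have fD : P (above xi r N) \is a fin_num.
  by apply: fin_num_measure; exact: measurable_above process _ _.
rewrite -(fineK fD) -EFinD !lee_fin => HP.
have half : 2^-1 <= (1 - lam / y ^+ 2) ^+ N.
  apply: le_trans (bernoulli_expr N _); last by rewrite lamy.
  rewrite lamy -[_^-1 *+ N]mulr_natr (_ : (2 * N%:R)^-1 * N%:R = 2^-1); first by lra.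
  by rewrite invfM -mulrA mulVf ?mulr1// gt_eqF.
have prod : 2^-1 * (4 * B / Q) <= (1 - lam / y ^+ 2) ^+ N * capped h theta y (x0, u0).
  by apply: ler_pM => //; rewrite divr_ge0 ?mulr_ge0// ltW.
have QB : Q^-1 <= B / Q by rewrite ler_peMl// invr_ge0 ltW.
have e4 : 2^-1 * (4 * B / Q) = 2 * (B / Q) by field; rewrite gt_eqF.
move: HP prod QB; rewrite e4; move: (B / Q) => ?; lra.
Qed.

(** The moment is at least n^s times the survival probability, hence at least a multiple of n^(s -
    theta). The drift holds only above r, which may exceed the prescribed level r'; survival above r
    implies survival above r'. *)
Lemma tau_moment_infinite (lam r' s : R) : 0 < lam -> r' <= r -> theta < s ->
  r < hval x0 -> 4 * (r ^+ 2 + H) `^ theta <= (hval x0 ^+ 2) `^ theta ->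
  (forall y, 0 < y -> {ae P, forall w n, r < X n w ->
    (1 - lam / y ^+ 2) * capped h theta y (xi n w) <=
      \int[Ks (xi n w)]_z capped h theta y z}) ->
  tau_moment P X r' s = +oo%E.
Proof.
move=> lam0 rr' ths rx0 x0B drift.
have s0 : 0 <= s by rewrite ltW// (lt_trans theta_gt0).
apply/eqyP => A A0.
have sth0 : 0 < s - theta by rewrite subr_gt0.
have [N1 N10 HN1] := powR_ge_near (A * (8 * lam) `^ theta) sth0.
have [n _ /(_ n (leqnn n)) /= nM] := nbhs_infty_ger
  (N1 + 1 + 4 * r ^+ 2 / (2 * lam) + hval x0 ^+ 2 / (8 * lam)).
have a1 : 0 <= 4 * r ^+ 2 / (2 * lam) by rewrite divr_ge0 ?mulr_ge0 ?sqr_ge0// ltW.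
have a2 : 0 <= hval x0 ^+ 2 / (8 * lam) by rewrite divr_ge0 ?sqr_ge0// mulr_ge0// ltW.
have n0 : 0 < n%:R :> R by lra.
have rn : 4 * r ^+ 2 <= 2 * lam * n%:R.
  by rewrite -ler_pdivrMl ?mulr_gt0// mulrC; lra.
have xn : hval x0 ^+ 2 <= 8 * lam * n%:R.
  by rewrite -ler_pdivrMl ?mulr_gt0// mulrC; lra.
have n0' : (0 < n)%N by rewrite -(ltr0n R).
have Psur := survival_probability lam0 rx0 x0B drift n0' rn xn.
have mD : measurable (above xi r' n) by exact: measurable_above process _ _.
apply: le_trans (@tau_moment_ge _ _ _ P X r' s n s0 mD).
have sub : (P (above xi r n) <= P (above xi r' n))%E.
  apply: le_measure; rewrite ?inE//; first exact: measurable_above process _ _.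
  by move=> w Hw k kn; exact: le_lt_trans rr' (Hw k kn).
have Psub := le_trans Psur sub.
have ns0 : (0 <= (n%:R `^ s)%:E)%E by rewrite lee_fin powR_ge0.
apply: le_trans (lee_wpmul2l ns0 Psub).
have l80 : 0 < 8 * lam by rewrite mulr_gt0.
rewrite -EFinM lee_fin ler_pdivlMr ?powR_gt0 ?mulr_gt0//.
rewrite powRM ?(ltW l80)// mulrA.
have -> : n%:R `^ s = n%:R `^ (s - theta) * n%:R `^ theta.
  by rewrite -powRD ?subrK// (gt_eqF n0) implybT.
by rewrite ler_wpM2r ?powR_ge0// HN1//; lra.
Qed.

End conclusion.

(** Allows theta to be lowered to an exponent within reach of the moment bound while delta stays
    negative. *)
Lemma delta_homo (R : realType) (d : measure_display) (S : measurableMetricType R d)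
    (S_compact : compact [set: S])
    (S_borel : @measurable d S = <<s @open S >>) (pi : probability S R)
    (e sigma2 : S -> R) (th1 th2 : R) :
  continuous e -> continuous sigma2 -> (forall u, 0 <= sigma2 u) -> th1 <= th2 ->
  delta pi e sigma2 th1 <= delta pi e sigma2 th2.
Proof.
move=> ce cs s0 th12.
have bg th : bounded_measurable (fun u => 2 * e u + (2 * th - 1) * sigma2 u).
  apply: (continuous_bounded_measurable S_compact S_borel) => u.
  by apply: cvgD; apply: cvgM; by [exact: cvg_cst|exact: ce|exact: cs].
apply: le_Rintegral => //; [exact: bounded_measurable_integrable..|].
by move=> u _; rewrite lerD2l ler_wpM2r//; lra.
Qed.

Theorem theorem2p3
  (R : realType) (d : measure_display) (S : measurableMetricType R d)
  (S_compact : compact [set: S])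
  (S_borel : @measurable d S = <<s @open S >>)
  (Ks : R.-pker (halfline R * S)%type ~> (halfline R * S)%type)
  (K : R.-pker S ~> S) (pi : probability S R)
  (p q xB Bp Bq : R) (e sigma2 : S -> R)
  (* limiting kernel *)
  (K_invariant : invariant_probability K pi)
  (K_unique : forall nu : probability S R, invariant_probability K nu ->
     forall B : set S, measurable B -> nu B = pi B)
  (K_continuous : forall u : S, tv_dist (K v) (K u) @[v --> u] --> 0%E)
  (* asymptotic Markovianity *)
  (asymptotically_markov :
     ereal_sup [set tv_norm_sub (angular_kernel Ks x u) (K u) | u in [set: S]]
       @[x --> @halfline_pinfty R] --> 0%E)
  (* constants of the moment bounds *)
  (hp : 2 < p) (hq : 2 <= q) (hxB : 0 <= xB)
  (* strict Lamperti regime *)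
  (e_continuous : continuous e) (sigma2_continuous : continuous sigma2)
  (drift : littleo_pinfty
     (fun x => ereal_sup
        [set `|increment_moment Ks 1 x u - (e u / hval x)%:E|%E | u in [set: S]])
     (fun x => (hval x)^-1))
  (variance : littleo_pinfty
     (fun x => ereal_sup
        [set `|increment_moment Ks 2 x u - (sigma2 u)%:E|%E | u in [set: S]])
     (fun=> 1)) :
  (* (a) *)
  (forall theta : R, 0 < theta -> delta pi e sigma2 theta < 0 ->
   forall s : R, 0 <= s -> s < Num.min theta (Num.min (p / 2) (q / 2)) ->
   exists2 r1 : R, 0 <= r1 &
   forall (x0 : halfline R) (u0 : S)
     (dO : measure_display) (Omega : measurableType dO) (P : probability Omega R)
     (F : nat -> set (set Omega)) (xi : nat -> Omega -> halfline R * S),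
   halfstrip_process P Ks x0 u0 F xi ->
   nonconfined P (radial xi) ->
   moment_bounds P F (radial xi) p q xB Bp Bq ->
   forall r : R, r1 <= r -> (tau_moment P (radial xi) r s < +oo)%E)
  /\
  (* (b) *)
  (forall theta : R, 0 < theta -> theta <= Num.min (p / 2) (q / 2) ->
   0 < delta pi e sigma2 theta ->
   forall s : R, theta < s ->
   forall r : R, 0 <= r ->
   exists2 r1 : R, r < r1 &
   forall (x0 : halfline R) (u0 : S)
     (dO : measure_display) (Omega : measurableType dO) (P : probability Omega R)
     (F : nat -> set (set Omega)) (xi : nat -> Omega -> halfline R * S),
   r1 < hval x0 ->
   halfstrip_process P Ks x0 u0 F xi ->
   nonconfined P (radial xi) ->
   moment_bounds P F (radial xi) p q xB Bp Bq ->
   tau_moment P (radial xi) r s = +oo%E).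
Proof.
have var0 := variance_ge0 variance.
pose B' := `|Bp| + 1.
split=> [theta theta0 dneg s s0|theta theta0 thpq dpos s ths r r0].
  set m := Num.min theta _ => sm.
  have [mth mp] : m <= theta /\ 2 * m <= p.
    split; first by rewrite ge_min lexx.
    have : m <= p / 2 by rewrite !ge_min lexx orbT.
    by rewrite ler_pdivlMr// mulrC.
  (* The midpoint still exceeds s, is at most p/2, and does not exceed theta, so its delta remains
     negative. *)
  pose th := (s + m) / 2.
  have [sth thm] : s < th /\ th <= m by rewrite /th; split; lra.
  have th0 : 0 < th by exact: le_lt_trans sth.
  have thp : 2 * th <= p by lra.
  have dneg' : delta pi e sigma2 th < 0.
    apply: le_lt_trans dneg; apply: delta_homo => //.
    exact: le_trans mth.
  have [h [H [c [x1 [ch hH c0 x10 up]]]]] := drift_upper S_compact S_borel B'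
    K_unique K_continuous asymptotically_markov hp e_continuous sigma2_continuous
    drift variance th0 thp dneg'.
  exists (Num.max x1 xB); first by rewrite le_max hxB orbT.
  move=> x0 u0 dO Omega P F xi process _ moments r; rewrite ge_max => /andP[x1r xBr].
  apply: (tau_moment_finite S_borel process ch hH th0 (le_trans hxB xBr) c0 s0 sth).
  apply: filterS (moment_ok_ae process moments) => w ok n rX.
  have := up (xi n w).1 (xi n w).2 (le_lt_trans x1r rX)
    (ok n (le_trans xBr (ltW rX))).
  by rewrite -surjective_pairing.
have thp : 2 * theta <= p.
  have : theta <= p / 2 by rewrite (le_trans thpq)// ge_min lexx.
  by rewrite ler_pdivlMr// mulrC.
have [h [H [lam [x1 [ch hH lam0 x10 lo]]]]] := drift_lower S_compact S_borel B'
  K_unique K_continuous asymptotically_markov hp e_continuous sigma2_continuous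
  drift variance theta0 thp dpos.
(* The level is raised to where the drift and the moment bounds are available. *)
pose r' := Num.max r (Num.max x1 xB).
have rr' : r <= r' by rewrite le_max lexx.
have x1r' : x1 <= r' by rewrite !le_max lexx orbT.
have xBr' : xB <= r' by rewrite !le_max lexx !orbT.
have r'0 : 0 <= r' by exact: le_trans rr'.
have [A A0 HA] := powR_ge_near (4 * (r' ^+ 2 + H) `^ theta) theta0.
(* The summand 1 gives x0 >= 1, hence x0^2 >= x0 >= A, which is what [HA] is applied to. *)
exists (r' + A + 1); first lra.
move=> x0 u0 dO Omega P F xi x0r process _ moments.
have x0B : 4 * (r' ^+ 2 + H) `^ theta <= (hval x0 ^+ 2) `^ theta.
  by apply: HA; rewrite expr2; nra.
have r'x0 : r' < hval x0 by lra.
apply: (tau_moment_infinite S_borel process ch hH theta0 r'0 lam0 rr' ths r'x0 x0B).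
move=> y y0; apply: filterS (moment_ok_ae process moments) => w ok n rX.
have := lo y (xi n w).1 (xi n w).2 y0 (le_lt_trans x1r' rX)
  (ok n (le_trans xBr' (ltW rX))).
by rewrite -surjective_pairing.
Qed.
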